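(* Let $m$ be a positive integer, let $K\in C^{[m]}(I^2)$ be independent of $\kappa$, let $f\in\tilde H^m_{\kappa,0}(I)$, and assume $1$ is not an eigenvalue of $\mathcal{K}$ for any $\kappa>1$, where $(\mathcal{K}u)(s)=\int_IK(s,t)e^{i\kappa|s-t|}u(t)\,dt$. Let $y$ be the solution of $y-\mathcal{K}y=f$. Then for sufficiently large $\kappa$ there exist a positive constant $c$ independent of $\kappa$ and $h_0>0$ such that for all partitions with mesh size $0<h<h_0$, the oscillation preserving Galerkin method has a unique solution $y_h\in V^m_{\kappa,h}$, and it satisfies $$\|y-y_h\|_2\le c\,h^m\,\|y\|_{\tilde H^m_{\kappa,0}}.$$
   Context: $I=[-1,1]$; $\kappa\in(1,\infty)$; functions are complex-valued; a $\kappa$-parameterized function is a family indexed by $\kappa>1$; ''independent of $\kappa$'' means a fixed function. $C^{[m]}(I^2)$: functions on $I^2$ with continuous $\partial_s^\alpha\partial_t^\beta$ derivatives, $\alpha,\beta\le m$. $\|u\|_2=(\int_I|u|^2)^{1/2}$, $(u,v)=\int_Iu\bar v$. $H^m(I)$ is the Sobolev space with $\|u\|_{H^m}=(\sum_{j=0}^m\|u^{(j)}\|_2^2)^{1/2}$. $H^m_{\kappa,0}(I)$: $\kappa$-parameterized $u\in H^m(I)$ with $\|u\|_{H^m}\le c$ for all $\kappa\ge\kappa_0$, some $c,\kappa_0>0$. $\tilde H^m_{\kappa,0}(I)=\{w_1e^{i\kappa t}+w_2e^{-i\kappa t}+w_3:w_j\in H^m_{\kappa,0}(I)\}$, with $\|u\|_{\tilde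 H^m_{\kappa,0}}=\inf\{(\sum_{j=1}^3\|w_j\|_{H^m}^2)^{1/2}:u=w_1e^{i\kappa\cdot}+w_2e^{-i\kappa\cdot}+w_3,\ w_j\in H^m_{\kappa,0}(I)\}$. Given a partition $-1=t_0<t_1<\dots<t_{N+1}=1$ with $h=\max_j(t_j-t_{j-1})$, $S_h^m$ is the space of $C^{m-2}(I)$ functions that are polynomials of degree less than $m$ on each $(t_{j-1},t_j)$ (splines of order $m$). $V^m_{\kappa,h}=\{w_1e^{i\kappa\cdot}+w_2e^{-i\kappa\cdot}+w_3:w_1,w_2,w_3\in S_h^m\}$. The oscillation preserving Galerkin method seeks $y_h\in V^m_{\kappa,h}$ with $(y_h,v_h)=(\mathcal{K}y_h,v_h)+(f,v_h)$ for all $v_h\in V^m_{\kappa,h}$, equivalently $y_h=\mathcal{P}_h\mathcal{K}y_h+\mathcal{P}_hf$ with $\mathcal{P}_h$ the $L^2(I)$-orthogonal projection onto $V^m_{\kappa,h}$. *)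

(* Defs.v *)
(* MathComp + MathComp-Analysis (R : realType), complex numbers R[i]
   from mathcomp-real-closed.  Complex-valued functions on I = [-1,1];
   integrals of complex functions are taken componentwise with the
   Lebesgue integral on R. *)
From HB Require Import structures.
From mathcomp Require Import all_boot all_order all_algebra.
From mathcomp Require Import all_classical all_reals all_analysis.
From mathcomp Require Import complex.
Set Implicit Arguments. Unset Strict Implicit. Unset Printing Implicit Defensive.
Import Order.TTheory GRing.Theory Num.Theory.
Import numFieldNormedType.Exports.
Local Open Scope classical_set_scope.
Local Open Scope ring_scope.
Local Open Scope complex_scope.

Section Defs.
Variable R : realType.
Local Notation C := (R[i]).
Local Notation mu := (@lebesgue_measure R).

(* the interval I = [-1,1] *)
Definition Iset : set R := `[-1, 1]%classic.

(* squared modulus of a complex number *)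
Definition cre (z : C) : R := complex.Re z.
Definition cim (z : C) : R := complex.Im z.

Definition csq (z : C) : R := cre z ^+ 2 + cim z ^+ 2.

(* complex exponential e^{i x} *)
Definition cexpi (x : R) : C := (cos x) +i* (sin x).

(* integral over I of a complex-valued function (componentwise) *)
Definition Cint (u : R -> C) : C :=
  (Rintegral mu Iset (fun x => cre (u x))) +i* (Rintegral mu Iset (fun x => cim (u x))).

(* u belongs to L^2(I) *)
Definition L2 (u : R -> C) : Prop :=
  [/\ measurable_fun Iset (fun x => cre (u x)),
      measurable_fun Iset (fun x => cim (u x)) &
      (\int[mu]_(x in Iset) (csq (u x))%:E < +oo)%E].

(* ||u||_2 *)
Definition L2norm (u : R -> C) : R := Num.sqrt (Rintegral mu Iset (fun x => csq (u x))).

(* (u, v) = int_I u conj(v) *)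
Definition ip (u v : R -> C) : C := Cint (fun x => u x * (v x)^*).

(* equality almost everywhere on I *)
Definition aeI (u v : R -> C) : Prop := {ae mu, forall x, Iset x -> u x = v x}.

(* smooth test functions with compact support in (-1,1) *)
Definition test_fun (phi : R -> R) : Prop :=
  (forall (n : nat) (x : R), derivable (derive1n n phi) x 1) /\
  exists a b : R, [/\ -1 < a, b < 1 &
    forall x, (x <= a \/ b <= x) -> phi x = 0].

(* g is the weak derivative of u on I *)
Definition weak_deriv (u g : R -> C) : Prop :=
  forall phi, test_fun phi ->
    Cint (fun x => u x * ((derive1 phi x)%:C)) = - Cint (fun x => g x * ((phi x)%:C)).

(* D is a chain of weak derivatives D 0 = u, D 1 = u', ..., D m = u^(m), all in L^2 *)
Definition Hm_chain (m : nat) (u : R -> C) (D : nat -> R -> C) : Prop :=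
  [/\ aeI (D 0%N) u,
      (forall j, (j <= m)%N -> L2 (D j)) &
      (forall j, (j < m)%N -> weak_deriv (D j) (D j.+1))].

(* Sobolev space H^m(I) *)
Definition Hm (m : nat) (u : R -> C) : Prop := exists D, Hm_chain m u D.

(* ||u||_{H^m} = (sum_{j<=m} ||u^(j)||_2^2)^(1/2)  (weak derivatives are unique
   a.e., so the infimum over chains is attained by the unique value) *)
Definition Hm_norm (m : nat) (u : R -> C) : R :=
  fine (ereal_inf [set (Num.sqrt (\sum_(j < m.+1) L2norm (D j) ^+ 2))%:E
                  | D in [set D | Hm_chain m u D]]).

(* kappa-parameterized families: w : R -> (R -> C), w kappa is the member at kappa *)
(* H^m_{kappa,0}(I) *)
Definition Hm0 (m : nat) (w : R -> R -> C) : Prop :=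
  (forall kappa, 1 < kappa -> Hm m (w kappa)) /\
  exists c kappa0 : R, [/\ 0 < c, 0 < kappa0 &
    forall kappa, kappa0 <= kappa -> Hm_norm m (w kappa) <= c].

(* u = w1 e^{i kappa .} + w2 e^{-i kappa .} + w3 on I (in L^2 sense) *)
Definition osc_decomp (u w1 w2 w3 : R -> R -> C) : Prop :=
  forall kappa, 1 < kappa ->
    aeI (u kappa) (fun x => w1 kappa x * cexpi (kappa * x)
                          + w2 kappa x * cexpi (- (kappa * x)) + w3 kappa x).

(* tilde H^m_{kappa,0}(I) *)
Definition tHm0 (m : nat) (u : R -> R -> C) : Prop :=
  exists w1 w2 w3, [/\ Hm0 m w1, Hm0 m w2, Hm0 m w3 & osc_decomp u w1 w2 w3].

(* ||u||_{tilde H^m_{kappa,0}} at parameter value kappa (extended real; +oo if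
   the defining set is empty) *)
Definition tHm0_norm (m : nat) (u : R -> R -> C) (kappa : R) : \bar R :=
  ereal_inf [set (Num.sqrt (Hm_norm m (w.1.1 kappa) ^+ 2 + Hm_norm m (w.1.2 kappa) ^+ 2
                            + Hm_norm m (w.2 kappa) ^+ 2))%:E
            | w in [set w : (R -> R -> C) * (R -> R -> C) * (R -> R -> C) |
                     [/\ Hm0 m w.1.1, Hm0 m w.1.2, Hm0 m w.2 &
                         osc_decomp u w.1.1 w.1.2 w.2]]].

(* complex-valued derivative (componentwise) *)
Definition cderiv (x : R) (f : R -> C) (l : C) : Prop :=
  is_derive x 1 (fun y => cre (f y)) (cre l) /\ is_derive x 1 (fun y => cim (f y)) (cim l).

(* K in C^{[m]}(I^2): all partial derivatives d_s^a d_t^b K, a,b <= m,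
   exist and are continuous on I^2.  D a b stands for d_s^a d_t^b K. *)
Definition Cm_sq (m : nat) (K : R -> R -> C) : Prop :=
  exists D : nat -> nat -> R -> R -> C,
  [/\ (forall s t : R, Iset s -> Iset t -> D 0%N 0%N s t = K s t),
      (forall b (s t : R), (b < m)%N -> Iset s -> -1 < t < 1 ->
          cderiv t (fun t' => D 0%N b s t') (D 0%N b.+1 s t)),
      (forall a b (s t : R), (a < m)%N -> (b <= m)%N -> -1 < s < 1 -> Iset t ->
          cderiv s (fun s' => D a b s' t) (D a.+1 b s t)) &
      (forall a b, (a <= m)%N -> (b <= m)%N ->
          {within [set p : R * R | Iset p.1 /\ Iset p.2],
             continuous (fun p : R * R => cre (D a b p.1 p.2))} /\
          {within [set p : R * R | Iset p.1 /\ Iset p.2],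
             continuous (fun p : R * R => cim (D a b p.1 p.2))})].

(* the integral operator (K_kappa u)(s) = int_I K(s,t) e^{i kappa |s-t|} u(t) dt *)
Definition Kop (K : R -> R -> C) (kappa : R) (u : R -> C) : R -> C :=
  fun s => Cint (fun t => K s t * cexpi (kappa * `|s - t|) * u t).

(* 1 is an eigenvalue of K_kappa on L^2(I) *)
Definition one_is_eigenvalue (K : R -> R -> C) (kappa : R) : Prop :=
  exists u, [/\ L2 u, ~ aeI u (fun _ => 0) & aeI (Kop K kappa u) u].

(* partition -1 = t_0 < t_1 < ... < t_{N+1} = 1 *)
Definition is_partition (N : nat) (t : nat -> R) : Prop :=
  [/\ t 0%N = -1, t N.+1 = 1 & forall j, (j <= N)%N -> t j < t j.+1].

(* mesh size h = max_j (t_j - t_{j-1}) *)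
Definition mesh (N : nat) (t : nat -> R) : R :=
  \big[Num.max/0]_(j < N.+1) (t j.+1 - t j).

(* real f is in C^k(I): derivatives up to order k exist in (-1,1) and extend
   continuously to I *)
Definition Ck_on (k : nat) (f : R -> R) : Prop :=
  exists g : nat -> R -> R,
  [/\ (forall x, Iset x -> g 0%N x = f x),
      (forall j, (j <= k)%N -> {within Iset, continuous (g j)}) &
      (forall j (x : R), (j < k)%N -> -1 < x < 1 -> is_derive x 1 (g j) (g j.+1 x))].

(* S_h^m: C^{m-2}(I) functions, polynomial of degree < m on each (t_{j-1},t_j);
   for m = 1 no continuity is required *)
Definition spline (m N : nat) (t : nat -> R) (s : R -> C) : Prop :=
  (forall j, (j <= N)%N -> exists p : {poly C},
      (size p <= m)%N /\ forall x, t j < x < t j.+1 -> s x = p.[x%:C]) /\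
  ((2 <= m)%N -> Ck_on (m - 2) (fun x => cre (s x)) /\ Ck_on (m - 2) (fun x => cim (s x))).

(* V^m_{kappa,h} *)
Definition Vspace (m : nat) (kappa : R) (N : nat) (t : nat -> R) (v : R -> C) : Prop :=
  exists s1 s2 s3, [/\ spline m N t s1, spline m N t s2, spline m N t s3 &
    forall x, v x = s1 x * cexpi (kappa * x) + s2 x * cexpi (- (kappa * x)) + s3 x].

(* y_h solves the oscillation preserving Galerkin equations *)
Definition galerkin_sol (m : nat) (K : R -> R -> C) (kappa : R) (f : R -> C)
    (N : nat) (t : nat -> R) (yh : R -> C) : Prop :=
  Vspace m kappa N t yh /\
  forall v, Vspace m kappa N t v -> ip yh v = ip (Kop K kappa yh) v + ip f v.

End Defs.

(* Main.v *)
(* The operator splits as K = V+ + V-, where V+ (resp. V-) integrates over t < s (resp.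
   t > s) and is, up to the unimodular factors e^{+-i kappa s}, a Volterra operator with a
   kernel independent of kappa.  By Gronwall's lemma I - V+ and I - V- are bounded below
   uniformly in kappa, while V+ V- tends to 0 with 1/kappa because its kernel oscillates
   (Riemann-Lebesgue); since (I - V+)(I - V-) = I - K + V+ V-, also I - K is bounded below
   uniformly for large kappa.  The functions
   e^{-+i kappa s} V+-u are equicontinuous on the unit ball of L^2, so K u is close to the
   trial space when the mesh is small.  If the residual e - K e of e = y - y_h is
   orthogonal to the trial space, it is no longer than its distance to that space, which
   gives quasi-optimality, and injectivity, hence solvability, of the discrete equations.
   There remains the error O(h^m) of spline approximation in H^m on arbitrary partitions:
   integrating a good spline for w' reduces it to a first order estimate for splines of
   any order, and this one holds for sums of increments of w times smooth steps, each of
   which lives on a block of 2^(m-1) consecutive knots. *)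
Require Import Defs.
From HB Require Import structures.
From mathcomp Require Import all_boot all_order all_algebra.
From mathcomp Require Import all_classical all_reals all_analysis.
From mathcomp Require Import complex.
From mathcomp Require Import measurable_realfun.
From mathcomp Require Import ring lra.
Import Order.TTheory GRing.Theory Num.Theory.
Import numFieldNormedType.Exports.
Local Open Scope classical_set_scope.
Local Open Scope ring_scope.
Local Open Scope complex_scope.
Set Implicit Arguments. Unset Strict Implicit. Unset Printing Implicit Defensive.

(** * Integration on a segment *)

(** The obstacle is uniformity in [kappa]: the operators need not shrink as [kappa] grows, and
    compactness of each of them separately yields no common constant. Once the unimodular factors
    are pulled out, bounds that use only absolute values, and the modulus of continuity of what
    remains, do not see [kappa]; only the product V+ V- does, because there the two phases add up to
    e^{-2 i kappa r} instead of cancelling. For the same reason the bound on the mesh is found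
    before [kappa] is fixed. Functions are kept as functions, not as classes modulo null sets, so
    the inner product is only semidefinite and linear algebra is done modulo its null vectors.
    Scalars are real: the imaginary part of the Galerkin equations is recovered by testing with ['i]
    times a trial function. No ratio of neighbouring mesh sizes is bounded, so nothing may be
    divided by the length of a cell. Truncated powers suit this: they are stable under integration,
    and the smooth steps built from them are bounded by 1 whatever the spacing of the knots. *)

Section RealIntegrals.
Variable R : realType.
Local Notation mu := (@lebesgue_measure R).
Implicit Types (f g : R -> R) (a b c : R).

Definition rint a b f : Prop := mu.-integrable `[a, b] (EFin \o f).
Definition sqint a b f : Prop :=
  measurable_fun `[a, b] f /\ rint a b (fun x => f x ^+ 2).
Definition Int a b f : R := \int[mu]_(x in `[a, b]) f x.

Lemma mu_itv_lty a b : (mu `[a, b]%classic < +oo)%E.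
Proof. by rewrite lebesgue_measure_itv/=; case: ifP => // _; rewrite -EFinB ltry. Qed.

Lemma rint_measurable a b f : rint a b f -> measurable_fun `[a, b] f.
Proof. by move=> /measurable_int /measurable_EFinP. Qed.

Lemma rint_le a b f g : measurable_fun `[a, b] f ->
  (forall x, a <= x <= b -> `|f x| <= g x) -> rint a b g -> rint a b f.
Proof.
move=> mf fg ig; apply: (le_integrable _ _ _ ig) => //.
  exact/measurable_EFinP.
move=> x /=; rewrite in_itv/= => xab; rewrite lee_fin.
by apply: (le_trans (fg _ xab)); exact: ler_norm.
Qed.

Lemma rint_cst a b c : rint a b (fun=> c).
Proof.
apply: measurable_bounded_integrable => //; first exact: mu_itv_lty.
exists `|c|; split; [exact: num_real|move=> M /ltW cM].
by move=> x _ /=.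
Qed.

Lemma rint_bounded a b f M : measurable_fun `[a, b] f ->
  (forall x, a <= x <= b -> `|f x| <= M) -> rint a b f.
Proof. by move=> mf fM; apply: (rint_le mf fM); exact: rint_cst. Qed.

Lemma rint_eq a b f g : (forall x, a <= x <= b -> f x = g x) ->
  rint a b f -> rint a b g.
Proof.
move=> fg; apply: eq_integrable => // x; rewrite inE/= in_itv/= => xab.
by rewrite /= fg.
Qed.

Lemma rintD a b f g : rint a b f -> rint a b g -> rint a b (fun x => f x + g x).
Proof. by move=> rf rg; exact: (integrableD _ rf rg). Qed.

Lemma rintN a b f : rint a b f -> rint a b (fun x => - f x).
Proof. by move=> rf; exact: (integrableN rf). Qed.

Lemma rintB a b f g : rint a b f -> rint a b g -> rint a b (fun x => f x - g x).
Proof. by move=> rf rg; exact: rintD rf (rintN rg). Qed.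

Lemma rintZ a b k f : rint a b f -> rint a b (fun x => k * f x).
Proof. by move=> rf; exact: (integrableZl _ k rf). Qed.

Lemma rint_abs a b f : rint a b f -> rint a b (fun x => `|f x|).
Proof. by move=> rf; exact: (integrable_norm rf). Qed.

Lemma rintM_bounded a b f g M : measurable_fun `[a, b] f ->
  (forall x, a <= x <= b -> `|f x| <= M) -> rint a b g ->
  rint a b (fun x => f x * g x).
Proof.
move=> mf fM rg; apply: (@rint_le _ _ _ (fun x => M * `|g x|)).
- by apply: measurable_funM => //; exact: rint_measurable rg.
- by move=> x /fM fxM; rewrite normrM ler_wpM2r.
- exact/rintZ/rint_abs.
Qed.

Lemma rint_sub a b c d f : a <= c -> d <= b -> rint a b f -> rint c d f.
Proof.
move=> ac db; apply: integrableS => //.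
by apply: subset_itv; rewrite bnd_simp.
Qed.

Lemma eq_Int a b f g : (forall x, a <= x <= b -> f x = g x) ->
  Int a b f = Int a b g.
Proof.
by move=> fg; apply: eq_Rintegral => x; rewrite inE/= in_itv/= => /fg.
Qed.

Lemma IntD a b f g : rint a b f -> rint a b g ->
  Int a b (fun x => f x + g x) = Int a b f + Int a b g.
Proof. by move=> rf rg; rewrite /Int RintegralD. Qed.

Lemma IntB a b f g : rint a b f -> rint a b g ->
  Int a b (fun x => f x - g x) = Int a b f - Int a b g.
Proof. by move=> rf rg; rewrite /Int RintegralB. Qed.

Lemma IntZ a b k f : rint a b f ->
  Int a b (fun x => k * f x) = k * Int a b f.
Proof. by move=> rf; rewrite /Int RintegralZl. Qed.

Lemma Int_cst a b c : a <= b -> Int a b (fun=> c) = c * (b - a).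
Proof.
move=> ab; rewrite /Int Rintegral_cst//; congr (_ * _).
rewrite [X in fine X]lebesgue_measure_itv/= lte_fin; case: ltP => //= ba.
by apply/eqP; rewrite eq_sym subr_eq0 eq_le ab ba.
Qed.

Lemma Int_id a f : Int a a f = 0.
Proof. by rewrite /Int set_itv1 Rintegral_set1. Qed.

Lemma Int_ge0 a b f : (forall x, a <= x <= b -> 0 <= f x) -> 0 <= Int a b f.
Proof. by move=> f0; apply: Rintegral_ge0 => x /=; rewrite in_itv/= => /f0. Qed.

Lemma le_Int a b f g : rint a b f -> rint a b g ->
  (forall x, a <= x <= b -> f x <= g x) -> Int a b f <= Int a b g.
Proof.
by move=> rf rg fg; apply: le_Rintegral => // x /=; rewrite in_itv/= => /fg.
Qed.

Lemma ler_norm_Int a b f : rint a b f -> `|Int a b f| <= Int a b (fun x => `|f x|).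
Proof. by move=> rf; exact: le_normr_Rintegral. Qed.

Lemma Int_split a b c f : a <= b -> b <= c -> rint a c f ->
  Int a c f = Int a b f + Int b c f.
Proof.
move=> ab bc rf; apply/eqP; rewrite addrC -subr_eq; apply/eqP.
rewrite /Int Rintegral_itvB ?bnd_simp//.
by rewrite Rintegral_itv_obnd_cbnd//; apply: integrableS rf => //;
  apply: subset_itv; rewrite bnd_simp.
Qed.

Lemma Int_mono a b c d f : a <= c -> c <= d -> d <= b -> rint a b f ->
  (forall x, a <= x <= b -> 0 <= f x) -> Int c d f <= Int a b f.
Proof.
move=> ac cd db rf f0.
rewrite (Int_split (le_trans ac cd) db)// (Int_split ac cd); last first.
  exact: rint_sub rf.
rewrite -[X in X <= _]addr0 -[X in X + 0]add0r lerD ?lerD ?Int_ge0// => x /andP[xa xb];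
  apply: f0; lra.
Qed.

(** No sign of [C] is known. For [C > 0] the hypothesis is used at the vertex, and otherwise at a
    point where the quadratic would be negative, except in the trivial case [B = C = 0]. *)
Lemma discriminant_le (A B C : R) :
  (forall l, 0 <= A + 2 * l * B + l ^+ 2 * C) -> B ^+ 2 <= A * C.
Proof.
move=> q; have A0 : 0 <= A by have := q 0; rewrite mulr0 mul0r expr0n/= mul0r !addr0.
have [C0|C0|C0] := ltgtP C 0; last first.
- have [->|B0] := eqVneq B 0; first by rewrite C0 expr0n/= mulr0.
  have := q (- (A + 1) / (2 * B)); rewrite C0 mulr0 addr0.
  have -> : A + 2 * (- (A + 1) / (2 * B)) * B = -1 by field.
  by move=> ?; lra.
- have := q (- B / C); have -> : A + 2 * (- B / C) * B + (- B / C) ^+ 2 * C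
     = (A * C - B ^+ 2) / C by field; rewrite gt_eqF.
  by rewrite pmulr_lge0 ?invr_gt0// subr_ge0.
- have [B0|B0] := leP 0 B.
    have := q (- ((A + 1) / (- C) + 1)).
    set t := (A + 1) / (- C).
    have t0 : 0 < t by rewrite divr_gt0 ?oppr_gt0// ltr_wpDl.
    have : t * C = - (A + 1) by rewrite /t; field; rewrite lt_eqF.
    nra.
  have := q ((A + 1) / (- C) + 1).
  set t := (A + 1) / (- C).
  have t0 : 0 < t by rewrite divr_gt0 ?oppr_gt0// ltr_wpDl.
  have : t * C = - (A + 1) by rewrite /t; field; rewrite lt_eqF.
  nra.
Qed.

Lemma sqintM a b f g : sqint a b f -> sqint a b g -> rint a b (fun x => f x * g x).
Proof.
move=> [mf rf] [mg rg]; apply: rint_le (rintD rf rg); first exact: measurable_funM.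
by move=> x _; rewrite normrM -[f x ^+ 2]real_normK ?num_real// -[g x ^+ 2]real_normK ?num_real//; nra.
Qed.

Lemma sqint_bounded a b f M : measurable_fun `[a, b] f ->
  (forall x, a <= x <= b -> `|f x| <= M) -> sqint a b f.
Proof.
move=> mf fM; split=> //; apply: (@rint_bounded _ _ _ (M ^+ 2)).
  exact: measurable_funX.
by move=> x /fM fxM; rewrite normrX lerXn2r// nnegrE// (le_trans _ fxM).
Qed.

Lemma sqint_rint a b f : sqint a b f -> rint a b f.
Proof.
move=> sf; have s1 : sqint a b (fun=> 1).
  by apply: (@sqint_bounded _ _ _ 1) => // x _; rewrite normr1.
by apply: rint_eq (sqintM sf s1) => x _; rewrite mulr1.
Qed.

Lemma sqint_eq a b f g : (forall x, a <= x <= b -> f x = g x) ->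
  sqint a b f -> sqint a b g.
Proof.
move=> fg [mf rf]; split.
  by apply: eq_measurable_fun mf => x; rewrite inE/= in_itv/= => /fg.
by apply: rint_eq rf => x /fg ->.
Qed.

Lemma sqintZ a b k f : sqint a b f -> sqint a b (fun x => k * f x).
Proof.
move=> [mf rf]; split; first exact: measurable_funM.
by apply: rint_eq (rintZ (k ^+ 2) rf) => x _; ring.
Qed.

Lemma sqintN a b f : sqint a b f -> sqint a b (fun x => - f x).
Proof. by move=> /(sqintZ (-1)); apply: sqint_eq => x _; rewrite mulN1r. Qed.

Lemma sqintD a b f g : sqint a b f -> sqint a b g -> sqint a b (fun x => f x + g x).
Proof.
move=> sf sg; split.
  by apply: measurable_funD; [case: sf|case: sg].
have := rintD (rintD sf.2 sg.2) (rintZ 2 (sqintM sf sg)).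
by apply: rint_eq => x _; ring.
Qed.

Lemma sqintB a b f g : sqint a b f -> sqint a b g -> sqint a b (fun x => f x - g x).
Proof. by move=> sf /sqintN; exact: sqintD. Qed.

Lemma sqintM_bounded a b f g M : measurable_fun `[a, b] f ->
  (forall x, a <= x <= b -> `|f x| <= M) -> sqint a b g ->
  sqint a b (fun x => f x * g x).
Proof.
move=> mf fM [mg rg]; split; first exact: measurable_funM.
have := @rintM_bounded a b (fun x => f x ^+ 2) _ (M ^+ 2) _ _ rg.
move=> h; apply: rint_eq (h _ _); first by move=> x _; ring.
  exact: measurable_funX.
by move=> x /fM fxM; rewrite normrX lerXn2r// nnegrE// (le_trans _ fxM).
Qed.

Lemma sqint_abs a b f : sqint a b f -> sqint a b (fun x => `|f x|).
Proof.
move=> [mf rf]; split; first exact: measurableT_comp.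
by apply: rint_eq rf => x _; rewrite real_normK ?num_real.
Qed.

Lemma sqint_sub a b c d f : a <= c -> d <= b -> sqint a b f -> sqint c d f.
Proof.
move=> ac db [mf rf]; split; last exact: rint_sub rf.
by apply: measurable_funS mf => //; apply: subset_itv; rewrite bnd_simp.
Qed.

Lemma Int_cauchy_schwarz a b f g : sqint a b f -> sqint a b g ->
  Int a b (fun x => f x * g x) ^+ 2
    <= Int a b (fun x => f x ^+ 2) * Int a b (fun x => g x ^+ 2).
Proof.
move=> sf sg; apply: discriminant_le => l.
have rfg := rintZ (2 * l) (sqintM sf sg); have rgg := rintZ (l ^+ 2) sg.2.
rewrite -(IntZ (2 * l) (sqintM sf sg)) -(IntZ (l ^+ 2) sg.2) -(IntD sf.2 rfg).
rewrite -(IntD (rintD sf.2 rfg) rgg).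
by apply: Int_ge0 => x _; have := sqr_ge0 (f x + l * g x); lra.
Qed.

Lemma Int_abs_sqr a b f : a <= b -> sqint a b f ->
  Int a b (fun x => `|f x|) ^+ 2 <= (b - a) * Int a b (fun x => f x ^+ 2).
Proof.
move=> ab sf; have s1 : sqint a b (fun=> 1).
  by apply: (@sqint_bounded _ _ _ 1) => // x _; rewrite normr1.
have := Int_cauchy_schwarz s1 (sqint_abs sf).
rewrite (@eq_Int _ _ (fun x => 1 * _) (fun x => `|f x|)); last first.
  by move=> x _; rewrite mul1r.
rewrite (@eq_Int _ _ (fun x => 1 ^+ 2) (fun=> 1)); last by move=> x _; rewrite expr1n.
rewrite Int_cst// mul1r (@eq_Int _ _ (fun x => `|f x| ^+ 2) (fun x => f x ^+ 2))//.
by move=> x _; rewrite real_normK ?num_real.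
Qed.

End RealIntegrals.

(** * Antiderivatives and the fundamental theorem of calculus *)

Section FTC.
Variable R : realType.
Implicit Types (f F : R -> R) (a b : R).

Lemma is_derive_continuous F (x l : R) : is_derive x 1 F l -> {for x, continuous F}.
Proof. by move=> [dF _]; exact/differentiable_continuous/derivable1_diffP. Qed.

Lemma rint_continuous a b f : continuous f -> rint a b f.
Proof.
move=> cf; apply: continuous_compact_integrable; first exact: segment_compact.
exact: continuous_subspaceT.
Qed.

Lemma Int_FTC a b f F : a <= b -> (forall x : R, is_derive x 1 F (f x)) ->
  continuous f -> Int a b f = F b - F a.
Proof.
rewrite le_eqVlt => /predU1P[->|ab] dF cf; first by rewrite Int_id subrr.
have cF x : {for x, continuous F} by exact: (is_derive_continuous (dF x)).
rewrite /Int /Rintegral (@continuous_FTC2 _ f F a b ab) //.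
- exact: continuous_subspaceT.
- split; [|exact/cvg_at_right_filter/cF|exact/cvg_at_left_filter/cF].
  by move=> x _; case: (dF x).
- by move=> x _; rewrite derive1E; case: (dF x).
Qed.

Lemma measurable_itv_continuous a b f : continuous f -> measurable_fun `[a, b] f.
Proof. by move=> cf; apply: measurable_funTS; exact: continuous_measurable_fun. Qed.

Lemma is_derive_pow (c x : R) n :
  is_derive x 1 (fun x => (x + c) ^+ n.+1 / n.+1%:R) ((x + c) ^+ n).
Proof.
have d1 : is_derive x (1 : R) (fun x : R => x + c) 1.
  by apply: is_derive_eq; rewrite addr0.
have dn := @is_deriveX _ _ _ n x 1 1 d1.
have -> : (fun x => (x + c) ^+ n.+1 / n.+1%:R) =
  (n.+1%:R^-1 *: ((fun x : R => x + c) ^+ n.+1)).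
  apply/funext => y; rewrite /GRing.scale/= exprfctE mulrC//.
apply: is_derive_eq.
by rewrite /GRing.scale/= !mulr1 mulrA mulVf ?pnatr_eq0// mul1r.
Qed.

Lemma continuous_shift_pow (c : R) n : continuous (fun x : R => (x + c) ^+ n).
Proof.
move=> x; apply: (@continuous_comp _ _ _ (fun x => x + c) (fun x => x ^+ n)).
  by apply: cvgD; [exact: cvg_id|exact: cvg_cst].
exact: exprn_continuous.
Qed.

Lemma Int_pow a b c n : a <= b ->
  Int a b (fun x : R => (x + c) ^+ n) = ((b + c) ^+ n.+1 - (a + c) ^+ n.+1) / n.+1%:R.
Proof.
move=> ab; have -> := Int_FTC ab (fun x => is_derive_pow c x n); first by rewrite mulrBl.
exact: continuous_shift_pow.
Qed.

(** Leaving out the left end point matters for truncated powers of degree 0, which jump at their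
    knot. *)
Lemma eq_Int_oc a b f g : (forall x, a < x <= b -> f x = g x) ->
  rint a b f -> rint a b g -> Int a b f = Int a b g.
Proof.
move=> fg rf rg; rewrite /Int -!Rintegral_itv_obnd_cbnd.
- by apply: eq_Rintegral => x; rewrite inE/= in_itv/= => /fg.
- by apply: integrableS rg => //; apply: subset_itv; rewrite bnd_simp.
- by apply: integrableS rf => //; apply: subset_itv; rewrite bnd_simp.
Qed.

End FTC.

(** * Truncated powers *)

Section TruncatedPowers.
Variable R : realType.

(** The case distinction makes degree 0 the left-continuous unit step, whereas the power 0 of the
    positive part of [x - c] would be 1 everywhere. *)
Definition tpow k (c x : R) : R := if c < x then (x - c) ^+ k else 0.

Lemma measurable_tpow k c (D : set R) : measurable_fun D (tpow k c).
Proof.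
apply: measurable_funTS; apply: measurable_fun_ifT => //.
- by apply: measurable_fun_ltr.
- by apply: measurable_funX; apply: measurable_funB.
Qed.

Lemma tpow_ge0 k c x : 0 <= tpow k c x.
Proof. by rewrite /tpow; case: ltP => // cx; rewrite exprn_ge0// subr_ge0 ltW. Qed.

Lemma tpow_bounded k c b x : x <= b -> `|tpow k c x| <= (1 + `|b - c|) ^+ k.
Proof.
move=> xb; rewrite ger0_norm ?tpow_ge0// /tpow; case: ltP => cx; last first.
  by rewrite exprn_ge0// addr_ge0.
have := ler_norm (b - c) => bc; apply: lerXn2r; rewrite ?nnegrE; lra.
Qed.

Lemma rint_tpow k c a b : rint a b (tpow k c).
Proof.
apply: (rint_bounded (M := (1 + `|b - c|) ^+ k)); first exact: measurable_tpow.
by move=> x /andP[_ xb]; exact: tpow_bounded.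
Qed.

Lemma Int_tpow k a c x : a <= c -> a <= x ->
  Int a x (tpow k c) = tpow k.+1 c x / k.+1%:R.
Proof.
move=> ac ax; have [xc|cx] := leP x c.
  rewrite (@eq_Int _ _ _ _ (fun=> 0)); last first.
    by move=> y /andP[_ yx]; rewrite /tpow ltNge (le_trans yx xc).
  by rewrite Int_cst// mul0r /tpow ltNge xc mul0r.
rewrite (Int_split ac (ltW cx) (rint_tpow k c a x)).
rewrite (@eq_Int _ a c _ (fun=> 0)) ?Int_cst//; last first.
  by move=> y /andP[_ yx]; rewrite /tpow ltNge yx.
rewrite mul0r add0r (@eq_Int_oc _ _ _ _ (fun x => (x - c) ^+ k)).
- by rewrite Int_pow ?(ltW cx)// subrr expr0n/= subr0 /tpow cx.
- by move=> y /andP[cy _]; rewrite /tpow cy.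
- exact: rint_tpow.
- exact/rint_continuous/continuous_shift_pow.
Qed.

End TruncatedPowers.

(** * Splines and the Jackson estimate *)

Section TruncatedPowerSplines.
Variables (R : realType) (N : nat) (t : nat -> R).
Hypothesis tP : is_partition N t.
Implicit Types (s g d : R -> R).

(* The span of powers and truncated powers, as an inductive predicate, so that linear
   properties need only be checked on generators. *)
Inductive tspline (k : nat) : (R -> R) -> Prop :=
| tspline_pow i : (i <= k)%N -> tspline k (fun x => (x + 1) ^+ i)
| tspline_tpow j : (j <= N.+1)%N -> tspline k (tpow k (t j))
| tsplineD s1 s2 : tspline k s1 -> tspline k s2 -> tspline k (fun x => s1 x + s2 x)
| tsplineZ a s : tspline k s -> tspline k (fun x => a * s x).

Lemma eq_tspline k s1 s2 : s1 =1 s2 -> tspline k s1 -> tspline k s2.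
Proof. by move=> /funext ->. Qed.

Lemma tspline_cst k a : tspline k (fun=> a).
Proof.
apply: eq_tspline (tsplineZ a (tspline_pow (leq0n k))) => x.
by rewrite expr0 mulr1.
Qed.

Lemma tsplineB k s1 s2 : tspline k s1 -> tspline k s2 ->
  tspline k (fun x => s1 x - s2 x).
Proof.
move=> h1 h2; apply: eq_tspline (tsplineD h1 (tsplineZ (-1) h2)) => x.
by rewrite mulN1r.
Qed.

Lemma partition_homo i j : (i <= j)%N -> (j <= N.+1)%N -> t i <= t j.
Proof.
move=> ij jN; elim: j ij jN => [|j ih]; first by rewrite leqn0 => /eqP ->.
rewrite leq_eqVlt => /predU1P[->//|]; rewrite ltnS => ij jN.
by apply: le_trans (ih ij (ltnW jN)) _; apply/ltW; case: tP => _ _; exact.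
Qed.

Lemma partition_lt i j : (i < j)%N -> (j <= N.+1)%N -> t i < t j.
Proof.
move=> ij jN; apply: lt_le_trans (partition_homo ij jN).
by case: tP => _ _; apply; rewrite -ltnS (leq_trans ij jN).
Qed.

Lemma partition_geN1 j : (j <= N.+1)%N -> -1 <= t j.
Proof. by move=> jN; case: tP => <- _ _; exact: partition_homo. Qed.

Lemma partition_le1 j : (j <= N.+1)%N -> t j <= 1.
Proof. by move=> jN; case: tP => _ <- _; exact: partition_homo. Qed.

Lemma mesh_step j : (j <= N)%N -> t j.+1 - t j <= mesh N t.
Proof.
move=> jN; rewrite /mesh.
exact: (@le_bigmax _ _ _ 0 (fun i : 'I_N.+1 => t i.+1 - t i) (Ordinal (jN : (j < N.+1)%N))).
Qed.

Lemma mesh_gt0 : 0 < mesh N t.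
Proof.
apply: lt_le_trans (mesh_step (leq0n N)).
by rewrite subr_gt0; exact: partition_lt.
Qed.

Lemma mesh_steps i j : (i <= j)%N -> (j <= N.+1)%N ->
  t j - t i <= (j - i)%:R * mesh N t.
Proof.
move=> ij; elim: j ij => [|j ih]; first by rewrite leqn0 => /eqP ->; rewrite !subrr mul0r.
rewrite leq_eqVlt => /predU1P[->|]; first by rewrite subrr subnn mul0r.
rewrite ltnS => ij jN; have := ih ij (ltnW jN); have := mesh_step jN.
by rewrite subSn// -natr1 mulrDl mul1r; lra.
Qed.

Lemma tspline_measurable k s (D : set R) : tspline k s -> measurable_fun D s.
Proof.
elim=> {s} [i _|j _|s1 s2 _ h1 _ h2|a s _ h].
- by apply: measurable_funX; apply: measurable_funD.
- exact: measurable_tpow.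
- exact: measurable_funD.
- exact: measurable_funM.
Qed.

Lemma tspline_bounded k s : tspline k s ->
  exists M, forall x, -1 <= x <= 1 -> `|s x| <= M.
Proof.
elim=> {s} [i _|j _|s1 s2 _ [M1 h1] _ [M2 h2]|a s _ [M h]].
- exists (2 ^+ i) => x x1; rewrite normrX lerXn2r// ?nnegrE// ger0_norm; lra.
- by exists ((1 + `|1 - t j|) ^+ k) => x /andP[_ x1]; exact: tpow_bounded.
- by exists (M1 + M2) => x x1; rewrite (le_trans (ler_normD _ _))// lerD ?h1 ?h2.
- by exists (`|a| * M) => x x1; rewrite normrM ler_wpM2l// h.
Qed.

Lemma tspline_sqint k s : tspline k s -> sqint (-1) 1 s.
Proof.
move=> ks; have [M sM] := tspline_bounded ks.
by apply: sqint_bounded sM; exact: tspline_measurable ks.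
Qed.

Lemma tspline_rint k s a b : -1 <= a -> b <= 1 -> tspline k s -> rint a b s.
Proof. by move=> a1 b1 /tspline_sqint/sqint_rint; exact: rint_sub. Qed.

(** Integration from -1 sends each generator to a multiple of the generator of next degree with the
    same knot. The smooth steps and the approximation in Sobolev spaces are both built by it. *)
Lemma tspline_antideriv k s : tspline k s -> exists2 S, tspline k.+1 S &
  forall x, -1 <= x <= 1 -> S x = Int (-1) x s.
Proof.
elim=> {s} [i ik|j jN|s1 s2 k1 [S1 kS1 E1] k2 [S2 kS2 E2]|a s ks [S kS E]].
- exists (fun x => i.+1%:R^-1 * (x + 1) ^+ i.+1); first exact/tsplineZ/tspline_pow.
  by move=> x /andP[x1 _]; rewrite Int_pow// addNr expr0n/= subr0 mulrC.
- exists (fun x => k.+1%:R^-1 * tpow k.+1 (t j) x); first exact/tsplineZ/tspline_tpow.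
  by move=> x /andP[x1 _]; rewrite Int_tpow ?partition_geN1// mulrC.
- exists (fun x => S1 x + S2 x); first exact: tsplineD.
  by move=> x x1; rewrite E1// E2// IntD//; apply: tspline_rint (k1) || apply: tspline_rint (k2); lra.
- exists (fun x => a * S x); first exact: tsplineZ.
  by move=> x x1; rewrite E// IntZ//; apply: tspline_rint ks; lra.
Qed.

End TruncatedPowerSplines.

(** * First order approximation by splines of any degree on an arbitrary partition *)

Section Jackson.
Variables (R : realType) (N : nat) (t : nat -> R).
Hypothesis tP : is_partition N t.
Local Notation mu := (@lebesgue_measure R).
Implicit Types (s g d : R -> R).

(* A step of degree [k.+1] is a normalised antiderivative of the difference of two
   steps of degree [k] with consecutive knots, which is a nonnegative bump. *)
Lemma tspline_step k j : (j + (2 ^ k).-1 <= N.+1)%N ->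
  exists2 s, tspline N t k s & forall x : R, -1 <= x <= 1 ->
    [/\ 0 <= s x, s x <= 1, x <= t j -> s x = 0 & t (j + (2 ^ k).-1) < x -> s x = 1].
Proof.
elim: k j => [|k ih] j; rewrite ?expn0 ?addn0 => jN.
  exists (tpow 0 (t j)); first exact: tspline_tpow.
  by move=> x _; rewrite /tpow expr0; case: ltP => tjx; split.
set p := (2 ^ k)%N; have p0 : (0 < p)%N by rewrite expn_gt0.
(* [A] starts at knot [j] and rises over [p.-1] cells; [B] starts one cell after [A] has
   finished. *)
have pE : (2 ^ k.+1).-1 = (p + p.-1)%N by rewrite expnS -/p mul2n -addnn -subn1 -addnBA// subn1.
rewrite pE in jN *.
have jp : (j + p <= N.+1)%N by rewrite (leq_trans _ jN)// addnA leq_addr.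
have jp1 : (j + p.-1 < j + p)%N by rewrite ltn_add2l prednK.
have [A TA Astep] := ih j (leq_trans (ltnW jp1) jp).
have [|B TB Bstep] := ih (j + p)%N; first by rewrite -addnA.
rewrite -/p in Astep Bstep.
pose r x := A x - B x; have Tr : tspline N t k r by exact: tsplineB.
have rr a b : -1 <= a -> b <= 1 -> rint a b r by move=> a1 b1; exact: tspline_rint Tr.
have tj : t j <= t (j + p)%N by apply: (partition_homo tP) => //; rewrite leq_addr.
have tjp : t (j + p.-1)%N < t (j + p)%N by apply: (partition_lt tP).
have tpp : t (j + p)%N <= t (j + p + p.-1)%N.
  by apply: (partition_homo tP); rewrite ?leq_addr// -addnA.
have r0 x : -1 <= x <= 1 -> 0 <= r x.
  move=> x1; rewrite /r; have [xp|px] := leP x (t (j + p)%N).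
    by have [_ _ -> //] := Bstep x x1; rewrite subr0; have [] := Astep x x1.
  have [_ _ _ ->] := Astep x x1; last exact: lt_trans px.
  by have [] := Bstep x x1; rewrite subr_ge0.
have [F TF FE] := tspline_antideriv tP Tr.
have a1 : -1 <= t (j + p.-1)%N by apply: (partition_geN1 tP); exact: leq_trans (ltnW jp1) jp.
have b1 : t (j + p)%N <= 1 by exact: (partition_le1 tP).
(* In the cell from [t (j + p.-1)] to [t (j + p)] the step [A] is already 1 and [B] still 0; this
   gap gives the bump positive mass, so that it can be normalised. *)
have F1 : 0 < F 1.
  rewrite FE; last by rewrite lexx; lra.
  have := @Int_mono _ (-1) 1 (t (j + p.-1)%N) (t (j + p)%N) r a1 (ltW tjp) b1
    (rr _ _ (lexx _) (lexx _)) r0.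
  apply: lt_le_trans.
  rewrite (@eq_Int_oc _ _ _ _ (fun=> 1)) ?Int_cst ?(ltW tjp)//.
  - by rewrite mul1r subr_gt0.
  - move=> x /andP[ax xb]; have x1 : -1 <= x <= 1 by lra.
    by rewrite /r; have [_ _ _ ->//] := Astep x x1; have [_ _ ->//] := Bstep x x1; rewrite subr0.
  - exact: rr.
  - exact: rint_cst.
exists (fun x => (F 1)^-1 * F x); first exact: tsplineZ.
move=> x x1; have /andP[lx ux] := x1.
have Fx0 : 0 <= F x.
  by rewrite FE//; apply: Int_ge0 => y y1; apply: r0; lra.
have F1x : F 1 = F x + Int x 1 r.
  have e1 : -1 <= 1 :> R by lra.
  by rewrite (FE 1) ?e1 ?lexx// (FE x x1) -Int_split//; exact: rr.
have Ix : 0 <= Int x 1 r by apply: Int_ge0 => y y1; apply: r0; lra.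
split.
- by rewrite mulr_ge0// invr_ge0 ltW.
- by rewrite mulrC ler_pdivrMr// mul1r F1x; lra.
- move=> xj; rewrite (FE x x1) (@eq_Int _ _ _ _ (fun=> 0)); last first.
    move=> y /andP[y1 yx]; have y11 : -1 <= y <= 1 by lra.
    rewrite /r; have [_ _ ->//] := Astep y y11; last exact: le_trans xj.
    by have [_ _ ->//] := Bstep y y11; rewrite ?subr0//; apply: le_trans tj; exact: le_trans xj.
  by rewrite Int_cst// mul0r mulr0.
- rewrite addnA => xp; suff Ix0 : Int x 1 r = 0.
    by rewrite F1x Ix0 addr0 mulVf// gt_eqF//; move: F1; rewrite F1x Ix0 addr0.
  rewrite (@eq_Int _ _ _ _ (fun=> 0)); last first.
    move=> y /andP[xy y1]; have y11 : -1 <= y <= 1 by lra.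
    rewrite /r; have [_ _ _ ->//] := Astep y y11; last lra.
    by have [_ _ _ ->//] := Bstep y y11; [rewrite subrr|lra].
  by rewrite Int_cst// mul0r.
Qed.

(** On a given block a single step is in transit, the earlier ones being 1 and the later ones 0.
    Hence the values of [s] are convex combinations of two values of [g], which is all that both
    estimates below use and asks no regularity of [g]. *)
Lemma tspline_quasi_interpolant k g :
  exists2 s, tspline N t k s & exists n (tau : nat -> R),
  [/\ tau 0%N = -1, tau n.+1 = 1, forall i, -1 <= tau i <= 1,
      (forall i, (i <= n)%N -> tau i <= tau i.+1 <= tau i + 2 ^+ k * mesh N t) &
      forall i x, (i <= n)%N -> tau i <= x <= tau i.+1 ->
        exists2 w, 0 <= w <= 1 & s x = (1 - w) * g (tau i) + w * g (tau i.+1)].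
Proof.
set L := (2 ^ k)%N; have L0 : (0 < L)%N by rewrite expn_gt0.
have claim n : (n * L <= N.+1)%N -> exists2 s, tspline N t k s &
    (forall i x, (i < n)%N -> t (i * L)%N <= x <= t (i.+1 * L)%N ->
      exists2 w, 0 <= w <= 1 & s x = (1 - w) * g (t (i * L)%N) + w * g (t (i.+1 * L)%N)) /\
    (forall x, x <= 1 -> t (n * L)%N <= x -> s x = g (t (n * L)%N)).
  elim: n => [|n ih] nN.
    by exists (fun=> g (t 0%N)); [exact: tspline_cst|split].
  have nLN : (n * L <= N.+1)%N by rewrite (leq_trans _ nN)// leq_mul2r leqnSn orbT.
  have [s Ts [s1 s2]] := ih nLN.
  have nL : (n * L + L.-1 < n.+1 * L)%N by rewrite mulSn addnC ltn_add2r prednK.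
  have [|a Ta sa] := @tspline_step k (n * L)%N.
    exact: leq_trans (ltnW nL) nN.
  rewrite -/L in sa.
  have xI x i : (i <= N.+1)%N -> t i <= x -> x <= 1 -> -1 <= x <= 1.
    by move=> iN ix x1; rewrite x1 andbT (le_trans (partition_geN1 tP iN)).
  have tn : t (n * L + L.-1)%N < t (n.+1 * L)%N by exact: (partition_lt tP).
  have tnn : t (n * L)%N <= t (n.+1 * L)%N.
    by apply: (partition_homo tP) => //; rewrite leq_mul2r leqnSn orbT.
  have t1 := partition_le1 tP nN.
  exists (fun x => s x + (g (t (n.+1 * L)%N) - g (t (n * L)%N)) * a x).
    exact: tsplineD (tsplineZ _ _).
  split=> [i x|x x1 nx].
    rewrite ltnS leq_eqVlt => /predU1P[->|it].
      move=> /andP[nx xn]; have x1 : x <= 1 := le_trans xn t1.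
      have [a0 a1 _ _] := sa x (xI _ _ nLN nx x1).
      by exists (a x); rewrite ?a0// s2//; ring.
    move=> ix; have xn : x <= t (n * L)%N.
      move/andP : ix => [_ /le_trans]; apply; apply: (partition_homo tP) => //.
      by rewrite leq_mul2r it orbT.
    have [w w01 ->] := s1 i x it ix; exists w => //.
    have [|_ _ -> //] := sa x; last by rewrite mulr0 addr0.
    apply: (xI x (i * L)%N); last exact: le_trans xn (partition_le1 tP nLN).
      by rewrite (leq_trans _ nLN)// leq_mul2r ltnW// orbT.
    by move/andP : ix => [].
  have [_ _ _ ->] := sa x (xI _ _ nN nx x1); last exact: lt_le_trans nx.
  by rewrite s2// ?(le_trans tnn)//; ring.
have [s Ts [s1 s2]] := claim (N.+1 %/ L)%N (leq_trunc_div _ _).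
exists s => //; set n := (N.+1 %/ L)%N in s1 s2 *.
have nN : (n * L <= N.+1)%N := leq_trunc_div _ _.
have nS : (N.+1 < n.+1 * L)%N by exact: ltn_ceil.
have minE i : (i <= n)%N -> minn (i * L) N.+1 = (i * L)%N.
  by move=> i_n; apply/minn_idPl; rewrite (leq_trans _ nN)// leq_mul2r i_n orbT.
have minS : minn (n.+1 * L) N.+1 = N.+1 by apply/minn_idPr/ltnW.
(* The minimum caps the last block. It holds the cells left over, fewer than [L]; [s] is constant
   there ([w = 0]), and the block shrinks to a point when [L] divides [N.+1]. *)
exists n, (fun i => t (minn (i * L) N.+1)); split.
- by rewrite mul0n min0n; case: tP.
- by rewrite minS; case: tP.
- by move=> i; rewrite (partition_geN1 tP) ?(partition_le1 tP) ?geq_minr.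
- move=> i i_n; have lei : (minn (i * L) N.+1 <= minn (i.+1 * L) N.+1)%N.
    by rewrite leq_min geq_minr andbT geq_min leq_mul2r leqnSn orbT.
  apply/andP; split; first by apply: (partition_homo tP); rewrite ?geq_minr.
  rewrite -lerBlDl /=; apply: le_trans (mesh_steps _ lei (geq_minr _ _)) _.
  rewrite ler_pM2r ?(mesh_gt0 tP)// -natrX ler_nat leq_subLR [X in (_ <= X + _)%N]minE//.
  by apply: (leq_trans (geq_minl _ _)); rewrite mulSn addnC.
- move=> i x; rewrite leq_eqVlt => /predU1P[->|i_n].
    rewrite minE// minS => /andP[nx xN]; exists 0; first by rewrite lexx ler01.
    rewrite s2 ?subr0 ?mul1r ?mul0r ?addr0//.
    by apply: le_trans xN _; case: tP => _ ->.
  by rewrite (minE _ (ltnW i_n)) (minE _ i_n); exact: s1.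
Qed.

Lemma tspline_uniform_approx k g e :
  (forall x y, -1 <= x <= 1 -> -1 <= y <= 1 -> `|x - y| <= 2 ^+ k * mesh N t ->
    `|g x - g y| <= e) ->
  exists2 s, tspline N t k s & forall x : R, -1 <= x <= 1 -> `|g x - s x| <= e.
Proof.
move=> ge; have [s Ts [n [tau [tau0 tau1 tauI tauS sE]]]] := tspline_quasi_interpolant k g.
exists s => // x /andP[x1 x2].
have [i i_n xi] : exists2 i, (i <= n)%N & tau i <= x <= tau i.+1.
  suff H j : (j <= n)%N -> x <= tau j.+1 -> exists2 i, (i <= n)%N & tau i <= x <= tau i.+1.
    by apply: (H n); rewrite ?tau1.
  elim: j => [|i ih] i_n xi; first by exists 0%N => //; rewrite tau0 x1.
  have [xi'|ix] := leP x (tau i.+1); first exact: ih (ltnW i_n) xi'.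
  by exists i.+1 => //; rewrite (ltW ix).
have [w /andP[w0 w1] ->] := sE i x i_n xi; have /andP[t1 t2] := tauS i i_n.
move/andP : xi => [xi1 xi2].
have /andP[tI _] := tauI i; have /andP[_ tI1] := tauI i.+1.
have g1 : `|g x - g (tau i)| <= e by apply: ge; rewrite ?ger0_norm; lra.
have g2 : `|g x - g (tau i.+1)| <= e by apply: ge; rewrite ?ler0_norm; lra.
have -> : g x - ((1 - w) * g (tau i) + w * g (tau i.+1)) =
  (1 - w) * (g x - g (tau i)) + w * (g x - g (tau i.+1)) by ring.
apply: le_trans (ler_normD _ _) _; rewrite !normrM (ger0_norm w0) ger0_norm; last lra.
nra.
Qed.

Lemma measurable_Int d : rint (-1) 1 d -> measurable_fun `[(-1 : R), 1] (fun x => Int (-1) x d).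
Proof.
move=> rd; apply: subspace_continuous_measurable_fun => //.
by apply: parameterized_integral_continuous => //; lra.
Qed.

Lemma Int_bounded d x : rint (-1) 1 d -> -1 <= x <= 1 ->
  `|Int (-1) x d| <= Int (-1) 1 (fun x => `|d x|).
Proof.
move=> rd /andP[x1 x2]; apply: le_trans (ler_norm_Int _) _.
  exact: rint_sub rd.
by apply: Int_mono => //; exact: rint_abs.
Qed.

Lemma sqint_Int c d : rint (-1) 1 d -> sqint (-1) 1 (fun x => c + Int (-1) x d).
Proof.
move=> rd; apply: (@sqint_bounded _ _ _ _ (`|c| + Int (-1) 1 (fun x => `|d x|))).
  by apply: measurable_funD => //; exact: measurable_Int.
by move=> x x1; rewrite (le_trans (ler_normD _ _))// lerD// Int_bounded.
Qed.

(** The estimate is local. On a block of length at most [H], Cauchy-Schwarz bounds the squared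
    variation of [g] by [H] times the energy of [d] on that block, and integrating over the block
    costs the second factor [H]. *)
Lemma tspline_jackson k g c d : sqint (-1) 1 d ->
  (forall x, -1 <= x <= 1 -> g x = c + Int (-1) x d) ->
  exists2 s, tspline N t k s &
  Int (-1) 1 (fun x => (g x - s x) ^+ 2)
    <= (2 ^+ k * mesh N t) ^+ 2 * Int (-1) 1 (fun x => d x ^+ 2).
Proof.
move=> sd gE; have [s Ts [n [tau [tau0 tau1 tauI tauS sE]]]] := tspline_quasi_interpolant k g.
exists s => //; have rd := sqint_rint sd; set H := 2 ^+ k * mesh N t in tauS *.
have H0 : 0 <= H by rewrite mulr_ge0 ?exprn_ge0// ltW// (mesh_gt0 tP).
have sg : sqint (-1) 1 g.
  by apply: sqint_eq (sqint_Int c rd) => x x1; rewrite gE.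
have sgs : sqint (-1) 1 (fun x => g x - s x) by apply: sqintB => //; exact: tspline_sqint Ts.
suff : forall i, (i <= n.+1)%N -> Int (-1) (tau i) (fun x => (g x - s x) ^+ 2)
    <= H ^+ 2 * Int (-1) (tau i) (fun x => d x ^+ 2) by move/(_ n.+1 (leqnn _)); rewrite tau1.
elim=> [_|i ih i_n]; first by rewrite tau0 !Int_id mulr0.
have /andP[t1 t2] := tauS i i_n.
have /andP[l1 _] := tauI i; have /andP[_ u1] := tauI i.+1.
rewrite (Int_split l1 t1); last exact: rint_sub sgs.2.
rewrite (Int_split l1 t1); last exact: rint_sub sd.2.
rewrite mulrDr lerD ?ih 1?ltnW//.
set D := Int (tau i) (tau i.+1) (fun x => d x ^+ 2).
have D0 : 0 <= D by apply: Int_ge0 => x _; rewrite sqr_ge0.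
have sdi : sqint (tau i) (tau i.+1) d by exact: sqint_sub sd.
have rdi := sqint_rint sdi.
pose A := Int (tau i) (tau i.+1) (fun x => `|d x|).
have A2 : A ^+ 2 <= H * D.
  apply: le_trans (Int_abs_sqr t1 sdi) _; rewrite ler_wpM2r//; lra.
have gdiff x y : tau i <= x -> x <= y -> y <= tau i.+1 -> `|g y - g x| <= A.
  move=> ix xy yi; rewrite !gE; try lra.
  rewrite (@Int_split _ (-1) x y)//; [|lra|by apply: rint_sub rd; lra].
  have -> : c + (Int (-1) x d + Int x y d) - (c + Int (-1) x d) = Int x y d by ring.
  apply: le_trans (ler_norm_Int _) _; first by apply: rint_sub rdi.
  by apply: Int_mono => //; exact: rint_abs.
have : Int (tau i) (tau i.+1) (fun x => (g x - s x) ^+ 2)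
    <= Int (tau i) (tau i.+1) (fun=> H * D).
  apply: le_Int; [exact: rint_sub sgs.2|exact: rint_cst|].
  move=> x xi; have [w /andP[w0 w1] ->] := sE i x i_n xi; move/andP : xi => [xi1 xi2].
  apply: le_trans A2; rewrite -real_normK ?num_real//.
  have -> : g x - ((1 - w) * g (tau i) + w * g (tau i.+1)) =
    (1 - w) * (g x - g (tau i)) - w * (g (tau i.+1) - g x) by ring.
  have g1 := gdiff _ _ (lexx _) xi1 xi2; have g2 := gdiff _ _ xi1 xi2 (lexx _).
  have A0 : 0 <= A by exact: le_trans g1.
  apply: lerXn2r; rewrite ?nnegrE//.
  apply: le_trans (ler_normB _ _) _; rewrite !normrM (ger0_norm w0) ger0_norm; last lra.
  have w1' : 0 <= 1 - w by lra.
  have := ler_wpM2l w0 g2; have := ler_wpM2l w1' g1; lra.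
rewrite Int_cst// => /le_trans; apply.
rewrite (_ : H ^+ 2 * D = H * D * H); last by ring.
rewrite (ler_wpM2l (mulr_ge0 H0 D0))//; lra.
Qed.

End Jackson.

(** * Smoothness and polynomial pieces of truncated power splines *)

Section SplineMembership.
Variables (R : realType) (N : nat) (t : nat -> R).
Hypothesis tP : is_partition N t.
Implicit Types (s g d f : R -> R).

Lemma tpow_max n c (x : R) : tpow n.+1 c x = ((x - c + `|x - c|) / 2) ^+ n.+1.
Proof.
rewrite /tpow; case: ltP => cx.
  by rewrite gtr0_norm ?subr_gt0//; congr (_ ^+ _); lra.
by rewrite ler0_norm ?subr_le0// subrr mul0r expr0n.
Qed.

Lemma continuous_tpow n (c : R) : continuous (tpow n.+1 c).
Proof.
have -> : tpow n.+1 c = (fun x => ((x - c + `|x - c|) / 2) ^+ n.+1).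
  by apply/funext => x; exact: tpow_max.
move=> x; apply: (@continuous_comp _ _ _ (fun x => (x - c + `|x - c|) / 2)
  (fun x => x ^+ n.+1)); last exact: exprn_continuous.
have cs : {for x, continuous (fun x : R => x - c)}.
  by apply: cvgB; [exact: cvg_id|exact: cvg_cst].
apply: cvgM; last exact: cvg_cst.
by apply: cvgD => //; exact: cvg_norm.
Qed.

(** Differentiability at the knot needs no separate argument when the function is read as the
    integral of a continuous one, from a base point [a] to the left of both [c] and [x]. *)
Lemma is_derive_tpow n (c x : R) :
  is_derive x 1 (tpow n.+2 c) (n.+2%:R * tpow n.+1 c x).
Proof.
pose a := Num.min c x - 1.
have ac : a < c by rewrite ltrBlDr gt_min ltrDl ltr01.
have ax : a < x by rewrite ltrBlDr gt_min [x < x + 1]ltrDl ltr01 orbT.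
have := @continuous_FTC1_closed R (tpow n.+1 c) a x (x + 1) _ (rint_tpow _ _ _ _) ax
  (@continuous_tpow n c x).
rewrite ltrDl ltr01 => /(_ isT) [dF FE].
have d : is_derive x 1 (fun y => Int a y (tpow n.+1 c)) (tpow n.+1 c x).
  by apply: (DeriveDef dF); rewrite -derive1E FE.
have := is_deriveZ (n.+2%:R) d; apply: near_eq_is_derive.
near=> y; rewrite /GRing.scale/= Int_tpow ?(ltW ac)//.
  by rewrite [LHS]mulrC divfK// pnatr_eq0.
by apply/ltW; near: y; exact: lt_nbhsr.
Unshelve. all: by end_near. Qed.

Lemma Ck_onD k f g : Ck_on k f -> Ck_on k g -> Ck_on k (fun x => f x + g x).
Proof.
move=> [F [F0 Fc Fd]] [G [G0 Gc Gd]]; exists (fun j x => F j x + G j x); split.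
- by move=> x x1; rewrite F0// G0.
- by move=> j jk x; apply: cvgD; [exact: Fc|exact: Gc].
- by move=> j x jk x1; apply: is_deriveD; [exact: Fd|exact: Gd].
Qed.

Lemma Ck_onZ k a f : Ck_on k f -> Ck_on k (fun x => a * f x).
Proof.
move=> [F [F0 Fc Fd]]; exists (fun j x => a * F j x); split.
- by move=> x x1; rewrite F0.
- by move=> j jk x; apply: cvgM; [exact: cvg_cst|exact: Fc].
- by move=> j x jk x1; exact: (is_deriveZ a (Fd j x jk x1)).
Qed.

Lemma Ck_on_tspline k s : tspline N t k.+1 s -> Ck_on k s.
Proof.
elim=> {s} [i ik|j jN|s1 s2 _ h1 _ h2|a s _ h].
- exists (fun j x => (i ^_ j)%:R * (x + 1) ^+ (i - j)); split.
  + by move=> x _; rewrite ffactn0 mul1r subn0.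
  + move=> j jk; apply: continuous_subspaceT => x; apply: cvgM; first exact: cvg_cst.
    exact: continuous_shift_pow.
  + move=> j x jk _; have [ij|ji] := leqP i j.
      (* Truncated subtraction makes the exponent 0 here, and the next falling factorial
         vanishes. *)
      have -> : (fun x : R => (i ^_ j)%:R * (x + 1) ^+ (i - j)) = cst (i ^_ j)%:R.
        by apply/funext => y; rewrite (eqP ij) expr0 mulr1.
      by rewrite (@ffact_small i j.+1)// mul0r; exact: is_derive_cst.
    have := is_deriveZ ((i ^_ j)%:R * (i - j)%:R) (is_derive_pow 1 x (i - j.+1)).
    rewrite /GRing.scale/= -subSn// subSS ffactnSr natrM.
    have ij0 : (i - j)%:R != 0 :> R by rewrite pnatr_eq0 -lt0n subn_gt0.
    congr is_derive; apply/funext => y; rewrite /GRing.scale/=.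
    by rewrite -[LHS]/(_ * _) -mulrA [_%:R * (_ / _)]mulrC divfK.
- exists (fun i x => (k.+1 ^_ i)%:R * tpow (k.+1 - i) (t j) x); split.
  + by move=> x _; rewrite ffactn0 mul1r subn0.
  + move=> i ik; apply: continuous_subspaceT => x; apply: cvgM; first exact: cvg_cst.
    by rewrite subSn//; exact: continuous_tpow.
  + move=> i x ik _; rewrite ffactnSr natrM -mulrA.
    have -> : (k.+1 - i = (k - i.+1).+2)%N by rewrite subnSK// subSn// ltnW.
    have -> : (k.+1 - i.+1 = (k - i.+1).+1)%N by rewrite subSS subnSK.
    exact: (is_deriveZ _ (is_derive_tpow _ _ _)).
- exact: Ck_onD.
- exact: Ck_onZ.
Qed.

Lemma tspline_piece k s j : tspline N t k s -> (j <= N)%N ->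
  exists2 p : {poly R}, (size p <= k.+1)%N & forall x, t j < x < t j.+1 -> s x = p.[x].
Proof.
move=> ks jN; elim: ks => {s} [i ik|i iN|s1 s2 _ [p p1 p2] _ [q q1 q2]|a s _ [p p1 p2]].
- exists (('X - (-1)%:P) ^+ i) => [|x _]; first by rewrite size_exp_XsubC.
  by rewrite horner_exp hornerXsubC opprK.
- have [ij|ji] := leqP i j.
    exists (('X - (t i)%:P) ^+ k) => [|x /andP[jx _]]; first by rewrite size_exp_XsubC.
    rewrite horner_exp hornerXsubC /tpow (le_lt_trans _ jx)//.
    by apply: (partition_homo tP) => //; exact: leqW.
  exists 0 => [|x /andP[_ xj]]; first by rewrite size_poly0.
  rewrite horner0 /tpow ltNge (le_trans (ltW xj))//.
  exact: (partition_homo tP).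
- exists (p + q) => [|x xj]; last by rewrite hornerD p2// q2.
  by rewrite (leq_trans (size_polyD _ _))// geq_max p1.
- exists (a *: p) => [|x xj]; last by rewrite hornerZ p2.
  by rewrite (leq_trans (size_scale_leq _ _)).
Qed.

Lemma spline_tspline m s1 s2 : (0 < m)%N -> tspline N t m.-1 s1 -> tspline N t m.-1 s2 ->
  spline m N t (fun x => s1 x +i* s2 x).
Proof.
case: m => // m _ /= T1 T2; split=> [j jN|]; last first.
  case: m T1 T2 => // m T1 T2 _; rewrite subSS subn1 /=.
  by split; exact: Ck_on_tspline.
have [p p1 p2] := tspline_piece T1 jN; have [q q1 q2] := tspline_piece T2 jN.
exists (map_poly (real_complex R) p + 'i *: map_poly (real_complex R) q); split.
  rewrite (leq_trans (size_polyD _ _))// geq_max size_map_poly p1/=.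
  by rewrite (leq_trans (size_scale_leq _ _))// size_map_poly.
move=> x xj; rewrite hornerD hornerZ !horner_map/= p2// q2//.
by simpc.
Qed.

End SplineMembership.

(** * Weak derivatives *)

Section Bump.
Variable R : realType.
Local Notation mu := (@lebesgue_measure R).
Implicit Types (p : {poly R}) (f : R -> R).

(* The functions [p(x) (x(1-x))^-(k+1) exp(-1/(x(1-x)))] on ]0,1[, extended by 0, form
   a class closed under differentiation. *)
Definition ebumpq : {poly R} := 'X * (1 - 'X).
Definition ebump p k (x : R) : R :=
  if (0 < x) && (x < 1) then p.[x] * (ebumpq.[x])^-1 ^+ k.+1 * expR (- (ebumpq.[x])^-1)
  else 0.
(** Numerator of the derivative over the power [k.+3] of [x(1-x)]: the three terms come from the
    polynomial, the negative power and the exponential. *)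
Definition ebump_deriv p k : {poly R} :=
  p^`() * ebumpq ^+ 2 - k.+1%:R *: (p * ebumpq^`() * ebumpq) + p * ebumpq^`().

Lemma horner_ebumpq (x : R) : ebumpq.[x] = x * (1 - x).
Proof. by rewrite /ebumpq !hornerE. Qed.

Lemma poly_bounded01 p : exists B : R, forall x : R, 0 <= x <= 1 -> `|p.[x]| <= B.
Proof.
elim/poly_ind: p => [|p c [B pB]]; first by exists 0 => x _; rewrite horner0 normr0.
exists (B + `|c|) => x /andP[x0 x1]; rewrite !hornerE.
rewrite (le_trans (ler_normD _ _))// lerD2r normrM (ger0_norm x0).
by apply: le_trans (pB x _); rewrite ?x0// ler_piMr.
Qed.

(** Meant for the points 0 and 1, where the two branches of [ebump] meet and the differentiation
    rules do not apply. *)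
Lemma is_derive_quadratic f (x C : R) :
  (forall y, `|f y| <= C * (y - x) ^+ 2) -> is_derive x 1 f 0.
Proof.
move=> fC; have fx : f x = 0.
  by apply/eqP; rewrite -normr_le0 (le_trans (fC x))// subrr expr0n/= mulr0.
have C0 : 0 <= C.
  by have := le_trans (normr_ge0 _) (fC (x + 1)); rewrite addrC addKr expr1n mulr1.
apply/is_derive1_caratheodory; exists (fun z => f z / (z - x)); split.
- move=> z; rewrite fx subr0; have [->|zx] := eqVneq z x; first by rewrite fx !mul0r.
  by rewrite divfK// subr_eq0.
- rewrite /prop_for /continuous_at /= fx mul0r; apply/cvgr0Pnorm_le => e e0.
  have cy : y - x @[y --> x] --> (0 : R).
    by rewrite -[X in _ --> X](subrr x); apply: cvgB; [exact: cvg_id|exact: cvg_cst].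
  have eC : 0 < e / (C + 1) by rewrite divr_gt0// ltr_wpDl.
  near=> y; rewrite /=; have [->|yx] := eqVneq y x; first by rewrite fx mul0r normr0 ltW.
  have yx0 : 0 < `|y - x| by rewrite normr_gt0 subr_eq0.
  rewrite normrM normfV ler_pdivrMr//.
  apply: (le_trans (fC y)); rewrite -real_normK ?num_real// expr2 mulrA ler_pM2r//.
  have : `|y - x| <= e / (C + 1).
    by near: y; exact: (cvgr0_norm_le _ cy _ eC).
  rewrite ler_pdivlMr ?ltr_wpDl//; nra.
- by rewrite fx mul0r.
Unshelve. all: by end_near. Qed.

Lemma expRN_inv_le n (q : R) : 0 < q -> expR (- q^-1) <= n.+1`!%:R * q ^+ n.+1.
Proof.
move=> q0; have qi : 0 <= q^-1 by rewrite invr_ge0 ltW.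
have f0 : 0 < n.+1`!%:R :> R by rewrite ltr0n fact_gt0.
have := expR_ge1Dxn n qi => h; rewrite expRN.
rewrite -[leRHS]invrK lef_pV2 ?posrE ?expR_gt0 ?invr_gt0 ?mulr_gt0 ?exprn_gt0//.
by rewrite invfM -exprVn mulrC; apply: le_trans h; rewrite lerDr ler01.
Qed.

Lemma ebump_le p k : exists C, forall x, `|ebump p k x| <= C * (x * (1 - x)) ^+ 2.
Proof.
have [B pB] := poly_bounded01 p; exists (`|B| * (k.+3)`!%:R) => x.
have f0 : 0 < (k.+3)`!%:R :> R by rewrite ltr0n fact_gt0.
rewrite /ebump; case: ifP => [/andP[x0 x1]|_]; last first.
  by rewrite normr0 mulr_ge0 ?sqr_ge0// mulr_ge0// ltW.
rewrite horner_ebumpq; set q := x * (1 - x).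
have q0 : 0 < q by rewrite mulr_gt0// subr_gt0.
(* Of the [k.+3] powers of [q], [k.+1] cancel the pole and two remain for the quadratic bound. *)
have h := expRN_inv_le k.+2 q0.
rewrite !normrM (gtr0_norm (expR_gt0 _)) (@ger0_norm _ (q^-1 ^+ _)); last first.
  by rewrite exprn_ge0// invr_ge0 ltW.
rewrite -!mulrA; apply: ler_pM => //.
- by rewrite mulr_ge0 ?expR_ge0// exprn_ge0// invr_ge0 ltW.
- by apply: le_trans (ler_norm B); apply: pB; rewrite !ltW.
- apply: (@le_trans _ _ (q^-1 ^+ k.+1 * (k.+3`!%:R * q ^+ k.+3))).
    by rewrite ler_wpM2l// exprn_ge0// invr_ge0 ltW.
  rewrite mulrCA (ler_wpM2l (ltW f0))// -[in q ^+ _](addn2 k.+1) exprD mulrA.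
  by rewrite -exprMn mulVf ?gt_eqF// expr1n mul1r.
Qed.

Lemma is_derive_ebump p k (x : R) : is_derive x 1 (ebump p k) (ebump (ebump_deriv p k) k.+2 x).
Proof.
have [x01|x01] := boolP ((0 < x) && (x < 1)); last first.
  rewrite {2}/ebump (negbTE x01).
  have [C bC] := ebump_le p k.
  have xcase : [\/ x = 0, x = 1, x < 0 | 1 < x].
    move: x01; rewrite negb_and -!leNgt !le_eqVlt => /orP[]/orP[/eqP|].
    + by constructor 1.
    + by constructor 3.
    + by move=> /esym; constructor 2.
    + by constructor 4.
  have C0 : 0 <= C.
    have := le_trans (normr_ge0 _) (bC (2^-1)); rewrite pmulr_lge0//.
    by rewrite exprn_gt0// mulr_gt0//; lra.
  case: xcase => [->|->|x0|x1].
  - apply: (@is_derive_quadratic _ _ C) => y; rewrite subr0.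
    have := bC y; rewrite /ebump; case: ifP => [/andP[y0 y1]|_ _]; last first.
      by rewrite normr0 mulr_ge0// sqr_ge0.
    move/le_trans; apply; rewrite ler_wpM2l// lerXn2r ?nnegrE//; nra.
  - apply: (@is_derive_quadratic _ _ C) => y.
    have := bC y; rewrite /ebump; case: ifP => [/andP[y0 y1]|_ _]; last first.
      by rewrite normr0 mulr_ge0// sqr_ge0.
    move/le_trans; apply; rewrite ler_wpM2l// -[X in _ <= X]sqrrN lerXn2r ?nnegrE//; nra.
  - apply: near_eq_is_derive (is_derive_cst 0 x 1).
    near=> y; rewrite /ebump ifF//; apply/negbTE; rewrite negb_and -!leNgt; apply/orP; left.
    by apply/ltW; near: y; exact: lt_nbhsl.
  - apply: near_eq_is_derive (is_derive_cst 0 x 1).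
    near=> y; rewrite /ebump ifF//; apply/negbTE; rewrite negb_and -!leNgt; apply/orP; right.
    by apply/ltW; near: y; exact: lt_nbhsr.
have /andP[x0 x1] := x01.
have q0 : ebumpq.[x] != 0 by rewrite horner_ebumpq mulf_neq0// ?gt_eqF// subr_gt0.
have dq := @is_derive_poly R ebumpq x; have dv := is_deriveV q0 dq.
have dvk := @is_deriveX R _ _ k.+1 x 1 _ dv.
have de := @is_derive1_comp R expR (- (fun y => ebumpq.[y]^-1)) x _ _
  (is_derive_expR (- (ebumpq.[x])^-1)) (is_deriveN dv).
have d := is_deriveM (is_deriveM (@is_derive_poly R p x) dvk) de.
apply: (@near_eq_is_derive _ _ _ _ (ebump p k) x 1 _ _ (is_derive_eq d _)).
  near=> y; have y01 : (0 < y) && (y < 1); last by rewrite /ebump y01 !fctE/= ?exprfctE.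
  by apply/andP; split; near: y; [exact: lt_nbhsr|exact: lt_nbhsl].
rewrite /ebump x01 /ebump_deriv !fctE /GRing.scale /=.
move: q0 (expR _) {x01 x0 x1 dq dv dvk de d}; move: (ebumpq) => q q0 e.
rewrite !(hornerD, hornerN, hornerM, hornerZ, horner_exp) !exprSr.
by set r := q.[x]^-1 ^+ k; field.
Unshelve. all: by end_near. Qed.

End Bump.

(** * Smooth steps and plateau-shaped test functions *)

Section SmoothStep.
Variable R : realType.
Local Notation mu := (@lebesgue_measure R).
Implicit Types (f u g : R -> R) (D : nat -> R -> R).

Definition deriv_chain D := forall n (x : R), is_derive x 1 (D n) (D n.+1 x).

Lemma derive1n_chain D : deriv_chain D -> forall n, derive1n n (D 0%N) = D n.
Proof.
move=> dD; elim=> [|n ih]; first by rewrite derive1n0.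
rewrite derive1nS ih; apply/funext => x; rewrite derive1E.
by case: (dD n x).
Qed.

Lemma ebump_chain : exists2 D, deriv_chain D & D 0%N = ebump (1 : {poly R}) 0%N.
Proof.
pose s n : {poly R} * nat := iter n (fun z => (ebump_deriv z.1 z.2, z.2.+2)) (1%R, 0%N).
exists (fun n => ebump (s n).1 (s n).2) => // n x.
exact: is_derive_ebump.
Qed.

Local Notation rho := (ebump (1 : {poly R}) 0%N).

Lemma continuous_rho : continuous rho.
Proof. by move=> x; apply: is_derive_continuous (is_derive_ebump _ _ _). Qed.

Lemma rho_ge0 x : 0 <= rho x.
Proof.
rewrite /ebump; case: ifP => // /andP[x0 x1].
rewrite hornerC mul1r expr1 mulr_ge0 ?expR_ge0// invr_ge0 horner_ebumpq.
by rewrite mulr_ge0 ?ltW// subr_gt0.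
Qed.

Lemma rho_out x : x <= 0 \/ 1 <= x -> rho x = 0.
Proof. by rewrite /ebump; case: ifP => // /andP[x0 x1] []; rewrite leNgt ?x0 ?x1. Qed.

Lemma rho_mass_gt0 : 0 < Int 0 1 rho.
Proof.
pose c : R := expR (- (16 / 3)).
have c0 : 0 < c by exact: expR_gt0.
have rr a b : rint a b rho by apply: rint_continuous; exact: continuous_rho.
apply: lt_le_trans (@Int_mono _ 0 1 (1/4) (3/4) rho _ _ _ (rr _ _) _); try lra; last first.
  by move=> x _; exact: rho_ge0.
apply: (@lt_le_trans _ _ (Int (1/4) (3/4) (fun=> c))).
  by rewrite Int_cst ?mulr_gt0//; lra.
apply: le_Int => //; first exact: rint_cst.
move=> x /andP[x0 x1]; rewrite /ebump ifT; last lra.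
rewrite hornerC mul1r expr1 horner_ebumpq; set q := x * (1 - x).
have q0 : 3 / 16 <= q by rewrite /q; nra.
have q1 : q <= 1 by rewrite /q; nra.
have q2 : 0 < q by lra.
have v1 : 1 <= q^-1 by rewrite invf_ge1.
have v2 : q^-1 <= 16 / 3.
  by rewrite -[X in _ <= X]invrK lef_pV2 ?posrE// ?invr_gt0; lra.
rewrite -[c]mul1r; apply: ler_pM => //; first exact: ltW.
by rewrite ler_expR lerN2.
Qed.

Definition sstep x : R := Int 0 x rho / Int 0 1 rho.

(** For [x < 0] the right-hand side integrates over an empty interval and is 0, not minus a reversed
    integral. Moving the base point to the left of [x] makes the fundamental theorem applicable at
    every [x]. *)
Lemma Int_rho_shift a x : a <= 0 -> a <= x -> Int a x rho = Int 0 x rho.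
Proof.
move=> a0 ax; have rr c d : rint c d rho by apply: rint_continuous; exact: continuous_rho.
have z c d : c <= d -> d <= 0 -> Int c d rho = 0.
  move=> cd d0; rewrite (@eq_Int _ _ _ _ (fun=> 0)) ?Int_cst ?mul0r//.
  by move=> y /andP[_ yd]; rewrite rho_out//; left; exact: le_trans d0.
have [x0|x0] := leP 0 x.
  by rewrite (@Int_split _ a 0 x)// z// add0r.
rewrite z// ?ltW// /Int set_itv_ge ?Rintegral_set0//.
by rewrite bnd_simp -ltNge.
Qed.

Lemma sstep_out x : (x <= 0 -> sstep x = 0) /\ (1 <= x -> sstep x = 1).
Proof.
have rr c d : rint c d rho by apply: rint_continuous; exact: continuous_rho.
have m0 := rho_mass_gt0.
split=> [x0|x1]; rewrite /sstep.
  rewrite -(Int_rho_shift x0 (lexx x)) Int_id mul0r//.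
rewrite (@Int_split _ 0 1 x)//.
rewrite (@eq_Int _ 1 x _ (fun=> 0)) ?Int_cst ?mul0r ?addr0 ?divff ?gt_eqF//.
by move=> y /andP[y1 _]; rewrite rho_out//; right.
Qed.

Lemma is_derive_sstep (x : R) : is_derive x 1 sstep (rho x / Int 0 1 rho).
Proof.
pose a := Num.min 0 x - 1.
have a0 : a < 0 by rewrite ltrBlDr gt_min ltrDl ltr01.
have ax : a < x by rewrite ltrBlDr gt_min [x < x + 1]ltrDl ltr01 orbT.
have := @continuous_FTC1_closed R rho a x (x + 1) _ (rint_continuous _ _ continuous_rho) ax
  (@continuous_rho x).
rewrite ltrDl ltr01 => /(_ isT) [dF FE].
have d : is_derive x 1 (fun y => Int a y rho) (rho x).
  by apply: (DeriveDef dF); rewrite -derive1E FE.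
have := is_deriveZ ((Int 0 1 rho)^-1) d; rewrite -[_ *: rho x]/(_ * _) mulrC.
apply: near_eq_is_derive.
near=> y; rewrite /sstep/= -[LHS]/(_ * _) Int_rho_shift ?(ltW a0) 1?mulrC//.
by apply/ltW; near: y; exact: lt_nbhsr.
Unshelve. all: by end_near. Qed.

Lemma sstep_itv x : 0 <= sstep x <= 1.
Proof.
have m0 := rho_mass_gt0.
have rr c d : rint c d rho by apply: rint_continuous; exact: continuous_rho.
have [x0|x0] := leP x 0; first by rewrite (sstep_out x).1// lexx ler01.
have [x1|x1] := leP 1 x; first by rewrite (sstep_out x).2// lexx ler01.
rewrite /sstep divr_ge0 ?Int_ge0//=; try by move=> *; exact: rho_ge0.
rewrite ler_pdivrMr// mul1r Int_mono ?(ltW x0) ?(ltW x1)//.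
by move=> *; exact: rho_ge0.
Qed.

Lemma sstep_chain : exists D, [/\ deriv_chain D, D 0%N = sstep &
  D 1%N = fun x => rho x / Int 0 1 rho].
Proof.
have [D dD D0] := ebump_chain.
exists (fun n => if n is k.+1 then (fun x => D k x / Int 0 1 rho) else sstep); split=> //.
- move=> [|n] x; first by rewrite D0; exact: is_derive_sstep.
  have := is_deriveZ ((Int 0 1 rho)^-1) (dD n x); rewrite -[_ *: D _ x]/(_ * _) mulrC.
  by congr is_derive; apply/funext => y; rewrite -[LHS]/(_ * _) mulrC.
- by rewrite D0.
Qed.

Lemma sstep_le c e x : 0 < e -> x <= c -> sstep ((x - c) / e) = 0.
Proof. by move=> e0 xc; apply: (sstep_out _).1; rewrite ler_pdivrMr// mul0r subr_le0. Qed.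

Lemma sstep_ge c e x : 0 < e -> c + e <= x -> sstep ((x - c) / e) = 1.
Proof.
by move=> e0 xc; apply: (sstep_out _).2; rewrite ler_pdivlMr// mul1r lerBrDl.
Qed.

(** Both flanks lie to the right of their base points, so the derivative is the difference of two
    translates of one mollifier, placed at [a] and at [b]. *)
Definition plateau (a b e x : R) : R := sstep ((x - a) / e) - sstep ((x - b) / e).

Lemma plateau_out a b e x : a < b -> 0 < e -> x <= a \/ b + e <= x -> plateau a b e x = 0.
Proof.
move=> ab e0 [xa|bx]; rewrite /plateau.
  by rewrite !sstep_le ?subrr//; lra.
by rewrite !sstep_ge ?subrr//; lra.
Qed.

Lemma plateau_mid a b e x : 0 < e -> a + e <= x -> x <= b -> plateau a b e x = 1.
Proof. by move=> e0 ax xb; rewrite /plateau sstep_ge// sstep_le// subr0. Qed.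

Lemma plateau_itv a b e x : a < b -> 0 < e -> a + e < b -> 0 <= plateau a b e x <= 1.
Proof.
move=> ab e0 abe; have [xa|ax] := leP x a.
  by rewrite plateau_out ?lexx ?ler01//; left.
rewrite /plateau; have [xb|bx] := leP x b.
  by rewrite [X in _ - X]sstep_le// subr0; exact: sstep_itv.
rewrite sstep_ge//; last lra.
by have := sstep_itv ((x - b) / e); lra.
Qed.


Lemma test_plateau a b e : -1 < a -> a < b -> 0 < e -> b + e < 1 ->
  test_fun (plateau a b e) /\
  forall x, derive1 (plateau a b e) x =
    (rho ((x - a) / e) - rho ((x - b) / e)) / (e * Int 0 1 rho).
Proof.
move=> a1 ab e0 b1; have [D [dD D0 D1]] := sstep_chain.
pose E n x := e^-1 ^+ n * (D n ((x - a) / e) - D n ((x - b) / e)).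
have dE : deriv_chain E.
  move=> n x.
  have daff c : is_derive x (1 : R) (fun x : R => (x - c) / e) e^-1.
    have d1 : is_derive x (1 : R) (fun x : R => x - c) 1.
      by apply: is_derive_eq; rewrite oppr0 addr0.
    have := is_deriveZ e^-1 d1; rewrite /GRing.scale/= mulr1.
    by congr is_derive; apply/funext => y; rewrite /GRing.scale/= mulrC.
  have da := @is_derive1_comp _ _ _ x _ _ (dD n ((x - a) / e)) (daff a).
  have db := @is_derive1_comp _ _ _ x _ _ (dD n ((x - b) / e)) (daff b).
  have := is_deriveZ (e^-1 ^+ n) (is_deriveB da db).
  rewrite -[_ *: (_ - _)]/(_ * _) /E exprS.
  by congr is_derive; ring.
have E0 : E 0%N = plateau a b e.
  by apply/funext => x; rewrite /E expr0 mul1r D0.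
split; last first.
  move=> x; rewrite -E0 derive1E; have [_ ->] := dE 0%N x.
  by rewrite /E expr1 D1; field; rewrite !gt_eqF ?rho_mass_gt0.
split=> [n x|].
  by rewrite -E0 derive1n_chain//; case: (dE n x).
exists a, (b + e); split=> // x h; exact: plateau_out.
Qed.

End SmoothStep.

(** * Functions with a weak derivative are primitives almost everywhere *)

Section WeakDerivatives.
Variable R : realType.
Local Notation mu := (@lebesgue_measure R).
Local Notation rho := (ebump (1 : {poly R}) 0%N).
Implicit Types (u g : R -> R) (a b e : R).

Lemma aeS (P Q : R -> Prop) : (forall x, P x -> Q x) ->
  {ae mu, forall x, P x} -> {ae mu, forall x, Q x}.
Proof. by move=> PQ; apply: filterS; first exact: (ae_filter_ringOfSetsType mu). Qed.

Lemma aeS2 (P Q S : R -> Prop) : (forall x, P x -> Q x -> S x) ->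
  {ae mu, forall x, P x} -> {ae mu, forall x, Q x} -> {ae mu, forall x, S x}.
Proof. by move=> PQS; apply: filterS2; first exact: (ae_filter_ringOfSetsType mu). Qed.

(** Lebesgue points are defined by centred averages. The ball has length [2 e], so the one-sided
    average is at most twice the centred one; hence [d / 2] in the proof. *)
Lemma lebesgue_pt_near u a (d : R) : rint (-1) 1 u -> -1 < a < 1 ->
  lebesgue_pt (u \_ `[-1, 1]) a -> 0 < d ->
  \forall e \near 0^'+, Int a (a + e) (fun x => `|u x - u a|) <= d * e.
Proof.
move=> ru /andP[a1 a2] /fine_cvgP[fin lim] d0.
have d20 : 0 < d / 2 by rewrite divr_gt0.
have near1 := cvgr_le _ lim _ d20.
near=> e.
have e0 : 0 < e by near: e; exact: nbhs_right_gt.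
have ae1 : a + e < 1.
  rewrite -ltrBrDl; near: e; apply: nbhs_right_lt; lra.
pose v := u \_ `[-1, 1]; pose w x := `|v x - v a|.
have va : v a = u a by rewrite /v patchE mem_set//= in_itv/= !ltW.
have mw : measurable_fun [set: R] w.
  apply: measurableT_comp => //; apply: measurable_funB => //.
  apply/(measurable_restrictT _ _).1 => //.
  exact: rint_measurable ru.
have rw : rint a (a + e) w.
  apply: (@rint_eq _ _ _ (fun x => `|u x - u a|)).
    move=> x /andP[xa xe]; rewrite /w va /v patchE mem_set//= in_itv/=.
    by apply/andP; split; lra.
  apply: rint_abs; apply: rintB; last exact: rint_cst.
  by apply: rint_sub ru; lra.
have IE : Int a (a + e) (fun x => `|u x - u a|) =
    \int[mu]_(x in `[a, a + e[) w x.
  rewrite Rintegral_itv_bndo_bndc; last first.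
    by apply: integrableS rw => //; apply: subset_itv; rewrite bnd_simp.
  apply: eq_Int => x /andP[xa xe]; rewrite /w va /v patchE mem_set//= in_itv/=.
  by apply/andP; split; lra.
have fe : fine (davg v a e) <= d / 2 by near: e; exact: near1.
have finE : davg v a e \is a fin_num by near: e; exact: fin.
have bE : ball a e = `]a - e, a + e[%classic by rewrite ball_itv.
have intE : (\int[mu]_(y in ball a e) (w y)%:E = (e *+ 2)%:E * davg v a e)%E.
  rewrite /davg /iavg lebesgue_measure_ball ?(ltW e0)//.
  have e20 : e *+ 2 != 0 by rewrite mulrn_eq0/= gt_eqF.
  rewrite muleA inver (negbTE e20) -EFinM divff// mul1e.
  by apply: eq_integral.
rewrite IE -lee_fin /Rintegral fineK; last first.
  apply: integrable_fin_num => //.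
  by apply: integrableS rw => //; apply: subset_itv; rewrite bnd_simp.
apply: (@le_trans _ _ (\int[mu]_(y in ball a e) (w y)%:E)%E).
  apply: ge0_subset_integral => //; first by rewrite bE.
  - apply/measurable_EFinP; exact: measurable_funTS.
  - by move=> x _; rewrite lee_fin normr_ge0.
  - by rewrite bE; apply: subset_itv; rewrite bnd_simp//; lra.
rewrite intE -(fineK finE) -EFinM lee_fin -mulr_natr; nra.
Unshelve. all: by end_near. Qed.

Lemma Int_supp a b (f : R -> R) : -1 <= a -> a <= b -> b <= 1 -> rint (-1) 1 f ->
  (forall x, -1 <= x <= 1 -> x <= a \/ b <= x -> f x = 0) -> Int (-1) 1 f = Int a b f.
Proof.
move=> a1 ab b1 rf f0.
have z c d : -1 <= c -> c <= d -> d <= 1 -> d <= a \/ b <= c -> Int c d f = 0.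
  move=> c1 cd d1 h; rewrite (@eq_Int _ _ _ _ (fun=> 0)) ?Int_cst ?mul0r//.
  move=> x /andP[cx xd]; apply: f0; first by apply/andP; split; lra.
  by case: h => h; [left|right]; lra.
rewrite (@Int_split _ (-1) a 1)//; last lra.
rewrite (@Int_split _ a b 1)//; last by apply: rint_sub rf.
by rewrite z ?add0r ?(z b) ?addr0//; lra.
Qed.

Lemma Int_abs_near g a (d : R) : sqint (-1) 1 g -> -1 < a < 1 -> 0 < d ->
  \forall e \near 0^'+, Int a (a + e) (fun x => `|g x|) <= d.
Proof.
move=> sg /andP[a1 a2] d0; pose G := Int (-1) 1 (fun x => g x ^+ 2).
have G0 : 0 <= G by apply: Int_ge0 => x _; exact: sqr_ge0.
near=> e.
have e0 : 0 < e by near: e; exact: nbhs_right_gt.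
have ae1 : a + e < 1 by rewrite -ltrBrDl; near: e; apply: nbhs_right_lt; lra.
have ed : e < d ^+ 2 / (G + 1).
  by near: e; apply: nbhs_right_lt; rewrite divr_gt0 ?exprn_gt0// ltr_wpDl.
have sga : sqint a (a + e) g by apply: sqint_sub sg; lra.
have ae : a <= a + e by lra.
have := Int_abs_sqr ae sga; rewrite addrAC subrr add0r.
have : Int a (a + e) (fun x => g x ^+ 2) <= G.
  by apply: Int_mono => //; [lra|lra|case: sg|move=> x _; exact: sqr_ge0].
rewrite ltr_pdivlMr ?ltr_wpDl// in ed.
set I := Int _ _ _; set J := Int _ _ _ => IG JI.
have J0 : 0 <= J by exact: Int_ge0.
have : J ^+ 2 <= d ^+ 2 by nra.
by rewrite ler_pXn2r ?nnegrE// ltW.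
Unshelve. all: by end_near. Qed.

Lemma rho_bounded : exists2 C : R, 0 < C & forall x : R, `|rho x| <= C.
Proof.
have [C rC] := ebump_le (1 : {poly R}) 0; exists (`|C| + 1); first by rewrite ltr_wpDl.
move=> x; have [x01|x01] := boolP ((0 < x) && (x < 1)); last first.
  by rewrite /ebump (negbTE x01) normr0 addr_ge0.
apply: (le_trans (rC x)); have := ler_norm C; move/andP: x01 => [x0 x1].
have q0 : 0 <= (x * (1 - x)) ^+ 2 by exact: sqr_ge0.
have q1 : (x * (1 - x)) ^+ 2 <= 1 by rewrite expr_le1//; nra.
have := normr_ge0 C; nra.
Qed.

Lemma mollify_near u a (d : R) : rint (-1) 1 u -> -1 < a < 1 ->
  lebesgue_pt (u \_ `[-1, 1]) a -> 0 < d ->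
  \forall e \near 0^'+,
    `|Int (-1) 1 (fun x => u x * (rho ((x - a) / e) / (e * Int 0 1 rho))) - u a| <= d.
Proof.
move=> ru a11 lpt d0; have /andP[a1 a2] := a11.
have [C C0 rC] := rho_bounded; set Z := Int 0 1 rho.
have Z0 : 0 < Z by exact: rho_mass_gt0.
(* The mollifier is at most [C / (e * Z)]; multiplied by [d * Z / C * e] this gives exactly [d]. *)
have d'0 : 0 < d * Z / C by rewrite divr_gt0// mulr_gt0.
have near1 := lebesgue_pt_near ru a11 lpt d'0.
near=> e.
have e0 : 0 < e by near: e; exact: nbhs_right_gt.
have ae1 : a + e < 1 by rewrite -ltrBrDl; near: e; apply: nbhs_right_lt; lra.
have Ie : Int a (a + e) (fun x => `|u x - u a|) <= d * Z / C * e by near: e; exact: near1.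
pose k x := rho ((x - a) / e) / (e * Z).
have dk (x : R) : is_derive x 1 (fun x => sstep ((x - a) / e)) (k x).
  have d1 : is_derive x (1 : R) (fun x : R => x - a) 1.
    by apply: is_derive_eq; rewrite oppr0 addr0.
  have d2 : is_derive x (1 : R) (fun x : R => (x - a) / e) e^-1.
    have := is_deriveZ e^-1 d1; rewrite /GRing.scale/= mulr1.
    by congr is_derive; apply/funext => y; rewrite /GRing.scale/= mulrC.
  have := @is_derive1_comp _ _ _ x _ _ (is_derive_sstep ((x - a) / e)) d2.
  by congr is_derive; rewrite /k -/Z; field; rewrite !gt_eqF.
have ck : continuous k.
  move=> x; apply: cvgM; last exact: cvg_cst.
  apply: (@continuous_comp _ _ _ (fun x => (x - a) / e) rho); last exact: continuous_rho.
  apply: cvgM; last exact: cvg_cst.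
  by apply: cvgB; [exact: cvg_id|exact: cvg_cst].
have k1 : Int (-1) 1 k = 1.
  have N11 : -1 <= 1 :> R by lra.
  rewrite (Int_FTC N11 dk ck) (sstep_out ((1 - a) / e)).2; last first.
    by rewrite ler_pdivlMr// mul1r; lra.
  by rewrite (sstep_out _).1 ?subr0// ler_pdivrMr// mul0r; lra.
have kout x : x <= a \/ a + e <= x -> k x = 0.
  move=> h; rewrite /k rho_out ?mul0r//.
  by rewrite ler_pdivrMr// mul0r ler_pdivlMr// mul1r; case: h => h; [left|right]; lra.
have kC x : `|k x| <= C / (e * Z).
  rewrite /k normrM [`|(_ * _)^-1|]gtr0_norm ?invr_gt0 ?mulr_gt0//.
  by rewrite ler_wpM2r// invr_ge0 mulr_ge0 ?ltW.
have mk : measurable_fun `[(-1 : R), 1] k by exact: measurable_itv_continuous.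
have rk : rint (-1) 1 k by exact: rint_continuous.
have ruk : rint (-1) 1 (fun x => k x * u x) by exact: (rintM_bounded mk (fun x _ => kC x)).
have rd : rint (-1) 1 (fun x => k x * (u x - u a)).
  by apply: (rintM_bounded mk (fun x _ => kC x)); apply: rintB => //; exact: rint_cst.
have -> : Int (-1) 1 (fun x => u x * k x) - u a = Int (-1) 1 (fun x => k x * (u x - u a)).
  have kua : Int (-1) 1 (fun x => u a * k x) = u a by rewrite IntZ// k1 mulr1.
  rewrite -[X in _ - X = _]kua -IntB//.
  - by apply: eq_Int => x _; ring.
  - by apply: rint_eq ruk => x _; rewrite mulrC.
  - exact: rintZ.
rewrite (@Int_supp a (a + e))//; try lra; last first.
  by move=> x _ /kout ->; rewrite mul0r.
have rd' : rint a (a + e) (fun x => k x * (u x - u a)) by apply: rint_sub rd; lra.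
have ra : rint a (a + e) (fun x => `|u x - u a|).
  by apply: rint_abs; apply: rintB; [apply: rint_sub ru; lra|exact: rint_cst].
apply: le_trans (ler_norm_Int rd') _.
apply: (@le_trans _ _ (Int a (a + e) (fun x => C / (e * Z) * `|u x - u a|))).
  apply: le_Int; [exact: rint_abs|exact: rintZ|].
  by move=> x _; rewrite normrM ler_wpM2r.
rewrite IntZ//; apply: (@le_trans _ _ (C / (e * Z) * (d * Z / C * e))).
  by rewrite ler_wpM2l// divr_ge0 ?mulr_ge0 ?ltW.
by rewrite le_eqVlt; apply/orP; left; apply/eqP; field; rewrite !gt_eqF.
Unshelve. all: by end_near. Qed.

Lemma Int_plateau g a b e : rint (-1) 1 g -> -1 < a -> 0 < e -> a + e < b -> b + e < 1 ->
  `|Int (-1) 1 (fun x => g x * plateau a b e x) - Int a b g|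
    <= Int a (a + e) (fun x => `|g x|) + Int b (b + e) (fun x => `|g x|).
Proof.
move=> rg a1 e0 abe be1.
have ab : a < b by rewrite (lt_trans _ abe)// ltrDl.
have pI x : 0 <= plateau a b e x <= 1 by exact: plateau_itv.
have cp : continuous (plateau a b e).
  move=> x; have := (test_plateau a1 ab e0 be1).1.1 0%N x; rewrite derive1n0 => h.
  exact/differentiable_continuous/derivable1_diffP.
have h1 : -1 <= b by rewrite ltW// (lt_trans a1).
have h2 : b <= 1 by rewrite ltW// (lt_trans _ be1)// ltrDl.
have h3 : a + e <= 1 by rewrite (le_trans (ltW abe)).
have h4 : a <= a + e by rewrite lerDl ltW.
have h5 : b <= b + e by rewrite lerDl ltW.
have h6 : -1 <= a + e by rewrite (le_trans (ltW a1)).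
have rgp : rint (-1) 1 (fun x => g x * plateau a b e x).
  have pC : forall x, -1 <= x <= 1 -> `|plateau a b e x| <= 1.
    by move=> x _; have /andP[p0 p1] := pI x; rewrite ger0_norm.
  have := rintM_bounded (measurable_itv_continuous cp) pC rg.
  by apply: rint_eq => x _; rewrite mulrC.
have rgp' c c' : -1 <= c -> c' <= 1 -> rint c c' (fun x => g x * plateau a b e x).
  by move=> c1 c2; apply: rint_sub rgp.
have rg' c c' : -1 <= c -> c' <= 1 -> rint c c' g by move=> c1 c2; apply: rint_sub rg.
have ba1 : -1 <= a by exact: ltW.
have be1' : b + e <= 1 by exact: ltW.
have abe' : a <= b + e by rewrite (le_trans (ltW ab)).
have -> : Int (-1) 1 (fun x => g x * plateau a b e x) =
    Int a (b + e) (fun x => g x * plateau a b e x).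
  by apply: Int_supp => // x _ h; rewrite plateau_out// mulr0.
rewrite (@Int_split _ a b (b + e)) ?(ltW ab)//; last exact: rgp'.
have mid : Int a b (fun x => g x * plateau a b e x) - Int a b g =
    Int a (a + e) (fun x => g x * plateau a b e x - g x).
  rewrite (@Int_split _ a (a + e) b) ?(ltW abe)//; last exact: rgp'.
  rewrite (@Int_split _ a (a + e) b g) ?(ltW abe)//; last exact: rg'.
  rewrite IntB; [|exact: rgp'|exact: rg'].
  rewrite (@eq_Int _ (a + e) b _ g); first ring.
  by move=> x /andP[x1 x2]; rewrite plateau_mid// mulr1.
rewrite addrAC mid; apply: le_trans (ler_normD _ _) _; apply: lerD.
  have r1 : rint a (a + e) (fun x => g x * plateau a b e x - g x).
    by apply: rintB; [exact: rgp'|exact: rg'].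
  apply: le_trans (ler_norm_Int r1) _.
  apply: le_Int; [exact: rint_abs|by apply: rint_abs; exact: rg'|].
  move=> x _; have /andP[p0 p1] := pI x.
  have -> : g x * plateau a b e x - g x = g x * (plateau a b e x - 1) by ring.
  by rewrite normrM ler_piMr// ler0_norm ?subr_le0// opprB lerBlDr lerDl.
have r1 : rint b (b + e) (fun x => g x * plateau a b e x) by exact: rgp'.
apply: le_trans (ler_norm_Int r1) _.
apply: le_Int; [exact: rint_abs|by apply: rint_abs; exact: rg'|].
move=> x _; have /andP[p0 p1] := pI x.
by rewrite normrM ler_piMr// ger0_norm.
Qed.

Definition real_weak_deriv u g := forall phi, test_fun phi ->
  Int (-1) 1 (fun x => u x * derive1 phi x) = - Int (-1) 1 (fun x => g x * phi x).

(** Testing with [plateau a b e] and letting [e] tend to 0, one side becomes [u a - u b] and the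
    other minus the integral of [g]. The four errors of size [d / 4] are the two mollifications of
    [u] and the two flanks of the plateau against [g]. *)
Lemma weak_deriv_lebesgue_pts u g a b : sqint (-1) 1 u -> sqint (-1) 1 g ->
  real_weak_deriv u g -> -1 < a -> a < b -> b < 1 ->
  lebesgue_pt (u \_ `[-1, 1]) a -> lebesgue_pt (u \_ `[-1, 1]) b ->
  u b - u a = Int a b g.
Proof.
move=> su sg H a1 ab b1 la lb; have [ru rg] := (sqint_rint su, sqint_rint sg).
have aI : -1 < a < 1 by rewrite a1 (lt_trans ab).
have bI : -1 < b < 1 by rewrite b1 (lt_trans a1).
apply/eqP; rewrite -subr_eq0 -normr_le0; apply/ler_addgt0Pl => d d0; rewrite addr0.
have d40 : 0 < d / 4 by rewrite divr_gt0.
have na := mollify_near ru aI la d40; have nb := mollify_near ru bI lb d40.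
have ga := Int_abs_near sg aI d40; have gb := Int_abs_near sg bI d40.
have : \forall e \near (0 : R)^'+, `|u b - u a - Int a b g| <= d; last first.
  by move/(@filter_ex _ _ _) => [].
near=> e.
have e0 : 0 < e by near: e; exact: nbhs_right_gt.
have abe : a + e < b by rewrite -ltrBrDl; near: e; apply: nbhs_right_lt; rewrite subr_gt0.
have be1 : b + e < 1 by rewrite -ltrBrDl; near: e; apply: nbhs_right_lt; lra.
have ua0 : `|Int (-1) 1 (fun x => u x * (rho ((x - a) / e) / (e * Int 0 1 rho))) - u a|
  <= d / 4 by near: e; exact: na.
have ub0 : `|Int (-1) 1 (fun x => u x * (rho ((x - b) / e) / (e * Int 0 1 rho))) - u b|
  <= d / 4 by near: e; exact: nb.
have [tp dp] := test_plateau a1 ab e0 be1; have := H _ tp.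
set Z := Int 0 1 rho in dp *.
have Z0 : 0 < Z by exact: rho_mass_gt0.
pose k c x := rho ((x - c) / e) / (e * Z).
have [C C0 rC] := rho_bounded.
have ck c : continuous (k c).
  move=> x; apply: cvgM; last exact: cvg_cst.
  apply: (@continuous_comp _ _ _ (fun x => (x - c) / e) rho); last exact: continuous_rho.
  apply: cvgM; last exact: cvg_cst.
  by apply: cvgB; [exact: cvg_id|exact: cvg_cst].
have kC c x : `|k c x| <= C / (e * Z).
  rewrite /k normrM [`|(_ * _)^-1|]gtr0_norm ?invr_gt0 ?mulr_gt0//.
  by rewrite ler_wpM2r// invr_ge0 mulr_ge0 ?ltW.
have ruk c : rint (-1) 1 (fun x => u x * k c x).
  have := rintM_bounded (measurable_itv_continuous (ck c)) (fun x _ => kC c x) ru.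
  by apply: rint_eq => x _; rewrite mulrC.
rewrite (@eq_Int _ _ _ _ (fun x => u x * k a x - u x * k b x)); last first.
  by move=> x _; rewrite dp /k; ring.
rewrite IntB//.
have ua : `|Int (-1) 1 (fun x => u x * k a x) - u a| <= d / 4 by exact: ua0.
have ub : `|Int (-1) 1 (fun x => u x * k b x) - u b| <= d / 4 by exact: ub0.
have va : Int a (a + e) (fun x => `|g x|) <= d / 4 by near: e; exact: ga.
have vb : Int b (b + e) (fun x => `|g x|) <= d / 4 by near: e; exact: gb.
have pl := Int_plateau rg a1 e0 abe be1.
move: ua ub va vb pl; clear; rewrite !ler_norml.
set I1 := Int _ _ _; set I2 := Int _ _ _; set I3 := Int _ _ _; set I4 := Int _ _ _.
set I5 := Int _ _ _; set I6 := Int _ _ _.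
move: I1 I2 I3 I4 I5 I6 => I1 I2 I3 I4 I5 I6; lra.
Unshelve. all: by end_near. Qed.

Lemma weak_deriv_ae u g : sqint (-1) 1 u -> sqint (-1) 1 g -> real_weak_deriv u g ->
  exists c, {ae mu, forall x, Iset x -> u x = c + Int (-1) x g}.
Proof.
move=> su sg H; have rg := sqint_rint sg.
have lpt : {ae mu, forall x, lebesgue_pt (u \_ `[-1, 1]) x}.
  apply: lebesgue_differentiation; apply: integrable_locally_restrict => //.
  exact: sqint_rint su.
(* Otherwise the open interval, of measure 2, would lie in a null set. *)
have [x0 x01 l0] : exists2 x0, -1 < x0 < 1 & lebesgue_pt (u \_ `[-1, 1]) x0.
  apply: contrapT => nex.
  have [A [mA A0 lA]] := lpt.
  pose J : set R := `]-1, 1[%classic.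
  have : (mu J <= mu A)%E.
    apply: le_measure; [by rewrite inE; exact: measurable_itv|by rewrite inE|].
    move=> x; rewrite /J /= in_itv/= => x1; apply: lA => /= lx.
    by apply: nex; exists x.
  rewrite A0 /J lebesgue_measure_itv/= lte_fin ifT; last lra.
  by rewrite -EFinD lee_fin; lra.
exists (u x0 - Int (-1) x0 g).
have ends : {ae mu, forall x, x != -1 /\ x != 1}.
  exists [set -1; 1]; split => //.
  - by apply: measurableU; exact: measurable_set1.
  - apply: measure_negligible; first by apply: measurableU; exact: measurable_set1.
    by apply: negligibleU; apply/negligibleP => //; exact: lebesgue_measure_set1.
  - move=> x /= /not_andP[]/negP/negPn/eqP ->; [by left|by right].
move: lpt ends; apply: aeS2 => x lx [xN1 x1]; rewrite /Iset /= in_itv/= => /andP[h1 h2].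
have h1' : -1 < x by rewrite lt_neqAle eq_sym xN1.
have h2' : x < 1 by rewrite lt_neqAle x1.
move/andP : x01 => [x01 x02].
have [xx|xx|->] := ltgtP x x0.
- have := weak_deriv_lebesgue_pts su sg H h1' xx x02 lx l0.
  rewrite (@Int_split _ (-1) x x0)//; [lra|lra|].
  by apply: rint_sub rg; lra.
- have := weak_deriv_lebesgue_pts su sg H x01 xx h2' l0 lx.
  rewrite (@Int_split _ (-1) x0 x)//; [lra|lra|lra|].
  by apply: rint_sub rg; lra.
- by rewrite subrK.
Qed.

End WeakDerivatives.

(** * Integrals of possibly nonmeasurable functions that agree almost everywhere *)

Section NonmeasurableAE.
Import HBNNSimple.
Local Open Scope ereal_scope.
Context d (T : measurableType d) (R : realType) (mu : {measure set T -> \bar R}).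
Implicit Types (f g : T -> \bar R).

(* The integral of a nonnegative function is a supremum over simple functions, hence
   insensitive to null sets even when the function is not measurable. *)
Lemma ge0_integral_null_le (N : set T) f g : measurable N -> mu N = 0 ->
  (forall x, 0 <= f x) -> (forall x, 0 <= g x) -> (forall x, ~ N x -> f x = g x) ->
  \int[mu]_x f x <= \int[mu]_x g x.
Proof.
move=> mN N0 f0 g0 fg; rewrite ge0_integralTE//; apply: ge_ereal_sup => _ [h hf <-].
have mNc : measurable (~` N) by exact: measurableC.
rewrite -integralT_nnsfun.
(* Cutting the simple function off on [N] keeps its integral and puts it below [g]. *)
have -> : \int[mu]_x (h x)%:E = \int[mu]_x (proj_nnsfun h mNc x)%:E.
  apply: ae_eq_integral => //; [exact/measurable_EFinP|exact/measurable_EFinP|].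
  exists N; split=> // x /= h1; apply: contrapT => Nx; apply: h1 => _.
  by rewrite /mindic /= indicE mem_set ?mulr1.
rewrite integralT_nnsfun ge0_integralTE//; apply: ereal_sup_ubound.
exists (proj_nnsfun h mNc) => //= x; rewrite /mindic indicE.
have [Nx|Nx] := boolP (x \in ~` N).
  by rewrite mulr1 -fg ?hf//; move: Nx; rewrite inE.
by rewrite mulr0 g0.
Qed.

Lemma integral_ae_nonmeasurable (D : set T) f g :
  {ae mu, forall x, D x -> f x = g x} -> \int[mu]_(x in D) f x = \int[mu]_(x in D) g x.
Proof.
move=> [N [mN N0 NP]].
have fg x : ~ N x -> D x -> f x = g x.
  by move=> Nx Dx; apply: contrapT => h; apply: Nx; apply: NP => /= /(_ Dx).
have key (p q : T -> \bar R) : (forall x, 0 <= p x) -> (forall x, 0 <= q x) ->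
    (forall x, ~ N x -> D x -> p x = q x) -> \int[mu]_(x in D) p x <= \int[mu]_(x in D) q x.
  move=> p0 q0 pq; rewrite integral_mkcond [leRHS]integral_mkcond.
  apply: (ge0_integral_null_le mN N0); try by move=> x; apply: erestrict_ge0.
  by move=> x Nx; rewrite !patchE; case: ifPn => // /set_mem; exact: pq.
rewrite integralE [RHS]integralE; congr (_ - _); apply/eqP; rewrite eq_le;
  apply/andP; split; apply: key => // x Nx Dx; by rewrite ?funeposE ?funenegE fg.
Qed.

End NonmeasurableAE.

(** * Spline approximation in Sobolev spaces *)

Section SobolevApproximation.
Variable R : realType.
Local Notation mu := (@lebesgue_measure R).
Implicit Types (u v w : R -> R[i]) (a : nat -> R -> R) (f g : R -> R).

Lemma eq_Int_ae f g : rint (-1) 1 f -> rint (-1) 1 g ->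
  {ae mu, forall x, Iset x -> f x = g x} -> Int (-1) 1 f = Int (-1) 1 g.
Proof.
move=> rf rg fg; rewrite /Int /Rintegral; congr fine; apply: ae_eq_integral => //.
- exact: measurable_int rf.
- exact: measurable_int rg.
- by move: fg; apply: aeS => x fgx xI; rewrite fgx.
Qed.

Lemma sobolev_tspline_approx k : exists2 C, 0 < C & forall a,
  (forall j, (j <= k.+1)%N -> sqint (-1) 1 (a j)) ->
  (forall j, (j <= k)%N -> real_weak_deriv (a j) (a j.+1)) ->
  forall N t, is_partition N t -> exists2 s, tspline N t k s &
    Int (-1) 1 (fun x => (a 0%N x - s x) ^+ 2)
      <= C * (mesh N t ^+ k.+1) ^+ 2 * Int (-1) 1 (fun x => a k.+1 x ^+ 2).
Proof.
elim: k => [|k [C C0 ih]].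
  exists 1 => // a sa wa N t tP.
  have [c ac] := weak_deriv_ae (sa 0%N isT) (sa 1%N isT) (wa 0%N isT).
  have rd := sqint_rint (sa 1%N isT).
  have [s Ts sB] := @tspline_jackson _ _ _ tP 0%N (fun x => c + Int (-1) x (a 1%N)) c _
    (sa 1%N isT) (fun x _ => erefl).
  exists s => //; rewrite mul1r expr1; move: sB; rewrite expr0 mul1r; apply: le_trans.
  rewrite le_eqVlt; apply/orP; left; apply/eqP; apply: eq_Int_ae.
  - by apply: (sqintB (sa 0%N isT) (tspline_sqint Ts)).2.
  - by apply: (sqintB (sqint_Int c rd) (tspline_sqint Ts)).2.
  - by move: ac; apply: aeS => x ax xI; rewrite ax.
(* Each order adds the constant of the first order estimate in degree [k.+1]. *)
exists ((2 ^+ k.+1) ^+ 2 * C); first by rewrite mulr_gt0// exprn_gt0// exprn_gt0.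
move=> a sa wa N t tP.
have [|j jk|s1 Ts1 s1B] := ih (fun j => a j.+1) _ _ N t tP.
- by move=> j jk; exact: sa.
- exact: wa.
have [S TS SE] := tspline_antideriv tP Ts1.
have [c ac] := weak_deriv_ae (sa 0%N isT) (sa 1%N isT) (wa 0%N isT).
have sd := sqintB (sa 1%N isT) (tspline_sqint Ts1).
have ra1 := sqint_rint (sa 1%N isT); have rs1 := sqint_rint (tspline_sqint Ts1).
(* The first order estimate is applied to the remainder, a primitive of [a 1 - s1], so that the new
   power of the mesh multiplies the error already achieved by [s1]. *)
have [s2 Ts2 s2B] := @tspline_jackson _ _ _ tP k.+1
  (fun x => c + Int (-1) x (fun x => a 1%N x - s1 x)) c _ sd (fun x _ => erefl).
exists (fun x => S x + s2 x); first exact: tsplineD.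
set A := Int _ _ (fun x => a k.+2 x ^+ 2) in s1B *.
have -> : Int (-1) 1 (fun x => (a 0%N x - (S x + s2 x)) ^+ 2) =
  Int (-1) 1 (fun x => (c + Int (-1) x (fun x => a 1%N x - s1 x) - s2 x) ^+ 2).
  apply: eq_Int_ae.
  - by apply: (sqintB (sa 0%N isT) (tspline_sqint (tsplineD TS Ts2))).2.
  - by apply: (sqintB (sqint_Int c (sqint_rint sd)) (tspline_sqint Ts2)).2.
  - move: ac; apply: aeS => x ax xI; rewrite ax//; move: xI.
    rewrite /Iset /= in_itv/= => x1; have /andP[_ x2] := x1.
    rewrite SE// IntB; [congr (_ ^+ 2); ring|exact: rint_sub ra1|exact: rint_sub rs1].
have := le_trans s2B (ler_wpM2l (sqr_ge0 (2 ^+ k.+1 * mesh N t)) s1B).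
move=> /= /le_trans; apply.
by rewrite le_eqVlt; apply/orP; left; apply/eqP; rewrite [mesh N t ^+ k.+2]exprS; ring.
Qed.

Lemma sqint_of_measurable f (g : R -> R) : measurable_fun `[(-1 : R), 1] f ->
  measurable_fun `[(-1 : R), 1] g -> (forall x, f x ^+ 2 <= g x) ->
  (\int[mu]_(x in @Iset R) (g x)%:E < +oo)%E -> sqint (-1) 1 f.
Proof.
move=> mf mg fg goo; split=> //.
apply: (@rint_le _ _ _ _ g); first exact: measurable_funX.
  by move=> x _; rewrite ger0_norm ?sqr_ge0.
apply/integrableP; split; first exact/measurable_EFinP.
suff -> : (fun x => `|(EFin \o g) x|%E) = (fun x => (g x)%:E) by [].
by apply/funext => x /=; rewrite ger0_norm// (le_trans _ (fg x))// sqr_ge0.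
Qed.

Lemma L2P u : L2 u <->
  sqint (-1) 1 (fun x => cre (u x)) /\ sqint (-1) 1 (fun x => cim (u x)).
Proof.
split=> [[mr mi uoo]|[sr si]].
  have mc : measurable_fun `[(-1 : R), 1] (fun x => csq (u x)).
    by apply: measurable_funD; apply: measurable_funX.
  split; apply: (sqint_of_measurable _ mc) => //.
    by move=> x; rewrite /csq lerDl sqr_ge0.
  by move=> x; rewrite /csq lerDr sqr_ge0.
split; [exact: sr.1|exact: si.1|].
have := rintD sr.2 si.2 => /integrableP[_].
suff -> : (fun x => `|(EFin \o (fun x => cre (u x) ^+ 2 + cim (u x) ^+ 2)%R) x|%E) =
  (fun x => (csq (u x))%:E) by [].
by apply/funext => x /=; rewrite ger0_norm// addr_ge0 ?sqr_ge0.
Qed.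

Lemma L2norm_sqr u : L2 u -> L2norm u ^+ 2 =
  Int (-1) 1 (fun x => cre (u x) ^+ 2) + Int (-1) 1 (fun x => cim (u x) ^+ 2).
Proof.
move=> /L2P[sr si]; rewrite /L2norm sqr_sqrtr.
  by rewrite -IntD; [|exact: sr.2|exact: si.2].
by apply: Rintegral_ge0 => x _; rewrite addr_ge0 ?sqr_ge0.
Qed.

Lemma weak_deriv_components u v : weak_deriv u v ->
  real_weak_deriv (fun x => cre (u x)) (fun x => cre (v x)) /\
  real_weak_deriv (fun x => cim (u x)) (fun x => cim (v x)).
Proof.
move=> uv; split=> phi /uv; rewrite /Cint => -[re im].
- move: re; rewrite /Int => re.
  rewrite (_ : (fun x => cre (u x) * _) = (fun x => cre (u x * (derive1 phi x)%:C))).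
    rewrite re; congr (- _); congr Rintegral; apply/funext => x.
    by rewrite /cre; case: (v x) => p q /=; rewrite mulr0 subr0.
  by apply/funext => x; rewrite /cre; case: (u x) => p q /=; rewrite mulr0 subr0.
- move: im; rewrite /Int => im.
  rewrite (_ : (fun x => cim (u x) * _) = (fun x => cim (u x * (derive1 phi x)%:C))).
    rewrite im; congr (- _); congr Rintegral; apply/funext => x.
    by rewrite /cim; case: (v x) => p q /=; rewrite mulr0 add0r.
  by apply/funext => x; rewrite /cim; case: (u x) => p q /=; rewrite mulr0 add0r.
Qed.

(** The estimate concerns the representative [D 0] because [w], which agrees with it almost
    everywhere, may fail to be measurable. *)
Lemma sobolev_spline_approx m : (0 < m)%N -> exists2 C, 0 < C & forall w D,
  Hm_chain m w D -> forall N t, is_partition N t -> exists s,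
  [/\ spline m N t s, L2 s &
      L2norm (fun x => D 0%N x - s x) <= C * mesh N t ^+ m * L2norm (D m)].
Proof.
case: m => // k _; have [C C0 HC] := sobolev_tspline_approx k.
exists (Num.sqrt C); first by rewrite sqrtr_gt0.
move=> w D [_ LD wD] N t tP.
have [||s1 Ts1 s1B] := HC (fun j x => cre (D j x)) _ _ N t tP.
- by move=> j jk; case: ((L2P _).1 (LD j jk)).
- by move=> j jk; case: (weak_deriv_components (wD j jk)).
have [||s2 Ts2 s2B] := HC (fun j x => cim (D j x)) _ _ N t tP.
- by move=> j jk; case: ((L2P _).1 (LD j jk)).
- by move=> j jk; case: (weak_deriv_components (wD j jk)).
exists (fun x => s1 x +i* s2 x).
have Ls : L2 (fun x => s1 x +i* s2 x).
  by apply/L2P; split; [exact: tspline_sqint Ts1|exact: tspline_sqint Ts2].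
split=> //; first exact: spline_tspline.
have Lds : L2 (fun x => D 0%N x - (s1 x +i* s2 x)).
  have [d1 d2] := (L2P _).1 (LD 0%N isT); apply/L2P; split.
    apply: sqint_eq (sqintB d1 (tspline_sqint Ts1)) => x _.
    by rewrite /cre; case: (D 0%N x).
  apply: sqint_eq (sqintB d2 (tspline_sqint Ts2)) => x _.
  by rewrite /cim; case: (D 0%N x).
have h0 : 0 <= mesh N t by exact/ltW/mesh_gt0.
rewrite -(@ler_pXn2r _ 2)// ?nnegrE ?sqrtr_ge0 ?mulr_ge0 ?exprn_ge0 ?sqrtr_ge0//.
rewrite !exprMn (sqr_sqrtr (ltW C0)) !L2norm_sqr//; last exact: LD.
rewrite mulrDr lerD//.
- apply: le_trans s1B; rewrite le_eqVlt; apply/orP; left; apply/eqP/eq_Int => x _.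
  by rewrite /cre; case: (D 0%N x).
- apply: le_trans s2B; rewrite le_eqVlt; apply/orP; left; apply/eqP/eq_Int => x _.
  by rewrite /cim; case: (D 0%N x).
Qed.

End SobolevApproximation.

(** * Galerkin equations in a semi-inner product space *)

Section SemiInnerProduct.
Variables (R : realType) (E : lmodType R) (B : E -> E -> R).
Hypothesis BC : forall u v, B u v = B v u.
Hypothesis BD : forall u v w, B (u + v) w = B u w + B v w.
Hypothesis BZ : forall a u w, B (a *: u) w = a * B u w.
Hypothesis B_ge0 : forall u, 0 <= B u u.

Lemma sformDr u v w : B u (v + w) = B u v + B u w.
Proof. by rewrite BC BD ![B _ u]BC. Qed.

Lemma sformZr a u v : B u (a *: v) = a * B u v.
Proof. by rewrite BC BZ BC. Qed.

Lemma sform0l u : B 0 u = 0.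
Proof. by rewrite -(scale0r 0) BZ mul0r. Qed.

Lemma sform_suml (I : finType) (F : I -> E) w : B (\sum_i F i) w = \sum_i B (F i) w.
Proof. exact: (big_morph (B^~ w) (fun u v => BD u v w) (sform0l w)). Qed.

Lemma sform_sumr (I : finType) (F : I -> E) w : B w (\sum_i F i) = \sum_i B w (F i).
Proof. by rewrite BC sform_suml; apply: eq_bigr => i _; rewrite BC. Qed.

Lemma form_cauchy_schwarz u v : B u v ^+ 2 <= B u u * B v v.
Proof.
apply: discriminant_le => l; apply: le_trans (B_ge0 (u + l *: v)) _.
by rewrite BD !sformDr BZ !sformZr BZ (BC v u) le_eqVlt; apply/orP; left; apply/eqP; ring.
Qed.

Definition nrm u := Num.sqrt (B u u).

Lemma nrm_ge0 u : 0 <= nrm u. Proof. exact: sqrtr_ge0. Qed.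

Lemma nrm_sqr u : nrm u ^+ 2 = B u u. Proof. by rewrite sqr_sqrtr. Qed.

Lemma form_le_nrm u v : `|B u v| <= nrm u * nrm v.
Proof.
rewrite -(@ler_pXn2r _ 2)// ?nnegrE ?mulr_ge0 ?nrm_ge0//.
by rewrite real_normK ?num_real// exprMn !nrm_sqr form_cauchy_schwarz.
Qed.

Lemma nrmD u v : nrm (u + v) <= nrm u + nrm v.
Proof.
rewrite -(@ler_pXn2r _ 2)// ?nnegrE ?addr_ge0 ?nrm_ge0//.
rewrite sqrrD !nrm_sqr BD !sformDr (BC v u).
by have := form_le_nrm u v; rewrite ler_norml => /andP[_]; lra.
Qed.

Lemma nrmZ a u : nrm (a *: u) = `|a| * nrm u.
Proof. by rewrite /nrm BZ sformZr mulrA -expr2 sqrtrM ?sqr_ge0// sqrtr_sqr. Qed.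

Lemma nrmN u : nrm (- u) = nrm u.
Proof. by rewrite -scaleN1r nrmZ normrN1 mul1r. Qed.

Lemma nrm_le_orthogonal u v : B u v = 0 -> nrm u <= nrm (u - v).
Proof.
move=> uv; rewrite ler_wsqrtr// -scaleN1r BD !sformDr !BZ !sformZr (BC v u) uv.
by have := B_ge0 v; lra.
Qed.

(** By Cauchy-Schwarz such vectors are orthogonal to everything; spanning and independence below are
    understood modulo them. *)
Definition null u := B u u = 0.

Lemma null_form u v : null u -> B u v = 0.
Proof.
move=> u0; apply/eqP; rewrite -sqrf_eq0 eq_le sqr_ge0 andbT.
by have := form_cauchy_schwarz u v; rewrite u0 mul0r.
Qed.

Lemma null_formr u v : null v -> B u v = 0.
Proof. by move=> v0; rewrite BC null_form. Qed.

Lemma nullD u v : null u -> null v -> null (u + v).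
Proof. by move=> u0 v0; rewrite /null BD !null_form ?addr0. Qed.

Lemma nullZ a u : null u -> null (a *: u).
Proof. by move=> u0; rewrite /null BZ null_form ?mulr0. Qed.

Lemma null_sum (I : finType) (F : I -> E) : (forall i, null (F i)) -> null (\sum_i F i).
Proof.
by move=> F0; elim/big_ind: _ => //; [rewrite /null sform0l|exact: nullD].
Qed.

Definition lincomb n (c : 'rV[R]_n) (e : 'I_n -> E) := \sum_i c 0 i *: e i.

(** * Finite dimensional trial spaces modulo null vectors *)

Section Galerkin.
Variable V : E -> Prop.
Hypothesis V0 : V 0.
Hypothesis VD : forall u v, V u -> V v -> V (u + v).
Hypothesis VZ : forall a u, V u -> V (a *: u).
Variables (n : nat) (phi : 'I_n -> E).
Hypothesis Vspan : forall v, V v -> exists c : 'rV[R]_n, null (v - lincomb c phi).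

Definition independent k (e : 'I_k -> E) :=
  (forall i, V (e i)) /\ forall c : 'rV[R]_k, null (lincomb c e) -> c = 0.

Lemma V_lincomb k (c : 'rV[R]_k) e : (forall i, V (e i)) -> V (lincomb c e).
Proof.
by move=> Ve; rewrite /lincomb; elim/big_ind: _ => // i _; exact: VZ.
Qed.

(** With [k > n] the coefficient matrix over [phi] has a nonzero left kernel, whose vectors are
    relations modulo [null] among the [e i]. *)
Lemma independent_le k (e : 'I_k -> E) : independent e -> (k <= n)%N.
Proof.
move=> [Ve ie]; rewrite leqNgt; apply/negP => nk.
have /choice[M eM] : forall i, exists c : 'rV[R]_n, null (e i - lincomb c phi).
  by move=> i; exact: Vspan.
pose A : 'M[R]_(k, n) := \matrix_(i, j) M i 0 j.
have : kermx A != 0.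
  by rewrite -mxrank_eq0 mxrank_ker subn_eq0 -ltnNge (leq_ltn_trans (rank_leq_col A)).
case/rowV0Pn => c /sub_kermxP cA /eqP; apply; apply: ie.
have -> : lincomb c e = \sum_i c 0 i *: (e i - lincomb (M i) phi).
  rewrite /lincomb -[LHS]subr0; under [RHS]eq_bigr do rewrite scalerBr.
  rewrite sumrB; congr (_ - _).
  transitivity (\sum_j (c *m A) 0 j *: phi j).
    by rewrite cA big1// => j _; rewrite mxE scale0r.
  under [RHS]eq_bigr do rewrite scaler_sumr.
  rewrite exchange_big/=; apply: eq_bigr => j _; rewrite mxE scaler_suml.
  by apply: eq_bigr => i _; rewrite mxE scalerA.
by apply: null_sum => i; apply: nullZ; exact: eM.
Qed.

(** The [phi] span a space containing [V] but need not lie in it, as for the functions cut to single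
    cells used later. A basis inside [V] is therefore taken as a maximal independent family; if [v]
    cannot be added, its coefficient in the new relation is nonzero and the relation is solved for
    [v]. *)
Lemma ex_basis : exists k (e : 'I_k -> E), independent e /\
  forall v, V v -> exists c, null (v - lincomb c e).
Proof.
pose P k := `[< exists e : 'I_k -> E, independent e >].
have P0 : exists k, P k.
  exists 0%N; apply/asboolP; exists (fun=> 0); split=> [[]//|c _].
  by apply/rowP => -[].
have Pn k : P k -> (k <= n)%N by move=> /asboolP[e]; exact: independent_le.
have [k /asboolP[e ie] kmax] := ex_maxnP P0 Pn.
exists k, e; split=> // v Vv; apply: contrapT => nv.
have : P k.+1; last by move/kmax; rewrite ltnn.
apply/asboolP.
exists (fun i => if unlift ord0 i is Some j then e j else v); split.
  by move=> i; case: unliftP => [j _|_] //; exact: ie.1.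
move=> c; rewrite /lincomb big_ord_recl unlift_none.
under eq_bigr do rewrite liftK.
set s := \sum_i _ => cs.
have [c0|c0] := eqVneq (c 0 ord0) 0.
  have d0 : (\row_j c 0 (lift ord0 j)) = 0 :> 'rV[R]_k.
    apply: ie.2; rewrite /lincomb; move: cs; rewrite c0 scale0r add0r.
    by congr null; apply: eq_bigr => j _; rewrite mxE.
  apply/rowP => i; rewrite mxE; case: (unliftP ord0 i) => [j ->|->//].
  by have /rowP/(_ j) := d0; rewrite !mxE.
exfalso; apply: nv; exists (\row_j (- (c 0 ord0)^-1 * c 0 (lift ord0 j))).
have := nullZ (c 0 ord0)^-1 cs; rewrite scalerDr scalerA mulVf// scale1r.
congr null; congr (_ + _); rewrite /lincomb scaler_sumr -sumrN.
by apply: eq_bigr => j _; rewrite mxE scalerA mulNr scaleNr opprK.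
Qed.

(** In a basis of [V] the equations form a square system, so uniqueness gives existence. *)
Lemma galerkin_solvable (T : E -> E) (f : E) :
  (forall a u v, T (a *: u + v) = a *: T u + T v) ->
  (forall d, V d -> (forall v, V v -> B (T d) v = 0) -> null d) ->
  exists2 y, V y & forall v, V v -> B (T y) v = B f v.
Proof.
move=> Tlin Tinj; have [k [e [ie span]]] := ex_basis.
have T0 : T 0 = 0 by have := Tlin (-1) 0 0; rewrite scaler0 addr0 scaleN1r addNr.
have TD u v : T (u + v) = T u + T v by have := Tlin 1 u v; rewrite !scale1r.
have TZ a u : T (a *: u) = a *: T u by have := Tlin a u 0; rewrite T0 !addr0.
have Te c : T (lincomb c e) = \sum_i c 0 i *: T (e i).
  rewrite /lincomb (big_morph T TD T0); exact: eq_bigr.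
have test w : (forall j, B w (e j) = 0) -> forall v, V v -> B w v = 0.
  move=> we v /span[c vc]; rewrite -(subrK (lincomb c e) v) sformDr null_formr// add0r.
  by rewrite sform_sumr big1// => j _; rewrite sformZr we mulr0.
pose A : 'M[R]_k := \matrix_(i, j) B (T (e i)) (e j).
have BTe c j : B (T (lincomb c e)) (e j) = (c *m A) 0 j.
  by rewrite Te sform_suml mxE; apply: eq_bigr => i _; rewrite BZ mxE.
have Au : A \in unitmx.
  rewrite -row_free_unit -kermx_eq0; apply/rowV0P => c /sub_kermxP cA.
  apply: ie.2; apply: Tinj; first exact: V_lincomb ie.1.
  by apply: test => j; rewrite BTe cA mxE.
pose c := (\row_j B f (e j)) *m invmx A.
exists (lincomb c e); first exact: V_lincomb ie.1.
move=> v Vv; apply/eqP; rewrite -subr_eq0 -mulN1r -BZ -BD scaleN1r; apply/eqP.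
apply: test v Vv => j; rewrite BD BTe /c mulmxKV// mxE -scaleN1r BZ.
by rewrite mulN1r subrr.
Qed.

End Galerkin.
End SemiInnerProduct.

(** * The space of square integrable functions *)

Section L2Space.
Variable R : realType.
Implicit Types (u v : R -> R[i]) (a : R).

Lemma creD (z w : R[i]) : cre (z + w) = cre z + cre w.
Proof. by case: z; case: w. Qed.
Lemma cimD (z w : R[i]) : cim (z + w) = cim z + cim w.
Proof. by case: z; case: w. Qed.
Lemma creN (z : R[i]) : cre (- z) = - cre z. Proof. by case: z. Qed.
Lemma cimN (z : R[i]) : cim (- z) = - cim z. Proof. by case: z. Qed.
Lemma creM (z w : R[i]) : cre (z * w) = cre z * cre w - cim z * cim w.
Proof. by case: z; case: w. Qed.
Lemma cimM (z w : R[i]) : cim (z * w) = cre z * cim w + cim z * cre w.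
Proof. by case: z; case: w. Qed.
Lemma creJ (z : R[i]) : cre (z^*) = cre z. Proof. by case: z. Qed.
Lemma cimJ (z : R[i]) : cim (z^*) = - cim z. Proof. by case: z. Qed.
Lemma creR a : cre a%:C = a. Proof. by []. Qed.
Lemma cimR a : cim a%:C = 0. Proof. by []. Qed.
Lemma cre_complex (a b : R) : cre (a +i* b) = a. Proof. by []. Qed.
Lemma cim_complex (a b : R) : cim (a +i* b) = b. Proof. by []. Qed.
Definition cE := (creD, cimD, creN, cimN, creM, cimM, creJ, cimJ, creR, cimR,
  cre_complex, cim_complex).
Lemma complex_eq (z w : R[i]) : cre z = cre w -> cim z = cim w -> z = w.
Proof. by case: z; case: w => ? ? ? ? /= -> ->. Qed.

Lemma L2D u v : L2 u -> L2 v -> L2 (fun x => u x + v x).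
Proof.
move=> /L2P[u1 u2] /L2P[v1 v2]; apply/L2P; split.
  by apply: sqint_eq (sqintD u1 v1) => x _; rewrite cE.
by apply: sqint_eq (sqintD u2 v2) => x _; rewrite cE.
Qed.

Lemma L2M_bounded u v M : measurable_fun `[(-1 : R), 1] (fun x => cre (u x)) ->
  measurable_fun `[(-1 : R), 1] (fun x => cim (u x)) ->
  (forall x, -1 <= x <= 1 -> `|cre (u x)| <= M /\ `|cim (u x)| <= M) ->
  L2 v -> L2 (fun x => u x * v x).
Proof.
move=> m1 m2 uM /L2P[v1 v2]; apply/L2P.
have h1 x : -1 <= x <= 1 -> `|cre (u x)| <= M by case/uM.
have h2 x : -1 <= x <= 1 -> `|cim (u x)| <= M by case/uM.
split.
  apply: sqint_eq (sqintB (sqintM_bounded m1 h1 v1) (sqintM_bounded m2 h2 v2)) => x _.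
  by rewrite cE.
apply: sqint_eq (sqintD (sqintM_bounded m1 h1 v2) (sqintM_bounded m2 h2 v1)) => x _.
by rewrite cE.
Qed.

Lemma L2Z (c : R[i]) v : L2 v -> L2 (fun x => c * v x).
Proof.
apply: (@L2M_bounded (fun=> c) v (`|cre c| + `|cim c|)) => // x _.
by rewrite lerDl lerDr.
Qed.

Lemma L2B u v : L2 u -> L2 v -> L2 (fun x => u x - v x).
Proof.
move=> Lu /(L2Z (-1)) /(L2D Lu) h.
by rewrite (_ : (fun x => _) = (fun x => u x + -1 * v x))//; apply/funext => x; rewrite mulN1r.
Qed.

Lemma L2_cst0 : L2 (fun=> 0 : R[i]).
Proof.
apply/L2P; split; apply: (@sqint_bounded _ _ _ _ 0) => //= x _; by rewrite normr0.
Qed.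

Record L2fun := MkL2fun { l2val :> R -> R[i]; l2valP : L2 l2val }.

Lemma l2fun_inj (u v : L2fun) : (l2val u : R -> R[i]) = l2val v -> u = v.
Proof.
case: u v => u Lu [v Lv] /= uv; subst v; congr MkL2fun; exact: Prop_irrelevance.
Qed.

HB.instance Definition _ := gen_eqMixin L2fun.
HB.instance Definition _ := gen_choiceMixin L2fun.

Definition l2add (u v : L2fun) := MkL2fun (L2D (l2valP u) (l2valP v)).
Definition l2zero := MkL2fun L2_cst0.
Definition l2opp (u : L2fun) := MkL2fun (L2Z (-1) (l2valP u)).
Definition l2scale (a : R) (u : L2fun) := MkL2fun (L2Z a%:C (l2valP u)).

Fact l2addA : associative l2add.
Proof. by move=> u v w; apply: l2fun_inj; apply/funext => x /=; rewrite addrA. Qed.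
Fact l2addC : commutative l2add.
Proof. by move=> u v; apply: l2fun_inj; apply/funext => x /=; rewrite addrC. Qed.
Fact l2add0 : left_id l2zero l2add.
Proof. by move=> u; apply: l2fun_inj; apply/funext => x /=; rewrite add0r. Qed.
Fact l2addN : left_inverse l2zero l2opp l2add.
Proof. by move=> u; apply: l2fun_inj; apply/funext => x /=; rewrite mulN1r addNr. Qed.

HB.instance Definition _ := GRing.isZmodule.Build L2fun l2addA l2addC l2add0 l2addN.

Fact l2scaleA a b (u : L2fun) : l2scale a (l2scale b u) = l2scale (a * b) u.
Proof. by apply: l2fun_inj; apply/funext => x /=; rewrite mulrA rmorphM. Qed.
Fact l2scale1 : left_id 1 l2scale.
Proof. by move=> u; apply: l2fun_inj; apply/funext => x /=; rewrite mul1r. Qed.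
Fact l2scaleDr : right_distributive l2scale +%R.
Proof. by move=> a u v; apply: l2fun_inj; apply/funext => x /=; rewrite mulrDr. Qed.
Fact l2scaleDl (u : L2fun) : {morph l2scale^~ u : a b / a + b}.
Proof. by move=> a b; apply: l2fun_inj; apply/funext => x /=; rewrite rmorphD mulrDl. Qed.

HB.instance Definition _ :=
  GRing.Zmodule_isLmodule.Build R L2fun l2scaleA l2scale1 l2scaleDr l2scaleDl.

(** The real part of [ip]. It is a symmetric bilinear form over the reals, so the abstract section
    applies without sesquilinear forms. *)
Definition l2form (u v : L2fun) : R :=
  Int (-1) 1 (fun x => cre (u x) * cre (v x)) + Int (-1) 1 (fun x => cim (u x) * cim (v x)).

Lemma l2valD (u v : L2fun) x : (u + v) x = u x + v x. Proof. by []. Qed.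
Lemma l2valZ a (u : L2fun) x : (a *: u) x = a%:C * u x. Proof. by []. Qed.
Lemma l2valB (u v : L2fun) x : (u - v) x = u x - v x.
Proof. by rewrite l2valD [(- v) x]/= mulN1r. Qed.
Lemma l2val_sum (I : finType) (F : I -> L2fun) x : (\sum_i F i) x = \sum_i F i x.
Proof. by elim/big_ind2 : _ => // u a v b; rewrite l2valD => -> ->. Qed.

Lemma l2rint (u v : L2fun) : rint (-1) 1 (fun x => cre (u x) * cre (v x)) /\
  rint (-1) 1 (fun x => cim (u x) * cim (v x)).
Proof.
have [u1 u2] := (L2P _).1 (l2valP u); have [v1 v2] := (L2P _).1 (l2valP v).
by split; exact: sqintM.
Qed.

Lemma l2formC (u v : L2fun) : l2form u v = l2form v u.
Proof. by congr (_ + _); apply: eq_Int => x _; rewrite mulrC. Qed.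

Lemma l2formD (u v w : L2fun) : l2form (u + v) w = l2form u w + l2form v w.
Proof.
have [uw1 uw2] := l2rint u w; have [vw1 vw2] := l2rint v w.
rewrite /l2form addrACA -(IntD uw1 vw1) -(IntD uw2 vw2); congr (_ + _); apply: eq_Int => x _;
  by rewrite l2valD cE mulrDl.
Qed.

Lemma l2formZ a (u w : L2fun) : l2form (a *: u) w = a * l2form u w.
Proof.
have [uw1 uw2] := l2rint u w.
rewrite /l2form mulrDr -(IntZ a uw1) -(IntZ a uw2); congr (_ + _); apply: eq_Int => x _;
  by rewrite l2valZ !cE mul0r ?subr0 ?addr0 mulrA.
Qed.

Lemma l2form_ge0 (u : L2fun) : 0 <= l2form u u.
Proof. by rewrite addr_ge0// Int_ge0// => x _; rewrite -expr2 sqr_ge0. Qed.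

Lemma l2form_orthogonal (u v : L2fun) : l2form u v = 0 -> nrm l2form u <= nrm l2form (u - v).
Proof.
by apply: nrm_le_orthogonal; [exact: l2formC|exact: l2formD|exact: l2formZ|exact: l2form_ge0].
Qed.

Lemma L2norm_nrm (u : L2fun) : L2norm u = nrm l2form u.
Proof.
rewrite /nrm /l2form /L2norm; congr Num.sqrt; have [u1 u2] := l2rint u u.
by rewrite -IntD.
Qed.

End L2Space.

(** * Complex integrals *)

Section ComplexIntegrals.
Variable R : realType.
Implicit Types (z w : R[i]) (f g u v : R -> R[i]) (a b c : R).

(* A submultiplicative norm, equivalent to the modulus, for which the triangle
   inequality for integrals is immediate. *)
Definition N1 z : R := `|cre z| + `|cim z|.

Lemma N1_ge0 z : 0 <= N1 z. Proof. by rewrite addr_ge0. Qed.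

Lemma N1D z w : N1 (z + w) <= N1 z + N1 w.
Proof. by rewrite /N1 !cE addrACA lerD ?ler_normD. Qed.

Lemma N1N z : N1 (- z) = N1 z.
Proof. by rewrite /N1 !cE !normrN. Qed.

Lemma N1C z w : N1 (z - w) = N1 (w - z).
Proof. by rewrite -N1N opprB. Qed.

Lemma N1M z w : N1 (z * w) <= N1 z * N1 w.
Proof.
rewrite /N1 !cE; have h1 := ler_normB (cre z * cre w) (cim z * cim w).
have h2 := ler_normD (cre z * cim w) (cim z * cre w).
by rewrite !normrM in h1 h2; lra.
Qed.

Lemma N1_cexpi x : N1 (cexpi x : R[i]) <= 2.
Proof.
by rewrite -[2]/(1 + 1) lerD ?cos_max ?sin_max.
Qed.

Lemma csq_N1 z : csq z <= N1 z ^+ 2.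
Proof.
rewrite /csq -[cre z ^+ 2]real_normK ?num_real// -[cim z ^+ 2]real_normK ?num_real//.
by rewrite /N1 sqrrD lerD2r lerDl mulrn_wge0// mulr_ge0.
Qed.

Lemma N1_csq z : N1 z ^+ 2 <= 2 * csq z.
Proof.
rewrite /csq -[cre z ^+ 2]real_normK ?num_real// -[cim z ^+ 2]real_normK ?num_real//.
by rewrite /N1; have := sqr_ge0 (`|cre z| - `|cim z|); lra.
Qed.

Lemma cre_N1 z : `|cre z| <= N1 z. Proof. by rewrite lerDl. Qed.
Lemma cim_N1 z : `|cim z| <= N1 z. Proof. by rewrite lerDr. Qed.

Definition cmeas a b f : Prop := measurable_fun `[a, b] (fun x => cre (f x)) /\
  measurable_fun `[a, b] (fun x => cim (f x)).
Definition crint a b f : Prop :=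
  rint a b (fun x => cre (f x)) /\ rint a b (fun x => cim (f x)).
Definition CInt a b f : R[i] :=
  Int a b (fun x => cre (f x)) +i* Int a b (fun x => cim (f x)).

Lemma crint_cmeas a b f : crint a b f -> cmeas a b f.
Proof. by move=> [r1 r2]; split; exact: rint_measurable. Qed.

Lemma cmeasM a b f g : cmeas a b f -> cmeas a b g -> cmeas a b (fun x => f x * g x).
Proof.
move=> [f1 f2] [g1 g2]; split.
  apply: eq_measurable_fun (measurable_funB (measurable_funM f1 g1) (measurable_funM f2 g2)).
  by move=> x _; rewrite cE.
apply: eq_measurable_fun (measurable_funD (measurable_funM f1 g2) (measurable_funM f2 g1)).
by move=> x _; rewrite cE.
Qed.

Lemma cmeas_sub a b c d f : a <= c -> d <= b -> cmeas a b f -> cmeas c d f.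
Proof.
move=> ac db [f1 f2].
by split; [apply: measurable_funS f1|apply: measurable_funS f2] => //;
  apply: subset_itv; rewrite bnd_simp.
Qed.

Lemma cmeas_cexpi a b k : cmeas a b (fun t => cexpi (k * t)).
Proof.
have ck : continuous (fun t : R => k * t).
  by move=> t; apply: cvgM; [exact: cvg_cst|exact: cvg_id].
split; apply: measurable_itv_continuous => t; rewrite /cexpi /=.
  by apply: (@continuous_comp _ _ _ (fun t => k * t) (@cos R)); [exact: ck|exact: continuous_cos].
by apply: (@continuous_comp _ _ _ (fun t => k * t) (@sin R)); [exact: ck|exact: continuous_sin].
Qed.

Lemma crint_N1 a b f : crint a b f -> rint a b (fun x => N1 (f x)).
Proof. by move=> [f1 f2]; apply: rintD; exact: rint_abs. Qed.

Lemma crint_le a b f (g : R -> R) : cmeas a b f ->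
  (forall x, a <= x <= b -> N1 (f x) <= g x) -> rint a b g -> crint a b f.
Proof.
move=> [m1 m2] fg rg; split; apply: (rint_le _ _ rg) => // x xab.
  exact: le_trans (cre_N1 _) (fg x xab).
exact: le_trans (cim_N1 _) (fg x xab).
Qed.

Lemma crintM_bounded a b f g M : cmeas a b f ->
  (forall x, a <= x <= b -> N1 (f x) <= M) -> crint a b g ->
  crint a b (fun x => f x * g x).
Proof.
move=> mf fM rg; apply: (@crint_le _ _ _ (fun x => M * N1 (g x))).
- by apply: cmeasM => //; exact: crint_cmeas.
- by move=> x /fM fxM; apply: le_trans (N1M _ _) _; rewrite ler_wpM2r// N1_ge0.
- exact/rintZ/crint_N1.
Qed.

Lemma crint_sub a b c d f : a <= c -> d <= b -> crint a b f -> crint c d f.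
Proof. by move=> ac db [f1 f2]; split; [exact: rint_sub f1|exact: rint_sub f2]. Qed.

Lemma crintD a b f g : crint a b f -> crint a b g -> crint a b (fun x => f x + g x).
Proof.
move=> [f1 f2] [g1 g2]; split.
  by apply: rint_eq (rintD f1 g1) => x _; rewrite cE.
by apply: rint_eq (rintD f2 g2) => x _; rewrite cE.
Qed.

Lemma crintZ a b z f : crint a b f -> crint a b (fun x => z * f x).
Proof.
move=> [f1 f2]; split.
  by apply: rint_eq (rintB (rintZ (cre z) f1) (rintZ (cim z) f2)) => x _; rewrite cE.
by apply: rint_eq (rintD (rintZ (cre z) f2) (rintZ (cim z) f1)) => x _; rewrite cE.
Qed.

Lemma eq_CInt a b f g : (forall x, a <= x <= b -> f x = g x) -> CInt a b f = CInt a b g.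
Proof.
by move=> fg; congr (_ +i* _); apply: eq_Int => x /fg ->.
Qed.

Lemma CIntD a b f g : crint a b f -> crint a b g ->
  CInt a b (fun x => f x + g x) = CInt a b f + CInt a b g.
Proof.
move=> [f1 f2] [g1 g2]; apply: complex_eq; rewrite !cE -IntD//;
  by apply: eq_Int => x _; rewrite cE.
Qed.

Lemma CIntZ a b z f : crint a b f -> CInt a b (fun x => z * f x) = z * CInt a b f.
Proof.
move=> [f1 f2]; apply: complex_eq; rewrite !cE.
  rewrite -(IntZ _ f1) -(IntZ _ f2) -IntB; [|exact: rintZ|exact: rintZ].
  by apply: eq_Int => x _; rewrite cE.
rewrite -(IntZ _ f1) -(IntZ _ f2) -IntD; [|exact: rintZ|exact: rintZ].
by apply: eq_Int => x _; rewrite cE.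
Qed.

Lemma CIntB a b f g : crint a b f -> crint a b g ->
  CInt a b (fun x => f x - g x) = CInt a b f - CInt a b g.
Proof.
move=> rf rg; rewrite -[- CInt a b g]mulN1r -CIntZ// -CIntD//; last exact: crintZ.
by apply: eq_CInt => x _; rewrite mulN1r.
Qed.

Lemma CInt_split a b c f : a <= b -> b <= c -> crint a c f ->
  CInt a c f = CInt a b f + CInt b c f.
Proof. by move=> ab bc [f1 f2]; apply: complex_eq; rewrite !cE; exact: Int_split. Qed.

Lemma N1_CInt a b f : crint a b f -> N1 (CInt a b f) <= Int a b (fun x => N1 (f x)).
Proof.
move=> [f1 f2]; rewrite IntD; [|exact: rint_abs|exact: rint_abs].
by rewrite /N1 !cE lerD// ler_norm_Int.
Qed.

Lemma N1_CInt_le a b f (g : R -> R) : crint a b f -> rint a b g ->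
  (forall x, a <= x <= b -> N1 (f x) <= g x) -> N1 (CInt a b f) <= Int a b g.
Proof.
move=> rf rg fg; apply: le_trans (N1_CInt rf) _; apply: le_Int => //.
exact: crint_N1.
Qed.

Lemma CInt_id a f : CInt a a f = 0.
Proof. by apply: complex_eq; rewrite !cE Int_id. Qed.

(** Each of the two components has an antiderivative bounded by [1 / k], evaluated at two end
    points. *)
Lemma N1_CInt_cexpi a b k : a <= b -> 0 < k ->
  N1 (CInt a b (fun t => cexpi (- k * t))) <= 4 / k.
Proof.
move=> ab k0.
have dk (x : R) : is_derive x 1 (fun t : R => - k * t) (- k).
  by have := is_deriveZ (- k) (is_derive_id x (1 : R)); rewrite /GRing.scale/= mulr1.
have ck : continuous (fun t : R => - k * t).
  by move=> t; apply: cvgM; [exact: cvg_cst|exact: cvg_id].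
have k0' : k != 0 by rewrite gt_eqF.
have ds (x : R) : is_derive x 1 (fun t : R => - k^-1 * sin (- k * t)) (cos (- k * x)).
  have := is_deriveZ (- k^-1) (@is_derive1_comp _ _ _ x _ _ (is_derive_sin (- k * x)) (dk x)).
  rewrite /GRing.scale/=; congr is_derive.
  by rewrite mulrCA mulrNN mulVf// mulr1.
have dc (x : R) : is_derive x 1 (fun t : R => k^-1 * cos (- k * t)) (sin (- k * x)).
  have := is_deriveZ k^-1 (@is_derive1_comp _ _ _ x _ _ (is_derive_cos (- k * x)) (dk x)).
  rewrite /GRing.scale/=; congr is_derive.
  by rewrite mulrNN mulrCA mulVf// mulr1.
have cs : continuous (fun t : R => cos (- k * t)).
  by move=> t; apply: (@continuous_comp _ _ _ (fun t => - k * t) (@cos R));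
    [exact: ck|exact: continuous_cos].
have cc : continuous (fun t : R => sin (- k * t)).
  by move=> t; apply: (@continuous_comp _ _ _ (fun t => - k * t) (@sin R));
    [exact: ck|exact: continuous_sin].
rewrite /N1 /CInt !cE /cexpi /cre /cim /= (Int_FTC ab ds cs) (Int_FTC ab dc cc).
rewrite -!mulrBr !normrM normrN (gtr0_norm (_ : 0 < k^-1)) ?invr_gt0//.
rewrite -mulrDr mulrC ler_wpM2r ?invr_ge0 ?(ltW k0)//.
have := ler_normB (sin (- k * b)) (sin (- k * a)).
have := ler_normB (cos (- k * b)) (cos (- k * a)).
have := sin_max (- k * a); have := sin_max (- k * b).
have := cos_max (- k * a); have := cos_max (- k * b); lra.
Qed.

(* Riemann-Lebesgue with an explicit rate: on each of [n] pieces of length at most [d]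
   the function [F] is replaced by a constant. *)
Lemma N1_CInt_oscillating n a b k d e A F : a <= b -> b - a <= n%:R * d -> 0 < k ->
  cmeas a b F -> (forall x, a <= x <= b -> N1 (F x) <= A) ->
  (forall x y, a <= x <= b -> a <= y <= b -> `|x - y| <= d -> N1 (F x - F y) <= e) ->
  N1 (CInt a b (fun t => cexpi (- k * t) * F t)) <= 2 * e * (b - a) + n%:R * (4 * A / k).
Proof.
move=> + + k0; elim: n a => [|n ih] a ab bnd mF FA Fe.
  have -> : a = b by apply/eqP; rewrite eq_le ab -subr_le0 (le_trans bnd)// mul0r.
  by rewrite CInt_id subrr mulr0 mul0r addr0 /N1 /cre /cim /= !normr0 addr0.
have A0 : 0 <= A by apply: le_trans (N1_ge0 (F a)) (FA a _); rewrite lexx.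
have rF c c' : a <= c -> c' <= b -> crint c c' (fun t => cexpi (- k * t) * F t).
  move=> ac cb; apply: (crintM_bounded (M := 2)); first exact: cmeas_cexpi.
    by move=> x _; exact: N1_cexpi.
  apply: crint_sub ac cb _; apply: (crint_le mF FA); exact: rint_cst.
have piece c : a <= c -> c <= b -> c - a <= d ->
    N1 (CInt a c (fun t => cexpi (- k * t) * F t)) <= 2 * e * (c - a) + 4 * A / k.
  move=> ac cb cd.
  have re : crint a c (fun t => cexpi (- k * t)).
    apply: (@crint_le _ _ _ (fun=> 2)); [exact: cmeas_cexpi| |exact: rint_cst].
    by move=> x _; exact: N1_cexpi.
  have rd : crint a c (fun t => cexpi (- k * t) * F t - F a * cexpi (- k * t)).
    apply: crintD; first exact: rF.
    by have [r1 r2] := crintZ (- F a) re; split;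
      [apply: rint_eq r1|apply: rint_eq r2] => x _; rewrite mulNr.
  have -> : CInt a c (fun t => cexpi (- k * t) * F t) =
      CInt a c (fun t => cexpi (- k * t) * F t - F a * cexpi (- k * t)) +
      F a * CInt a c (fun t => cexpi (- k * t)).
    by rewrite CIntB ?CIntZ ?subrK//; [exact: rF|exact: crintZ].
  apply: le_trans (N1D _ _) _; apply: lerD.
    apply: le_trans (N1_CInt_le rd (rint_cst _ _ (2 * e)) _) _.
      move=> x /andP[ax xc]; rewrite [F a * _]mulrC -mulrBr.
      apply: le_trans (N1M _ _) _; apply: ler_pM; rewrite ?N1_ge0 ?N1_cexpi//.
      apply: Fe; rewrite ?ax ?lexx ?ab ?(le_trans xc)//.
      by rewrite ger0_norm ?subr_ge0// (le_trans _ cd)// lerD2r.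
    by rewrite Int_cst.
  apply: le_trans (N1M _ _) _.
  apply: (@le_trans _ _ (A * (4 / k))); last by rewrite mulrCA mulrA.
  by apply: ler_pM; rewrite ?N1_ge0 ?N1_CInt_cexpi ?FA ?lexx.
have Ak : 0 <= 4 * A / k by rewrite divr_ge0 ?mulr_ge0 ?(ltW k0).
have [bd|db] := leP (b - a) d.
  apply: le_trans (piece b ab (lexx b) bd) _.
  have -> : n.+1%:R * (4 * A / k) = n%:R * (4 * A / k) + 4 * A / k.
    by rewrite -[n.+1%:R]natr1; ring.
  have : 0 <= n%:R * (4 * A / k) by rewrite mulr_ge0.
  lra.
have nd : n%:R * d + d = n.+1%:R * d by rewrite -[n.+1%:R]natr1 mulrDl mul1r.
(* One piece of length [d] does not exhaust the segment but [n.+1] do, which forces [d] to be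
   positive. *)
have d0 : 0 < d.
  rewrite ltNge; apply/negP => d0; have : n.+1%:R * d <= 0 by rewrite mulr_ge0_le0.
  have := lt_le_trans db bnd; rewrite -[n.+1%:R]natr1 mulrDl mul1r.
  have : n%:R * d <= 0 by rewrite mulr_ge0_le0.
  by lra.
have ad : a <= a + d by rewrite lerDl ltW.
have adb : a + d <= b by rewrite -lerBrDl ltW.
rewrite (CInt_split ad adb (rF _ _ (lexx a) (lexx b))).
apply: le_trans (N1D _ _) _.
have -> : 2 * e * (b - a) + n.+1%:R * (4 * A / k) =
  (2 * e * (a + d - a) + 4 * A / k) + (2 * e * (b - (a + d)) + n%:R * (4 * A / k)).
  by rewrite -[n.+1%:R]natr1; ring.
apply: lerD; first by apply: piece => //; lra.
apply: ih => //.
- by rewrite -nd in bnd; lra.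
- exact: cmeas_sub mF.
- by move=> x /andP[x1 x2]; apply: FA; rewrite x2 andbT (le_trans ad).
- move=> x y /andP[x1 x2] /andP[y1 y2]; apply: Fe; rewrite ?x2 ?y2 andbT.
    exact: le_trans x1.
  exact: le_trans y1.
Qed.

End ComplexIntegrals.

(** * The oscillatory integral operator *)

Section Kernel.
Variable R : realType.

(** Heine's theorem on the square. Compactness is used in its near-covering form: around each point
    [p], one [d] serves all nearby points against every [q] of the square, by comparison with
    [k p]. *)
Lemma within_square_uniform (k : R * R -> R) :
  {within [set p | Iset p.1 /\ Iset p.2], continuous k} ->
  (exists M, forall s t, Iset s -> Iset t -> `|k (s, t)| <= M) /\
  forall e, 0 < e -> exists2 d, 0 < d & forall s s' t t',
    Iset s -> Iset s' -> Iset t -> Iset t' -> `|s - s'| <= d -> `|t - t'| <= d ->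
    `|k (s, t) - k (s', t')| <= e.
Proof.
set A := [set p | _] => ck.
have cA : compact A.
  by have := compact_setX (@segment_compact R (-1) 1) (@segment_compact R (-1) 1).
split.
  have [M [_ kM]] := compact_bounded (continuous_compact ck cA).
  exists (M + 1) => s t Is It; apply: (kM (M + 1)); first by rewrite ltrDl.
  by exists (s, t).
move=> e e0; move/compact_near_coveringP : cA => /(_ R (0 : R)^'+
  (fun d p => A p -> forall q, A q -> `|p.1 - q.1| <= d -> `|p.2 - q.2| <= d ->
     `|k p - k q| <= e) _) [].
  move=> p Ap; have e20 : 0 < e / 2 by rewrite divr_gt0.
  have := (subspace_continuousP A k).1 ck p Ap => /cvgrPdist_le/(_ _ e20).
  rewrite near_withinE => /nbhs_ballP[r /= r0 rB].
  have r20 : 0 < r / 2 by rewrite divr_gt0.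
  have np : \forall q \near p, ball p (r / 2) q by exact: nbhsx_ballx.
  have nd : \forall d \near (0 : R)^'+, d < r / 2 by exact: nbhs_right_lt.
  exists (ball p (r / 2), [set d | d < r / 2]) => //.
  move=> [x d] /= [[b1 b2] dr] Ax q Aq d1 d2.
  have near_p z : A z -> `|p.1 - z.1| < r -> `|p.2 - z.2| < r -> `|k p - k z| <= e / 2.
    by move=> Az z1 z2; apply: rB => //; split.
  rewrite /ball /= in b1 b2.
  have kx : `|k p - k x| <= e / 2 by apply: near_p => //; lra.
  have kq : `|k p - k q| <= e / 2.
    apply: near_p => //.
      apply: (@le_lt_trans _ _ (`|p.1 - x.1| + `|x.1 - q.1|)); last lra.
      exact: ler_distD.
    apply: (@le_lt_trans _ _ (`|p.2 - x.2| + `|x.2 - q.2|)); last lra.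
    exact: ler_distD.
  apply: le_trans (ler_distD (k p) _ _) _; rewrite distrC; lra.
move=> d /= d0 dP; exists (d / 2); first by rewrite divr_gt0.
move=> s s' t t' Is Is' It It' ss tt.
apply: (dP (d / 2) _ _ (s, t)) => //=; last by rewrite divr_gt0.
by rewrite /ball_/= sub0r normrN gtr0_norm ?divr_gt0// ltr_pdivrMr// ltr_pMr// ltr1n.
Qed.

Lemma measurable_uniform a b (g : R -> R) :
  (forall e, 0 < e -> exists2 d, 0 < d & forall x y, a <= x <= b -> a <= y <= b ->
    `|x - y| <= d -> `|g x - g y| <= e) -> measurable_fun `[a, b] g.
Proof.
move=> gu; apply: subspace_continuous_measurable_fun => //.
apply/subspace_continuousP => x; rewrite /= in_itv/= => xab.
apply/cvgrPdist_le => e /gu[d d0 dP]; rewrite near_withinE.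
apply/nbhs_ballP; exists d => //= y /ltW xy; rewrite in_itv/= => yab.
exact: dP.
Qed.

(** Size and modulus of continuity of the kernel, both free of [kappa]: the data behind the
    constants of the stability and mesh estimates. *)
Definition kernel_bound (M : R) (K : R -> R -> R[i]) : Prop :=
  [/\ 0 < M, (forall s t, -1 <= s <= 1 -> -1 <= t <= 1 -> N1 (K s t) <= M) &
      forall e, 0 < e -> exists2 d, 0 < d & forall s s' t t',
        -1 <= s <= 1 -> -1 <= s' <= 1 -> -1 <= t <= 1 -> -1 <= t' <= 1 ->
        `|s - s'| <= d -> `|t - t'| <= d -> N1 (K s t - K s' t') <= e].

Lemma Cm_sq_kernel_bound m K : Cm_sq m K -> exists M, kernel_bound M K.
Proof.
move=> [D [D0 _ _ Dc]]; have [c1 c2] := Dc 0%N 0%N isT isT.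
have [[M1 B1] U1] := within_square_uniform c1; have [[M2 B2] U2] := within_square_uniform c2.
have I s : -1 <= s <= 1 -> Iset s by rewrite /Iset /= in_itv.
exists (`|M1| + `|M2| + 1); split; first by rewrite ltr_wpDl// addr_ge0.
  move=> s t /I Is /I It; rewrite -D0// /N1.
  have := B1 s t Is It; have := B2 s t Is It => /=.
  by have := ler_norm M1; have := ler_norm M2; lra.
move=> e e0; have e20 : 0 < e / 2 by rewrite divr_gt0.
have [d1 d10 h1] := U1 _ e20; have [d2 d20 h2] := U2 _ e20.
exists (Num.min d1 d2); first by rewrite lt_min d10.
move=> s s' t t' /I Is /I Is' /I It /I It'; rewrite !le_min => /andP[s1 s2] /andP[t1 t2].
rewrite -!D0// /N1 !cE.
by have := h1 s s' t t' Is Is' It It' s1 t1; have := h2 s s' t t' Is Is' It It' s2 t2 => /=; lra.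
Qed.

Lemma kernel_cmeas M K s : kernel_bound M K -> -1 <= s <= 1 -> cmeas (-1) 1 (K s).
Proof.
move=> [_ _ KU] s1; split; apply: measurable_uniform => e /KU[d d0 dP]; exists d => // x y x1 y1 xy.
  rewrite -creN -creD; apply: le_trans (cre_N1 _) _; apply: dP => //.
  by rewrite subrr normr0 ltW.
rewrite -cimN -cimD; apply: le_trans (cim_N1 _) _; apply: dP => //.
by rewrite subrr normr0 ltW.
Qed.

End Kernel.

(** * Gronwall's lemma for both directions of integration *)

Section Volterra.
Variable R : realType.
Implicit Types (u v : L2fun R) (b : bool) (s t k : R).

(** The boolean treats both Volterra operators at once: [true] is V+ and [false] is V-. *)
Definition lo b s : R := if b then -1 else s.
Definition hi b s : R := if b then s else 1.

Lemma lo_hi b s : -1 <= s <= 1 -> [/\ -1 <= lo b s, lo b s <= hi b s & hi b s <= 1].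
Proof. by case: b => /= /andP[s1 s2]; split; rewrite ?lexx. Qed.

Lemma cexpiD (x y : R) : cexpi (x + y) = cexpi x * cexpi y.
Proof.
by apply: complex_eq; rewrite /cexpi !cE ?cosD ?sinD; ring.
Qed.

(** Bielecki's exponential weight. The sign makes it grow in the direction of integration, so that
    integrating it gains a factor [1 / l]. *)
Definition gweight b l t := expR (l * (1 + (-1) ^+ (~~ b) * t)).

Lemma is_derive_gweight b l (x : R) :
  is_derive x 1 (gweight b l) (gweight b l x * (l * (-1) ^+ (~~ b))).
Proof.
have d1 : is_derive x 1 (fun t : R => l * (1 + (-1) ^+ (~~ b) * t)) (l * (-1) ^+ (~~ b)).
  have d2 := is_deriveZ ((-1) ^+ (~~ b)) (is_derive_id x (1 : R)).
  have d3 := is_deriveZ l (is_deriveD (is_derive_cst (1 : R) x 1) d2).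
  by move: d3; rewrite /GRing.scale/= add0r mulr1.
exact: (@is_derive1_comp _ expR _ x _ _ (is_derive_expR _) d1).
Qed.

Lemma continuous_gweight b l : continuous (gweight b l).
Proof. by move=> x; exact: is_derive_continuous (is_derive_gweight b l x). Qed.

Lemma Int_gweight b l s : 0 < l -> -1 <= s <= 1 ->
  Int (lo b s) (hi b s) (gweight b l) <= gweight b l s / l.
Proof.
move=> l0 s1; have [h1 h2 h3] := lo_hi b s1.
pose F t := gweight b l t * ((-1) ^+ (~~ b) / l).
have dg x := is_derive_gweight b l x.
have dF (x : R) : is_derive x 1 F (gweight b l x).
  have := is_deriveZ ((-1) ^+ (~~ b) / l) (dg x).
  rewrite /GRing.scale/= (_ : _ / l * _ = gweight b l x); last first.
    by have l1 : l != 0 by [rewrite gt_eqF]; case: b {F dg h1 h2 h3} => /=; rewrite ?expr0 ?expr1; field.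
  by congr is_derive; apply/funext => y; rewrite /F -[LHS]/(_ * _) mulrC.
have cg := @continuous_gweight b l.
rewrite (Int_FTC h2 dF cg) /F /gweight.
have e0 (y : R) : 0 <= expR y / l by rewrite divr_ge0 ?expR_ge0 ?ltW.
case: b {F dg dF cg h1 h2 h3} => /=; rewrite ?expr0 ?expr1 ?mul1r ?mulN1r ?mulrN.
  by rewrite gerDl oppr_le0 e0.
by rewrite opprK addrC gerDl oppr_le0 e0.
Qed.

Lemma gweight_itv b l s : 0 < l -> -1 <= s <= 1 -> 1 <= gweight b l s <= expR (2 * l).
Proof.
move=> l0 /andP[s1 s2]; rewrite /gweight.
have h : 0 <= 1 + (-1) ^+ (~~ b) * s <= 2.
  by case: b => /=; rewrite ?expr0 ?expr1 ?mul1r ?mulN1r; lra.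
move/andP : h => [h0 h2]; apply/andP; split; first by rewrite -[leLHS]expR0 ler_expR mulr_ge0// ltW.
by rewrite ler_expR [leRHS]mulrC ler_wpM2l// ltW.
Qed.

(** With weight parameter [2 * L] the integral inequality improves a bound [B] to [L * W + B / 2].
    Iterating from any initial bound [Z0] leaves the fixed point [2 * L * W], and [expR (4 * L)] is
    the largest value of the weight. The result does not depend on [Z0], which is essential. *)
Lemma gronwall b (z w : R -> R) L W Z0 : 0 < L -> rint (-1) 1 z -> rint (-1) 1 w ->
  (forall s, -1 <= s <= 1 -> 0 <= w s) -> Int (-1) 1 w <= W ->
  (forall s, -1 <= s <= 1 -> z s <= Z0) ->
  (forall s, -1 <= s <= 1 -> z s <= L * Int (lo b s) (hi b s) (fun t => w t + z t)) ->
  forall s, -1 <= s <= 1 -> z s <= 2 * L * W * expR (4 * L).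
Proof.
move=> L0 rz rw w0 wW zZ zint; have l0 : 0 < 2 * L by rewrite mulr_gt0.
pose P B := forall s, -1 <= s <= 1 -> z s <= B * gweight b (2 * L) s.
have W0 : 0 <= W by apply: le_trans wW; exact: Int_ge0.
have PZ : P (Num.max Z0 0).
  move=> s s1; apply: (le_trans (zZ s s1)).
  have /andP[g1 _] := gweight_itv b l0 s1.
  apply: (@le_trans _ _ (Num.max Z0 0)); first by rewrite le_max lexx.
  by rewrite ler_peMr// le_max lexx orbT.
have Pstep B : 0 <= B -> P B -> P (L * W + B / 2).
  move=> B0 PB s s1; have [h1 h2 h3] := lo_hi b s1.
  have /andP[g1 _] := gweight_itv b l0 s1.
  apply: (le_trans (zint s s1)); rewrite IntD; [|exact: rint_sub rw|exact: rint_sub rz].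
  have rg c d : rint c d (gweight b (2 * L)) by apply/rint_continuous/continuous_gweight.
  have i1 : Int (lo b s) (hi b s) w <= W by apply: le_trans wW; exact: Int_mono.
  have i2 : Int (lo b s) (hi b s) z <= B * (gweight b (2 * L) s / (2 * L)).
    apply: (@le_trans _ _ (Int (lo b s) (hi b s) (fun t => B * gweight b (2 * L) t))).
      apply: le_Int; [exact: rint_sub rz|exact: rintZ|].
      by move=> t /andP[t1 t2]; apply: PB; rewrite (le_trans h1)// (le_trans t2).
    by rewrite IntZ// ler_wpM2l// Int_gweight.
  have -> : (L * W + B / 2) * gweight b (2 * L) s =
      L * W * gweight b (2 * L) s + L * (B * (gweight b (2 * L) s / (2 * L))).
    by field; rewrite gt_eqF.
  rewrite mulrDr lerD//; last by rewrite ler_wpM2l// ltW.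
  apply: (@le_trans _ _ (L * W)); first by rewrite ler_wpM2l// ltW.
  by rewrite ler_peMr// mulr_ge0// ltW.
have Piter n : P (2 * (L * W) + Num.max Z0 0 / 2 ^+ n).
  elim: n => [|n ih].
    move=> s s1; apply: (le_trans (PZ s s1)); rewrite expr0 divr1 ler_wpM2r ?expR_ge0//.
    by rewrite lerDr mulr_ge0// mulr_ge0// ltW.
  have -> : 2 * (L * W) + Num.max Z0 0 / 2 ^+ n.+1 =
      L * W + (2 * (L * W) + Num.max Z0 0 / 2 ^+ n) / 2.
    by rewrite exprS; field; rewrite expf_neq0.
  apply: Pstep => //; rewrite addr_ge0 ?mulr_ge0 ?(ltW L0)// ?invr_ge0 ?exprn_ge0//.
  by rewrite le_max lexx orbT.
move=> s s1; have /andP[g1 g2] := gweight_itv b l0 s1.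
apply: (@le_trans _ _ (2 * L * W * gweight b (2 * L) s)); last first.
  rewrite ler_wpM2l ?mulr_ge0 ?(ltW L0)//.
  by apply: le_trans g2 _; rewrite mulrA -natrM.
apply/ler_addgt0Pl => e e0.
have [n nP] : exists n, Num.max Z0 0 * gweight b (2 * L) s / 2 ^+ n <= e.
  set c := _ * gweight _ _ _; have c0 : 0 <= c.
    by rewrite mulr_ge0 ?expR_ge0// le_max lexx orbT.
  exists (Num.truncn (c / e)).+1; rewrite ler_pdivrMr ?exprn_gt0// mulrC -ler_pdivrMr//.
  apply: ltW; apply: lt_trans (truncnS_gt _) _.
  by rewrite -natrX ltr_nat ltn_expl.
apply: le_trans (Piter n s s1) _.
by rewrite mulrDl addrC lerD// ?mulrA// mulrAC.
Qed.

End Volterra.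

(** * Volterra operators: bounds, equicontinuity and stability *)

Section VolterraOperators.
Variables (R : realType) (K : R -> R -> R[i]) (M : R).
Hypothesis KM : kernel_bound M K.
Implicit Types (u v : L2fun R) (b : bool) (s t k : R).

Definition N2 (u : L2fun R) : R := L2norm u.

Lemma L2norm_ge0 (u : R -> R[i]) : 0 <= L2norm u. Proof. exact: sqrtr_ge0. Qed.

Lemma N2_ge0 u : 0 <= N2 u. Proof. exact: L2norm_ge0. Qed.

Lemma N2_nrm u : N2 u = nrm (@l2form R) u. Proof. exact: L2norm_nrm. Qed.

Lemma L2_crint u : crint (-1) 1 u.
Proof. by have [u1 u2] := (L2P u).1 (l2valP u); split; exact: sqint_rint. Qed.

Lemma L2_N1_sqint u : sqint (-1) 1 (fun x => N1 (u x)).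
Proof.
by have [u1 u2] := (L2P u).1 (l2valP u); apply: sqintD; exact: sqint_abs.
Qed.

Lemma Int_N1_sqr u a c : -1 <= a -> a <= c -> c <= 1 ->
  Int a c (fun x => N1 (u x)) ^+ 2 <= 2 * (c - a) * N2 u ^+ 2.
Proof.
move=> a1 ac c1; have su := L2_N1_sqint u.
have -> : Int a c (fun x => N1 (u x)) = Int a c (fun x => `|N1 (u x)|).
  by apply: eq_Int => x _; rewrite ger0_norm// N1_ge0.
have sac : sqint a c (fun x => N1 (u x)) by exact: sqint_sub su.
apply: le_trans (Int_abs_sqr ac sac) _.
rewrite [2 * _]mulrC -mulrA ler_wpM2l ?subr_ge0// /N2 L2norm_sqr; last exact: l2valP.
have [u1 u2] := (L2P u).1 (l2valP u).
apply: (@le_trans _ _ (Int (-1) 1 (fun x => N1 (u x) ^+ 2))).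
  by apply: Int_mono => //; [case: su|move=> x _; exact: sqr_ge0].
rewrite -(IntD u1.2 u2.2) -IntZ; last by apply: rintD; [case: u1|case: u2].
apply: le_Int; [by case: su|by apply: rintZ; apply: rintD; [case: u1|case: u2]|].
by move=> x _; exact: N1_csq.
Qed.

Lemma Int_N1_le u a c : -1 <= a -> a <= c -> c <= 1 ->
  Int a c (fun x => N1 (u x)) <= 2 * N2 u.
Proof.
move=> a1 ac c1; rewrite -(@ler_pXn2r _ 2)// ?nnegrE ?mulr_ge0 ?N2_ge0//; last first.
  by apply: Int_ge0 => x _; exact: N1_ge0.
apply: le_trans (Int_N1_sqr u a1 ac c1) _; rewrite exprMn ler_wpM2r ?sqr_ge0//; lra.
Qed.

Lemma L2_bounded (f : R -> R[i]) A : cmeas (-1) 1 f ->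
  (forall x, -1 <= x <= 1 -> N1 (f x) <= A) -> L2 f /\ L2norm f <= 2 * A.
Proof.
move=> [m1 m2] fA.
have Lf : L2 f.
  apply/L2P; split; [apply: (sqint_bounded m1 (M := A))|apply: (sqint_bounded m2 (M := A))].
    by move=> x /fA; apply: le_trans; exact: cre_N1.
  by move=> x /fA; apply: le_trans; exact: cim_N1.
split=> //; have A0 : 0 <= A.
  by apply: le_trans (fA 0 _); [exact: N1_ge0|lra].
rewrite -(@ler_pXn2r _ 2)// ?nnegrE ?mulr_ge0 ?L2norm_ge0// L2norm_sqr//.
have [f1 f2] := (L2P f).1 Lf.
rewrite -(IntD f1.2 f2.2); apply: (@le_trans _ _ (Int (-1) 1 (fun=> A ^+ 2))).
  apply: le_Int; [by apply: rintD; [case: f1|case: f2]|exact: rint_cst|].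
  move=> x x1; apply: le_trans (csq_N1 _) _.
  by rewrite lerXn2r ?nnegrE ?N1_ge0// fA.
rewrite Int_cst; last lra.
by rewrite exprMn; have := sqr_ge0 A; lra.
Qed.

(** The Volterra integral without its outer factor [cexpi (k * s)], hence slowly varying in [s]. The
    operator V- is obtained from [b = false] with [- k] in place of [k]. *)
Definition vint b k s (u : R -> R[i]) : R[i] :=
  CInt (lo b s) (hi b s) (fun t => K s t * cexpi (- k * t) * u t).

Lemma vker_cmeas k s : -1 <= s <= 1 -> cmeas (-1) 1 (fun t => K s t * cexpi (- k * t)).
Proof.
by move=> s1; apply: cmeasM; [exact: kernel_cmeas KM s1|exact: cmeas_cexpi].
Qed.

Lemma vker_N1 k s t : -1 <= s <= 1 -> -1 <= t <= 1 ->
  N1 (K s t * cexpi (- k * t)) <= 2 * M.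
Proof.
move=> s1 t1; have [M0 KM' _] := KM.
rewrite mulrC; apply: le_trans (N1M _ _) _.
by rewrite ler_pM ?N1_ge0 ?N1_cexpi ?KM'.
Qed.

Lemma vint_crint k s a c u : -1 <= s <= 1 -> -1 <= a -> c <= 1 ->
  crint a c (fun t => K s t * cexpi (- k * t) * u t).
Proof.
move=> s1 a1 c1; apply: (crint_sub a1 c1).
apply: (crintM_bounded (M := 2 * M)); [exact: vker_cmeas|by move=> t; exact: vker_N1|].
exact: L2_crint.
Qed.

Lemma vint_piece k s a c u : -1 <= s <= 1 -> -1 <= a -> a <= c -> c <= 1 ->
  N1 (CInt a c (fun t => K s t * cexpi (- k * t) * u t))
    <= 2 * M * Int a c (fun t => N1 (u t)).
Proof.
move=> s1 a1 ac c1; have ru : rint a c (fun t => N1 (u t)).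
  exact: rint_sub (crint_N1 (L2_crint u)).
rewrite -IntZ//; apply: N1_CInt_le; [exact: vint_crint|exact: rintZ|].
move=> t /andP[t1 t2]; apply: le_trans (N1M _ _) _.
by rewrite ler_wpM2r ?N1_ge0// vker_N1// (le_trans a1)//= (le_trans t2).
Qed.

Lemma vint_bound b k s u : -1 <= s <= 1 -> N1 (vint b k s u) <= 4 * M * N2 u.
Proof.
move=> s1; have [h1 h2 h3] := lo_hi b s1; have [M0 _ _] := KM.
apply: le_trans (vint_piece k u s1 h1 h2 h3) _.
have -> : 4 * M * N2 u = 2 * M * (2 * N2 u) by ring.
by rewrite ler_wpM2l ?mulr_ge0 ?(ltW M0)// Int_N1_le.
Qed.

Lemma vint_diff_piece k s s' a c u e : -1 <= s <= 1 -> -1 <= s' <= 1 ->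
  -1 <= a -> a <= c -> c <= 1 ->
  (forall t, -1 <= t <= 1 -> N1 (K s t - K s' t) <= e) ->
  N1 (CInt a c (fun t => K s t * cexpi (- k * t) * u t) -
      CInt a c (fun t => K s' t * cexpi (- k * t) * u t)) <= 4 * e * N2 u.
Proof.
move=> s1 s1' a1 ac c1 Ke.
have e0 : 0 <= e by apply: le_trans (Ke 0 _); [exact: N1_ge0|lra].
have r1 := vint_crint k u s1 a1 c1; have r2 := vint_crint k u s1' a1 c1.
rewrite -CIntB//.
have ru : rint a c (fun t => N1 (u t)) by exact: rint_sub (crint_N1 (L2_crint u)).
apply: (@le_trans _ _ (Int a c (fun t => 2 * e * N1 (u t)))); last first.
  rewrite IntZ//; have -> : 4 * e * N2 u = 2 * e * (2 * N2 u) by ring.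
  by rewrite ler_wpM2l ?mulr_ge0// Int_N1_le.
apply: N1_CInt_le; [|exact: rintZ|].
  have := crintD r1 (crintZ (-1) r2) => -[q1 q2].
  by split; [apply: rint_eq q1|apply: rint_eq q2] => x _; rewrite mulN1r.
move=> t /andP[t1 t2]; rewrite -mulrBl -mulrBl.
apply: le_trans (N1M _ _) _; rewrite ler_wpM2r ?N1_ge0// mulrC.
apply: le_trans (N1M _ _) _; rewrite ler_pM ?N1_ge0 ?N1_cexpi// Ke//.
by rewrite (le_trans a1)//= (le_trans t2).
Qed.

(** On the common part of the two intervals only [K] changes, and the remaining piece is short. The
    oscillating factor enters through its size alone, so one [d] serves all [k] and [u]. *)
Lemma vint_equicontinuous e : 0 < e -> exists2 d, 0 < d & forall b k u s s',
  -1 <= s <= 1 -> -1 <= s' <= 1 -> `|s - s'| <= d ->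
  N1 (vint b k s u - vint b k s' u) <= e * N2 u.
Proof.
move=> e0; have [M0 _ KU] := KM.
have e80 : 0 < e / 8 by rewrite divr_gt0.
have [d1 d10 d1P] := KU _ e80.
pose eta := e / (4 * M); have eta0 : 0 < eta by rewrite divr_gt0// mulr_gt0.
(* The change of [K] costs [4 * (e / 8) * N2 u]; the short piece costs [2 * M * eta * N2 u] by
   Cauchy-Schwarz. Both equal half of the allowance. *)
exists (Num.min d1 (eta ^+ 2 / 2)); first by rewrite lt_min d10 divr_gt0// exprn_gt0.
suff H b k u s s' : -1 <= s' -> s' <= s -> s <= 1 -> s - s' <= d1 ->
    s - s' <= eta ^+ 2 / 2 -> N1 (vint b k s u - vint b k s' u) <= e * N2 u.
  move=> b k u s s' /andP[s1 s2] /andP[s1' s2']; rewrite le_min => /andP[sd se].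
  have [ss|ss] := leP s' s.
    by rewrite ger0_norm ?subr_ge0// in sd se; exact: H.
  rewrite ltr0_norm ?subr_lt0// opprB in sd se; rewrite N1C.
  by apply: H => //; exact: ltW.
move=> s1 ss s2 sd se.
have sI : -1 <= s <= 1 by rewrite s2 andbT (le_trans s1).
have sI' : -1 <= s' <= 1 by rewrite s1 (le_trans ss).
have Kd t : -1 <= t <= 1 -> N1 (K s t - K s' t) <= e / 8.
  by move=> t1; apply: d1P => //; rewrite ?subrr ?normr0 ?(ltW d10)// ger0_norm ?subr_ge0.
have mid : 2 * M * Int s' s (fun t => N1 (u t)) <= e / 2 * N2 u.
  have -> : e / 2 * N2 u = 2 * M * (eta * N2 u) by rewrite /eta; field; rewrite gt_eqF.
  rewrite ler_wpM2l ?mulr_ge0 ?(ltW M0)//.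
  have i0 : 0 <= Int s' s (fun t => N1 (u t)) by apply: Int_ge0 => x _; exact: N1_ge0.
  have eu0 : 0 <= eta * N2 u by rewrite mulr_ge0 ?N2_ge0 ?ltW.
  rewrite -(@ler_pXn2r _ 2)//.
  apply: le_trans (Int_N1_sqr u s1 ss s2) _.
  by rewrite exprMn ler_wpM2r ?sqr_ge0//; lra.
have eE : e * N2 u = 4 * (e / 8) * N2 u + e / 2 * N2 u by field.
case: b; rewrite /vint /lo /hi.
  rewrite (CInt_split s1 ss (vint_crint k u sI (lexx _) s2)) addrAC eE.
  apply: le_trans (N1D _ _) _; apply: lerD.
    by apply: vint_diff_piece => //; case/andP: sI'.
  by apply: le_trans mid; exact: vint_piece.
rewrite (CInt_split ss s2 (vint_crint k u sI' s1 (lexx _))) opprD addrCA eE.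
rewrite [X in N1 X]addrC; apply: le_trans (N1D _ _) _; apply: lerD.
  by apply: vint_diff_piece => //; case/andP: sI.
by rewrite N1N; apply: le_trans mid; exact: vint_piece.
Qed.

Lemma vint_cmeas b k u : cmeas (-1) 1 (fun s => vint b k s u).
Proof.
have key e : 0 < e -> exists2 d, 0 < d & forall s s', -1 <= s <= 1 -> -1 <= s' <= 1 ->
    `|s - s'| <= d -> N1 (vint b k s u - vint b k s' u) <= e.
  move=> e0; have eu0 : 0 < e / (N2 u + 1) by rewrite divr_gt0// ltr_wpDl// N2_ge0.
  have [d d0 dP] := vint_equicontinuous eu0; exists d => // s s' s1 s1' ss.
  apply: le_trans (dP _ _ _ _ _ s1 s1' ss) _.
  rewrite mulrAC ler_pdivrMr ?ltr_wpDl ?N2_ge0// ler_wpM2l ?(ltW e0)//.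
  by rewrite lerDl.
split; apply: measurable_uniform => e /key[d d0 dP]; exists d => // s s' s1 s1' ss.
  by rewrite -creN -creD; apply: le_trans (cre_N1 _) _; exact: dP.
by rewrite -cimN -cimD; apply: le_trans (cim_N1 _) _; exact: dP.
Qed.

(** Cut to 0 outside the segment, where [K] is not controlled and the integrals need not be
    additive: [vop] has to be linear at every point. *)
Definition vfun b k u s : R[i] :=
  if (-1 <= s) && (s <= 1) then cexpi (k * s) * vint b k s u else 0.

Lemma vfun_in b k u s : -1 <= s <= 1 -> vfun b k u s = cexpi (k * s) * vint b k s u.
Proof. by rewrite /vfun => ->. Qed.

Lemma vfun_bound b k u s : -1 <= s <= 1 -> N1 (vfun b k u s) <= 8 * M * N2 u.
Proof.
move=> s1; rewrite vfun_in//; apply: le_trans (N1M _ _) _.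
have -> : 8 * M * N2 u = 2 * (4 * M * N2 u) by ring.
by rewrite ler_pM ?N1_ge0 ?N1_cexpi ?vint_bound.
Qed.

Lemma eq_cmeas a c (f g : R -> R[i]) : (forall x, a <= x <= c -> f x = g x) ->
  cmeas a c f -> cmeas a c g.
Proof.
move=> fg [f1 f2]; split; [apply: eq_measurable_fun f1|apply: eq_measurable_fun f2] => x;
  by rewrite inE/= in_itv/= => /fg ->.
Qed.

Lemma vfun_cmeas b k u : cmeas (-1) 1 (vfun b k u).
Proof.
apply: eq_cmeas (cmeasM (@cmeas_cexpi _ (-1) 1 k) (vint_cmeas b k u)) => s s1.
by rewrite vfun_in.
Qed.

Lemma vfun_L2 b k u : L2 (vfun b k u).
Proof.
by apply: (L2_bounded (A := 8 * M * N2 u) (vfun_cmeas b k u) _).1 => s; exact: vfun_bound.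
Qed.

Definition vop b k u : L2fun R := MkL2fun (vfun_L2 b k u).

Lemma vop_lin b k a u v : vop b k (a *: u + v) = a *: vop b k u + vop b k v.
Proof.
apply: l2fun_inj; apply/funext => s; rewrite l2valD l2valZ /= /vfun.
case: ifP => [s1|_]; last by rewrite mulr0 addr0.
have [h1 h2 h3] := lo_hi b s1.
rewrite /vint [_%:C * _]mulrCA -mulrDr; congr (_ * _).
rewrite -CIntZ; last exact: vint_crint.
rewrite -CIntD; [|by apply: crintZ; exact: vint_crint|exact: vint_crint].
by apply: eq_CInt => t _; rewrite l2valD l2valZ mulrDr mulrCA.
Qed.

Lemma N2D u v : N2 (u + v) <= N2 u + N2 v.
Proof.
rewrite !N2_nrm; apply: nrmD;
  [exact: l2formC|exact: l2formD|exact: l2formZ|exact: l2form_ge0].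
Qed.

Lemma N2N u : N2 (- u) = N2 u.
Proof. by rewrite !N2_nrm; apply: nrmN; [exact: l2formC|exact: l2formZ]. Qed.

Lemma N2B u v : N2 (u - v) <= N2 u + N2 v.
Proof. by rewrite -(N2N v) N2D. Qed.

(** Gronwall is applied to the size of [vop b k u] and not of [u], which is only square integrable:
    [vop b k u] is bounded, so an initial bound exists. *)
Lemma volterra_stable b : exists2 C, 0 < C & forall k u, N2 u <= C * N2 (u - vop b k u).
Proof.
have [M0 _ _] := KM; have M40 : 0 < 4 * M by rewrite mulr_gt0.
(* Gronwall with [L = 4 * M] and [W = 2 * N2 w]; the outer 2 comes from [L2_bounded]. *)
pose C := 2 * (2 * (4 * M) * 2 * expR (4 * (4 * M))).
have C0 : 0 < C by rewrite !mulr_gt0 ?expR_gt0.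
exists (1 + C) => [|k u]; first by rewrite addr_gt0.
set w := u - vop b k u.
have zI s : -1 <= s <= 1 -> N1 (vop b k u s) <= 4 * M *
    Int (lo b s) (hi b s) (fun t => N1 (w t) + N1 (vop b k u t)).
  move=> s1; have [h1 h2 h3] := lo_hi b s1.
  rewrite /= vfun_in//; apply: le_trans (N1M _ _) _.
  apply: (@le_trans _ _ (2 * (2 * M * Int (lo b s) (hi b s) (fun t => N1 (u t))))).
    by rewrite ler_pM ?N1_ge0 ?N1_cexpi// vint_piece.
  rewrite mulrA mulrA -natrM ler_wpM2l ?(ltW M40)//.
  have rN (v : L2fun R) : rint (lo b s) (hi b s) (fun t => N1 (v t)).
    exact: rint_sub (crint_N1 (L2_crint v)).
  apply: le_Int; [exact: (rN u)|exact: rintD (rN w) (rN (vop b k u))|].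
  move=> t _; apply: le_trans _ (N1D _ _).
  by rewrite mulN1r subrK.
have z1 := gronwall M40 (crint_N1 (L2_crint (vop b k u))) (crint_N1 (L2_crint w))
  (fun s _ => N1_ge0 _) (Int_N1_le w (lexx _) _ (lexx _)) (@vfun_bound b k u) zI.
have N11 : -1 <= 1 :> R by lra.
have [_ zn] := L2_bounded (vfun_cmeas b k u) (z1 N11).
have -> : u = w + vop b k u by rewrite subrK.
apply: le_trans (N2D _ _) _; rewrite mulrDl mul1r lerD2l.
apply: le_trans zn _; rewrite le_eqVlt; apply/orP; left; apply/eqP.
by rewrite /C; ring.
Qed.

End VolterraOperators.

(** * Smallness of the composition and uniform stability *)

Section OscillatoryOperator.
Variables (R : realType) (K : R -> R -> R[i]) (M : R).
Hypothesis KM : kernel_bound M K.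
Implicit Types (u v : L2fun R) (b : bool) (s t k : R).

(** The outer factor of V- and the inner factor of V+ are both [cexpi (- k * r)], so their product
    oscillates with frequency [2 * k] against [F s], whose modulus of continuity in [r] is
    independent of [k]. *)
Lemma vop_comp_small e : 0 < e -> exists k0, forall k, k0 <= k -> forall u,
  N2 (vop KM true k (vop KM false (- k) u)) <= e * N2 u.
Proof.
move=> e0; have [M0 KM' KU] := KM.
have e20 : 0 < e / (64 * M) by rewrite divr_gt0// mulr_gt0.
have e10 : 0 < e / (64 * M) / 4 by rewrite divr_gt0.
have [d1 d10 d1P] := KU _ e10; have [d2 d20 d2P] := vint_equicontinuous KM e20.
pose d := Num.min d1 d2; have d0 : 0 < d by rewrite lt_min d10.
pose n := (Num.truncn (2 / d)).+1.
have nd : 2 <= n%:R * d by rewrite -ler_pdivrMr// ltW// truncnS_gt.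
(* The [n] pieces contribute at most [8 * n * M ^ 2 / k] times [N2 u], which this makes at most
   [e / 8]. The number [n] is fixed by [e] before [k] and [u]. *)
exists (64 * n%:R * M ^+ 2 / e + 1) => k kk0 u; have u0 := N2_ge0 u.
have k0 : 0 < k.
  by apply: lt_le_trans kk0; rewrite ltr_wpDl// divr_ge0 ?(ltW e0)// !mulr_ge0// ltW.
have kn : 32 * n%:R * M ^+ 2 / k <= e / 2.
  rewrite ler_pdivrMr//; have : 64 * n%:R * M ^+ 2 / e <= k by lra.
  by rewrite ler_pdivrMr//; lra.
pose F s r := K s r * vint K false (- k) r u.
have Fc s : -1 <= s <= 1 -> cmeas (-1) 1 (F s).
  by move=> s1; apply: cmeasM; [exact: kernel_cmeas KM s1|exact: vint_cmeas KM _ _ _].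
have FA s r : -1 <= s <= 1 -> -1 <= r <= 1 -> N1 (F s r) <= 4 * M ^+ 2 * N2 u.
  move=> s1 r1; apply: le_trans (N1M _ _) _.
  have -> : 4 * M ^+ 2 * N2 u = M * (4 * M * N2 u) by ring.
  by rewrite ler_pM ?N1_ge0 ?KM' ?(vint_bound KM).
have Fe s r r' : -1 <= s <= 1 -> -1 <= r <= 1 -> -1 <= r' <= 1 -> `|r - r'| <= d ->
    N1 (F s r - F s r') <= e / 32 * N2 u.
  move=> s1 r1 r1'; rewrite le_min => /andP[rd1 rd2].
  have -> : F s r - F s r' = (K s r - K s r') * vint K false (- k) r u +
    K s r' * (vint K false (- k) r u - vint K false (- k) r' u) by rewrite /F; ring.
  have -> : e / 32 * N2 u = e / (64 * M) / 4 * (4 * M * N2 u) + M * (e / (64 * M) * N2 u).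
    by field; rewrite gt_eqF.
  apply: le_trans (N1D _ _) _; apply: lerD; apply: le_trans (N1M _ _) _; apply: ler_pM;
    rewrite ?N1_ge0 ?(vint_bound KM) ?KM' ?d2P//.
  by apply: d1P => //; rewrite subrr normr0 ltW.
have comp s : -1 <= s <= 1 -> N1 (vop KM true k (vop KM false (- k) u) s) <= e / 2 * N2 u.
  move=> s1; have /andP[l1 l2] := s1; rewrite [vop _ _ _ _ _]vfun_in//.
  have -> : vint K true k s (vop KM false (- k) u) =
      CInt (-1) s (fun r => cexpi (- (2 * k) * r) * F s r).
    apply: eq_CInt => r /andP[r1 r2]; have rI : -1 <= r <= 1 by rewrite r1 (le_trans r2).
    rewrite [l2val _ r]vfun_in// /F.
    have -> : - (2 * k) * r = - k * r + - k * r by ring.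
    by rewrite cexpiD; ring.
  apply: le_trans (N1M _ _) _.
  have k20 : 0 < 2 * k by rewrite mulr_gt0.
  have snd : s - -1 <= n%:R * d by apply: le_trans nd; lra.
  have rI r : -1 <= r <= s -> -1 <= r <= 1.
    by move=> /andP[r1 r2]; rewrite r1 (le_trans r2).
  have := N1_CInt_oscillating l1 snd k20 (cmeas_sub (lexx _) l2 (Fc s s1))
    (fun r h => FA s r s1 (rI r h))
    (fun r r' h h' => Fe s r r' s1 (rI r h) (rI r' h')).
  set X := N1 _ => XB; have X0 : 0 <= X by exact: N1_ge0.
  have XB' : X <= e / 8 * N2 u + e / 8 * N2 u.
    apply: (le_trans XB); apply: lerD.
      have eu0 : 0 <= e * N2 u by rewrite mulr_ge0// ltW.
      have -> : 2 * (e / 32 * N2 u) * (s - -1) = e * N2 u * ((s + 1) / 16) by field.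
      have -> : e / 8 * N2 u = e * N2 u * (2 / 16) by field.
      by rewrite ler_wpM2l// ler_wpM2r//; lra.
    have -> : n%:R * (4 * (4 * M ^+ 2 * N2 u) / (2 * k)) =
        (32 * n%:R * M ^+ 2 / k) / 4 * N2 u by field; rewrite gt_eqF.
    by rewrite ler_wpM2r//; lra.
  apply: (@le_trans _ _ (2 * X)); first by rewrite ler_wpM2r// N1_cexpi.
  by lra.
have [_] := L2_bounded (vfun_cmeas KM true k (vop KM false (- k) u)) comp.
by move=> /le_trans; apply; rewrite /N2; lra.
Qed.

Definition kop k u := vop KM true k u + vop KM false (- k) u.

Lemma kop_lin k a u v : kop k (a *: u + v) = a *: kop k u + kop k v.
Proof. by rewrite /kop !vop_lin scalerDr addrACA. Qed.

Lemma kop_stable : exists C k0, 0 < C /\ forall k, k0 <= k -> forall u,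
  N2 u <= C * N2 (u - kop k u).
Proof.
have [C1 C10 S1] := volterra_stable KM true.
have [C2 C20 S2] := volterra_stable KM false.
pose C := C2 * C1; have C0 : 0 < C by rewrite mulr_gt0.
(* The composition then costs at most half of [N2 u], which is absorbed on the left and doubles the
   constant. *)
have e0 : 0 < (2 * C)^-1 by rewrite invr_gt0 mulr_gt0.
have [k0 small] := vop_comp_small e0.
exists (2 * C), k0; split=> [|k kk0 u]; first by rewrite mulr_gt0.
set w := u - vop KM false (- k) u.
have wE : w - vop KM true k w = (u - kop k u) + vop KM true k (vop KM false (- k) u).
  have -> : vop KM true k w = vop KM true k u - vop KM true k (vop KM false (- k) u).
    by rewrite /w addrC -scaleN1r vop_lin scaleN1r addrC.
  rewrite /w /kop opprB opprD -!addrA; congr (u + _).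
  by rewrite [RHS]addrCA; congr (_ + _); rewrite addrC.
have h1 : N2 u <= C2 * N2 w by exact: S2.
have h2 : N2 w <= C1 * N2 (w - vop KM true k w) by exact: S1.
rewrite wE in h2.
have h3 := N2D (u - kop k u) (vop KM true k (vop KM false (- k) u)).
have h4 := small k kk0 u.
have h5 : N2 u <= C * (N2 (u - kop k u) + (2 * C)^-1 * N2 u).
  apply: (le_trans h1); rewrite /C -mulrA ler_wpM2l ?(ltW C20)//.
  apply: (le_trans h2); rewrite ler_wpM2l ?(ltW C10)//.
  by apply: (le_trans h3); rewrite lerD2l.
have : C * ((2 * C)^-1 * N2 u) = N2 u / 2 by field; rewrite gt_eqF.
by rewrite mulrDr in h5; lra.
Qed.

End OscillatoryOperator.

(** * Approximation of the range of the operator by the trial space *)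

Section OscillatorySplines.
Variables (R : realType) (K : R -> R -> R[i]) (M : R).
Hypothesis KM : kernel_bound M K.
Implicit Types (u v : L2fun R) (b : bool) (s k : R).

Lemma Kop_kop k u s : -1 <= s <= 1 -> Kop K k u s = kop KM k u s.
Proof.
move=> s1; have /andP[l1 l2] := s1; have [M0 KB _] := KM.
rewrite l2valD /= !vfun_in//.
set f := fun t => K s t * cexpi (k * `|s - t|) * u t.
have N11 : -1 <= 1 :> R by lra.
have ca : continuous (fun t : R => k * `|s - t|).
  move=> t; apply: cvgM; first exact: cvg_cst.
  by apply: cvg_norm; apply: cvgB; [exact: cvg_cst|exact: cvg_id].
have me : cmeas (-1) 1 (fun t => cexpi (k * `|s - t|)).
  split; apply: measurable_itv_continuous => t; rewrite /cexpi /=.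
    by apply: (@continuous_comp _ _ _ (fun t => k * `|s - t|) (@cos R));
      [exact: ca|exact: continuous_cos].
  by apply: (@continuous_comp _ _ _ (fun t => k * `|s - t|) (@sin R));
    [exact: ca|exact: continuous_sin].
have rf : crint (-1) 1 f.
  apply: (crintM_bounded (M := M * 2)); last exact: L2_crint.
    by apply: cmeasM => //; exact: kernel_cmeas KM s1.
  move=> t t1; apply: le_trans (N1M _ _) _.
  by rewrite ler_pM ?N1_ge0 ?N1_cexpi ?KB.
have -> : Kop K k u s = CInt (-1) 1 f by [].
rewrite (CInt_split l1 l2 rf) /vint /lo /hi.
rewrite -(CIntZ _ (vint_crint KM k u s1 (lexx _) l2)).
rewrite -(CIntZ _ (vint_crint KM (- k) u s1 l1 (lexx _))).
congr (_ + _); apply: eq_CInt => t /andP[t1 t2]; rewrite /f.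
  rewrite ger0_norm ?subr_ge0// mulrBr -mulNr cexpiD; ring.
rewrite ler0_norm ?subr_le0// opprB mulrBr addrC -mulNr cexpiD opprK; ring.
Qed.

Lemma L2_cexpiM (w : R -> R[i]) k : L2 w -> L2 (fun x => w x * cexpi (k * x)).
Proof.
move=> Lw; have [m1 m2] := @cmeas_cexpi R (-1) 1 k.
have := @L2M_bounded _ (fun x => cexpi (k * x)) w 1 m1 m2 _ Lw.
rewrite (_ : (fun x => cexpi (k * x) * w x) = (fun x => w x * cexpi (k * x))).
  by apply=> x _; rewrite /cexpi /cre /cim /= cos_max sin_max.
by apply/funext => x; rewrite mulrC.
Qed.

Lemma spline_uniform_approx m d e N t (g : R -> R[i]) : (0 < m)%N -> is_partition N t ->
  2 ^+ m.-1 * mesh N t <= d ->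
  (forall x y, -1 <= x <= 1 -> -1 <= y <= 1 -> `|x - y| <= d -> N1 (g x - g y) <= e) ->
  exists s : R -> R[i], [/\ spline m N t s, L2 s & forall x, -1 <= x <= 1 -> N1 (g x - s x) <= 2 * e].
Proof.
move=> m0 tP md ge.
have [|s1 T1 h1] := @tspline_uniform_approx _ _ _ tP m.-1 (fun x => cre (g x)) e.
- move=> x y x1 y1 xy; rewrite -creN -creD; apply: le_trans (cre_N1 _) _.
  by apply: ge => //; exact: le_trans md.
have [|s2 T2 h2] := @tspline_uniform_approx _ _ _ tP m.-1 (fun x => cim (g x)) e.
- move=> x y x1 y1 xy; rewrite -cimN -cimD; apply: le_trans (cim_N1 _) _.
  by apply: ge => //; exact: le_trans md.
exists (fun x => s1 x +i* s2 x); split; first exact: spline_tspline.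
  by apply/L2P; split; [exact: tspline_sqint T1|exact: tspline_sqint T2].
by move=> x x1; rewrite /N1 !cE; have := h1 x x1; have := h2 x x1; lra.
Qed.

Lemma Vspace_of_splines m k N t (s1 s2 s3 : R -> R[i]) :
  spline m N t s1 -> spline m N t s2 -> spline m N t s3 -> L2 s1 -> L2 s2 -> L2 s3 ->
  exists2 v : L2fun R, Vspace m k N t v &
    forall x, v x = s1 x * cexpi (k * x) + s2 x * cexpi (- (k * x)) + s3 x.
Proof.
move=> S1 S2 S3 L1 L2' L3.
have L : L2 (fun x => s1 x * cexpi (k * x) + s2 x * cexpi (- (k * x)) + s3 x).
  apply: L2D => //; apply: L2D; first exact: L2_cexpiM.
  by have := L2_cexpiM (- k) L2'; under eq_fun do rewrite mulNr.
by exists (MkL2fun L) => //; exists s1, s2, s3.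
Qed.

(** Splines replace the two factors [vint], and the non-oscillating component is 0. The 16 in
    [e / 16] collects four factors 2: real and imaginary parts, the bound of [cexpi], the two terms,
    and [L2_bounded]. *)
Lemma kop_approx m e : (0 < m)%N -> 0 < e -> exists2 h0, 0 < h0 &
  forall k N t, is_partition N t -> mesh N t < h0 -> forall u,
  exists2 v : L2fun R, Vspace m k N t v & N2 (kop KM k u - v) <= e * N2 u.
Proof.
move=> m0 e0; have e160 : 0 < e / 16 by rewrite divr_gt0.
have [d d0 dP] := vint_equicontinuous KM e160.
have p0 : 0 < 2 ^+ m.-1 :> R by rewrite exprn_gt0.
exists (d / 2 ^+ m.-1) => [|k N t tP mh u]; first by rewrite divr_gt0.
have md : 2 ^+ m.-1 * mesh N t <= d by rewrite mulrC -ler_pdivlMr// ltW.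
have [s1 [S1 L1 h1]] := spline_uniform_approx m0 tP md
  (fun x y x1 y1 xy => dP true k u x y x1 y1 xy).
have [s2 [S2 L2' h2]] := spline_uniform_approx m0 tP md
  (fun x y x1 y1 xy => dP false (- k) u x y x1 y1 xy).
have S3 : spline m N t (fun=> 0).
  by have := spline_tspline tP m0 (tspline_cst N t m.-1 0) (tspline_cst N t m.-1 0).
have [v Vv vE] := Vspace_of_splines k S1 S2 S3 L1 L2' (@L2_cst0 R).
exists v => //.
have bnd x : -1 <= x <= 1 -> N1 ((kop KM k u - v) x) <= e / 2 * N2 u.
  move=> x1; rewrite l2valB l2valD /= !vfun_in// vE addr0 !mulNr.
  have -> : cexpi (k * x) * vint K true k x u + cexpi (- (k * x)) * vint K false (- k) x u -
      (s1 x * cexpi (k * x) + s2 x * cexpi (- (k * x))) =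
    cexpi (k * x) * (vint K true k x u - s1 x) +
    cexpi (- (k * x)) * (vint K false (- k) x u - s2 x) by ring.
  have -> : e / 2 * N2 u = 2 * (2 * (e / 16 * N2 u)) + 2 * (2 * (e / 16 * N2 u)) by field.
  apply: le_trans (N1D _ _) _; apply: lerD; apply: le_trans (N1M _ _) _.
    by apply: ler_pM; [exact: N1_ge0|exact: N1_ge0|exact: N1_cexpi|exact: h1].
  by apply: ler_pM; [exact: N1_ge0|exact: N1_ge0|exact: N1_cexpi|exact: h2].
have [_] := L2_bounded (crint_cmeas (L2_crint (kop KM k u - v))) bnd.
by move=> /le_trans; apply; rewrite /N2; lra.
Qed.

End OscillatorySplines.

(** * The trial space *)

Section BestApproximation.
Variables (R : realType).
Local Notation mu := (@lebesgue_measure R).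
Implicit Types (u v : L2fun R).

Lemma N2_ae u v : aeI u v -> N2 u = N2 v.
Proof.
move=> uv; apply/eqP; rewrite -(@eqrXn2 _ 2)// ?N2_ge0//; apply/eqP.
rewrite /N2 !L2norm_sqr; [|exact: l2valP|exact: l2valP].
have [u1 u2] := (L2P u).1 (l2valP u); have [v1 v2] := (L2P v).1 (l2valP v).
congr (_ + _); apply: eq_Int_ae; [exact: u1.2|exact: v1.2| |exact: u2.2|exact: v2.2|];
  by move: uv; apply: aeS => x uvx /uvx ->.
Qed.

Lemma csq_cexpi (z : R[i]) (x : R) : csq (z * cexpi x) = csq z.
Proof.
rewrite /csq /cexpi !cE; have := cos2Dsin2 x => h.
have -> : (cre z * cos x - cim z * sin x) ^+ 2 + (cre z * sin x + cim z * cos x) ^+ 2 =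
  (cre z ^+ 2 + cim z ^+ 2) * (cos x ^+ 2 + sin x ^+ 2) by ring.
by rewrite h mulr1.
Qed.

Lemma L2norm_cexpi (w : R -> R[i]) (k : R -> R) :
  L2norm (fun x => w x * cexpi (k x)) = L2norm w.
Proof.
by rewrite /L2norm; congr Num.sqrt; apply: eq_Rintegral => x _; rewrite csq_cexpi.
Qed.

Lemma Hm_norm_chain m (w : R -> R[i]) e : Hm m w -> 0 < e ->
  exists2 D, Hm_chain m w D & L2norm (D m) <= Hm_norm m w + e.
Proof.
move=> [D0 D0w] e0; rewrite /Hm_norm; set S := (X in ereal_inf X).
have S0 x : S x -> (0 <= x)%E by move=> [D _ <-]; rewrite lee_fin sqrtr_ge0.
have Sfin : ereal_inf S \is a fin_num.
  rewrite ge0_fin_numE; last exact: le_ereal_inf_tmp.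
  apply: le_lt_trans (ltry (Num.sqrt (\sum_(j < m.+1) L2norm (D0 j) ^+ 2))).
  by apply: ereal_inf_lbound; exists D0.
have [_ [D Dw <-]] := lb_ereal_inf_adherent e0 Sfin.
rewrite -(fineK Sfin) -EFinD lte_fin => /ltW De; exists D => //.
apply: le_trans De.
rewrite -[leLHS]ger0_norm ?L2norm_ge0// -sqrtr_sqr ler_wsqrtr//.
by rewrite big_ord_recr/= lerDr sumr_ge0// => i _; exact: sqr_ge0.
Qed.

Lemma Hm_spline_approx m : (0 < m)%N -> exists2 C, 0 < C & forall (w : R -> R[i]) e N t,
  Hm m w -> 0 < e -> is_partition N t -> exists s w0 : R -> R[i],
  [/\ spline m N t s, L2 s, L2 w0, aeI w0 w &
      L2norm (fun x => w0 x - s x) <= C * mesh N t ^+ m * (Hm_norm m w + e)].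
Proof.
move=> m0; have [C C0 CP] := @sobolev_spline_approx R m m0.
exists C => // w e N t Hw e0 tP; have [D Dw De] := Hm_norm_chain Hw e0.
have [s [Ss Ls sB]] := CP w D Dw N t tP; have [D0 LD _] := Dw.
exists s, (D 0%N); split=> //; first exact: LD.
apply: (le_trans sB); rewrite ler_wpM2l// mulr_ge0 ?(ltW C0)// exprn_ge0//.
exact/ltW/(mesh_gt0 tP).
Qed.

(** Multiplication by [cexpi] preserves the norm, so the three spline errors add up with a constant
    independent of [k]. *)
Lemma osc_approx m : (0 < m)%N -> exists2 C, 0 < C &
  forall k N t u (w1 w2 w3 : R -> R[i]) e, Hm m w1 -> Hm m w2 -> Hm m w3 -> 0 < e ->
  is_partition N t ->
  aeI u (fun x => w1 x * cexpi (k * x) + w2 x * cexpi (- (k * x)) + w3 x) ->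
  exists2 v : L2fun R, Vspace m k N t v &
    N2 (u - v) <= C * mesh N t ^+ m * (Hm_norm m w1 + Hm_norm m w2 + Hm_norm m w3 + e).
Proof.
move=> m0; have [C C0 CP] := Hm_spline_approx m0; exists C => //.
move=> k N t u w1 w2 w3 e H1 H2 H3 e0 tP uw.
have e30 : 0 < e / 3 by rewrite divr_gt0.
have [s1 [d1 [S1 Ls1 Ld1 a1 b1]]] := CP w1 _ N t H1 e30 tP.
have [s2 [d2 [S2 Ls2 Ld2 a2 b2]]] := CP w2 _ N t H2 e30 tP.
have [s3 [d3 [S3 Ls3 Ld3 a3 b3]]] := CP w3 _ N t H3 e30 tP.
have [v Vv vE] := Vspace_of_splines k S1 S2 S3 Ls1 Ls2 Ls3.
exists v => //.
pose p1 := MkL2fun (L2_cexpiM k (L2B Ld1 Ls1)).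
pose p2 := MkL2fun (L2_cexpiM (- k) (L2B Ld2 Ls2)).
pose p3 := MkL2fun (L2B Ld3 Ls3).
have -> : N2 (u - v) = N2 (p1 + p2 + p3).
  apply: N2_ae; have a12 : {ae mu, forall x, Iset x -> d1 x = w1 x /\ d2 x = w2 x}.
    by apply: aeS2 a1 a2 => x h1 h2 xI; rewrite h1// h2.
  have a123 : {ae mu, forall x, Iset x -> [/\ d1 x = w1 x, d2 x = w2 x & d3 x = w3 x]}.
    by apply: aeS2 a12 a3 => x h1 h2 xI; have [-> ->] := h1 xI; rewrite h2.
  apply: aeS2 uw a123 => x h1 h2 xI; have [e1 e2 e3] := h2 xI.
  by rewrite l2valB !l2valD /= h1// vE e1 e2 e3 mulNr; ring.
apply: le_trans (N2D _ _) _; apply: (@le_trans _ _ (N2 p1 + N2 p2 + N2 p3)).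
  by rewrite lerD2r N2D.
have -> : C * mesh N t ^+ m * (Hm_norm m w1 + Hm_norm m w2 + Hm_norm m w3 + e) =
  C * mesh N t ^+ m * (Hm_norm m w1 + e / 3) + C * mesh N t ^+ m * (Hm_norm m w2 + e / 3)
  + C * mesh N t ^+ m * (Hm_norm m w3 + e / 3) by field.
by rewrite /N2 !lerD// L2norm_cexpi.
Qed.

End BestApproximation.

(** * Finite dimensionality of the trial space *)

Section FiniteDimension.
Variables (R : realType) (m N : nat) (k : R) (t : nat -> R).
Local Notation mu := (@lebesgue_measure R).
Hypothesis tP : is_partition N t.
Implicit Types (u v : R -> R[i]).

Lemma knot_or_piece x : -1 <= x <= 1 ->
  (exists2 j, (j <= N.+1)%N & x = t j) \/ (exists2 j, (j <= N)%N & t j < x < t j.+1).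
Proof.
case: (tP) => t0 t1 _ /andP[x1 x2].
suff H j : (j <= N.+1)%N -> x <= t j -> (exists2 i, (i <= N.+1)%N & x = t i) \/
    (exists2 i, (i <= N)%N & t i < x < t i.+1).
  by apply: (H N.+1) => //; rewrite t1.
elim: j => [|j ih] jN xj.
  by left; exists 0%N => //; apply/eqP; rewrite eq_le xj t0.
have [xt|tx] := leP x (t j); first exact: ih (ltnW jN) xt.
move: xj; rewrite le_eqVlt => /predU1P[->|xj]; first by left; exists j.+1.
by right; exists j => //; rewrite tx.
Qed.

(** Needed because a spline of order 1 may take any values at the knots. [g] is patched with the
    values of [f] at the exceptional points. *)
Lemma measurable_off_finite (f g : R -> R) (s : seq R) :
  measurable_fun `[(-1 : R), 1] g ->
  (forall x, -1 <= x <= 1 -> x \notin s -> f x = g x) -> measurable_fun `[(-1 : R), 1] f.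
Proof.
move=> mg fg; pose h := foldr (fun a h x => if x == a then f a else h x) g s.
have mh : measurable_fun `[(-1 : R), 1] h.
  rewrite /h; elim: s {fg h} => //= a s ih.
  apply: measurable_fun_if => //; first exact: measurable_fun_eqr.
  by apply: measurable_funS ih => //; exact: subIsetl.
apply: eq_measurable_fun mh => x; rewrite inE/= in_itv/= => x1.
have : x \notin s -> f x = g x by exact: fg.
rewrite /h; elim: s {fg h} => [/(_ isT)->//|a s ih] /=.
rewrite inE negb_or; case: eqVneq => [->//|xa] /= fgx.
exact: ih.
Qed.

Lemma ae_off_finite (P : R -> Prop) (s : seq R) : (forall x, x \notin s -> P x) ->
  {ae mu, forall x, P x}.
Proof.
move=> sP; have cs : countable [set` s] by exact/finite_set_countable/finite_seq.
exists [set` s]; split=> //.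
- exact: countable_measurable.
- exact: countable_lebesgue_measure0.
- by move=> x /= nP; apply: contrapT => /= xs; apply: nP; apply: sP; apply/negP.
Qed.

Lemma L2_off_finite u (v : L2fun R) (s : seq R) :
  (forall x, -1 <= x <= 1 -> x \notin s -> u x = v x) -> L2 u /\ aeI u v.
Proof.
move=> uv; have [v1 v2] := (L2P v).1 (l2valP v).
have m1 : measurable_fun `[(-1 : R), 1] (fun x => cre (u x)).
  by apply: (measurable_off_finite (s := s) v1.1) => x x1 xs; rewrite uv.
have m2 : measurable_fun `[(-1 : R), 1] (fun x => cim (u x)).
  by apply: (measurable_off_finite (s := s) v2.1) => x x1 xs; rewrite uv.
have ae : aeI u v.
  by apply: (@ae_off_finite _ s) => x xs; rewrite /Iset /= in_itv/= => x1; exact: uv.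
split=> //; split=> //; case: (l2valP v) => _ _; apply: le_lt_trans.
have mc (w : R -> R[i]) : measurable_fun `[(-1 : R), 1] (fun x => cre (w x)) ->
    measurable_fun `[(-1 : R), 1] (fun x => cim (w x)) ->
    measurable_fun (@Iset R) (fun x => (csq (w x))%:E).
  by move=> w1 w2; apply/measurable_EFinP; apply: measurable_funD; apply: measurable_funX.
rewrite le_eqVlt; apply/orP; left; apply/eqP; apply: ae_eq_integral => //.
- exact: measurable_itv.
- exact: (mc u m1 m2).
- exact: (mc v v1.1 v2.1).
- by move: ae; apply: aeS => x h xI; rewrite h.
Qed.

Definition osc (q : 'I_3) (x : R) : R[i] :=
  if q == 0 then cexpi (k * x) else if q == 1 then cexpi (- (k * x)) else 1.

(** The index holds a cell, a degree, an oscillation and the choice of 1 or ['i], the span being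
    real. These functions ignore the smoothness conditions at the knots and serve only to bound the
    dimension. *)
Definition gen_fun (i : 'I_N.+1 * 'I_m * 'I_3 * bool) (x : R) : R[i] :=
  if (t i.1.1.1 < x) && (x < t i.1.1.1.+1)
  then (if i.2 then 'i else 1) * x%:C ^+ i.1.1.2 * osc i.1.2 x else 0.

Lemma gen_fun_L2 i : L2 (gen_fun i).
Proof.
case: i => [[[j l] q] c].
pose chi (x : R) : R := if (t j < x) && (x < t j.+1) then x ^+ l else 0.
have chiE x : gen_fun (j, l, q, c) x =
    (if c then 'i else 1) * (osc q x * (chi x)%:C).
  rewrite /gen_fun /chi /=; case: ifP => _; last by rewrite !mulr0.
  by rewrite rmorphXn -mulrA [_ ^+ _ * _]mulrC.
suff L : L2 (fun x => osc q x * (chi x)%:C).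
  have := L2Z (if c then 'i else 1) L; congr L2.
  by apply/funext => x; rewrite chiE.
have Lchi : L2 (fun x => (chi x)%:C).
  have mchi : measurable_fun `[(-1 : R), 1] chi.
    apply: measurable_funTS; apply: measurable_fun_ifT => //.
    by apply: measurable_and; apply: measurable_fun_ltr.
  apply: (@L2_bounded _ _ 1 _ _).1 => [|x x1]; first by split.
  rewrite /N1 !cE normr0 addr0 /chi; case: ifP => _; last by rewrite normr0.
  by rewrite normrX exprn_ile1// ler_norml.
have eq_L2 (f g : R -> R[i]) : (forall x, f x = g x) -> L2 f -> L2 g by move=> /funext ->.
rewrite /osc; case: (q == 0).
  by apply: eq_L2 (L2_cexpiM k Lchi) => x; rewrite mulrC.
case: (q == 1).
  by apply: eq_L2 (L2_cexpiM (- k) Lchi) => x; rewrite mulrC mulNr.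
by apply: eq_L2 Lchi => x; rewrite mul1r.
Qed.

Definition gen i : L2fun R := MkL2fun (gen_fun_L2 i).

Lemma Vspace_span v : Vspace m k N t v -> exists c : 'I_N.+1 * 'I_m * 'I_3 * bool -> R,
  forall x, -1 <= x <= 1 -> x \notin [seq t j | j <- iota 0 N.+2] ->
    v x = (\sum_i c i *: gen i) x.
Proof.
move=> [s1 [s2 [s3 [[p1 _] [p2 _] [p3 _] vE]]]].
have /choice[P1 P1E] : forall j : 'I_N.+1, exists p : {poly R[i]}, (size p <= m)%N /\
  forall x, t j < x < t j.+1 -> s1 x = p.[x%:C] by move=> j; exact: (p1 j (ltn_ord j)).
have /choice[P2 P2E] : forall j : 'I_N.+1, exists p : {poly R[i]}, (size p <= m)%N /\
  forall x, t j < x < t j.+1 -> s2 x = p.[x%:C] by move=> j; exact: (p2 j (ltn_ord j)).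
have /choice[P3 P3E] : forall j : 'I_N.+1, exists p : {poly R[i]}, (size p <= m)%N /\
  forall x, t j < x < t j.+1 -> s3 x = p.[x%:C] by move=> j; exact: (p3 j (ltn_ord j)).
pose P (q : 'I_3) := if q == 0 then P1 else if q == 1 then P2 else P3.
have PE q j : (size (P q j) <= m)%N.
  by rewrite /P; case: ifP => _; [case: (P1E j)|case: ifP => _; [case: (P2E j)|case: (P3E j)]].
pose c (i : 'I_N.+1 * 'I_m * 'I_3 * bool) : R :=
  let z := (P i.1.2 i.1.1.1)`_(i.1.1.2) in if i.2 then cim z else cre z.
exists c => x x1 xk.
case: (knot_or_piece x1) => [[j jN xj]|[j jN xj]].
  by move: xk; rewrite xj map_f// mem_iota.
pose j0 : 'I_N.+1 := Ordinal (jN : (j < N.+1)%N).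
rewrite l2val_sum.
have hE (q : 'I_3) : (P q j0).[x%:C] * osc q x =
    \sum_(l < m) \sum_(b : bool) (c (j0, l, q, b) *: gen (j0, l, q, b)) x.
  rewrite (horner_coef_wide _ (PE q j0)) mulr_suml; apply: eq_bigr => l _.
  rewrite big_bool !l2valZ /= /gen_fun /= xj /c /= mul1r.
  set z := (P q j0)`_l.
  have zE : z = (cim z)%:C * 'i%C + (cre z)%:C.
    by apply: complex_eq; rewrite !cE /cre /cim /=; ring.
  by rewrite {1}zE; ring.
have vx : v x = \sum_(q < 3) (P q j0).[x%:C] * osc q x.
  rewrite !big_ord_recl big_ord0 /P /osc /= addr0 mulr1 vE addrA.
  by rewrite (P1E j0).2 ?(P2E j0).2 ?(P3E j0).2.
have splitE (F : 'I_N.+1 * 'I_m * 'I_3 * bool -> R[i]) :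
    \sum_i F i = \sum_j \sum_l \sum_q \sum_b F (j, l, q, b).
  by rewrite !pair_bigA/=; apply: eq_bigr => -[[[? ?] ?] ?].
pose G j := \sum_l \sum_q \sum_b (c (j, l, q, b) *: gen (j, l, q, b)) x.
have -> : \sum_i (c i *: gen i) x = G j0; last first.
  by rewrite vx /G exchange_big; apply: eq_bigr => q _; exact: hE.
transitivity (\sum_j G j); first exact: splitE.
rewrite (bigD1 j0)//= big1 ?addr0// => i ij0.
rewrite /G big1// => l _; rewrite big1// => q _; rewrite big1// => b _.
rewrite l2valZ /= /gen_fun /= ifF ?mulr0//; apply/negbTE/negP => /andP[ix xi].
move/andP : xj => [jx xj'].
have [ij|ji|ij] := ltngtP (i : nat) j.
- have := partition_homo tP ij (leqW jN) => h.
  by have := lt_le_trans xi h; rewrite ltNge (ltW jx).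
- have := partition_homo tP ji (leqW (ltn_ord i : (i <= N)%N)) => h.
  by have := lt_le_trans xj' h; rewrite ltNge (ltW ix).
- by move: ij0; rewrite -val_eqE /= ij eqxx.
Qed.

End FiniteDimension.

(** * Linear structure of the trial space *)

Section VspaceClosure.
Variables (R : realType) (m N : nat) (k : R) (t : nat -> R).
Hypothesis tP : is_partition N t.
Local Notation mu := (@lebesgue_measure R).
Local Notation V := (Vspace m k N t).

Lemma eq_Ck_on n (f g : R -> R) : f =1 g -> Ck_on n f -> Ck_on n g.
Proof. by move=> /funext ->. Qed.

Lemma splineD (s1 s2 : R -> R[i]) : spline m N t s1 -> spline m N t s2 ->
  spline m N t (fun x => s1 x + s2 x).
Proof.
move=> [p1 c1] [p2 c2]; split=> [j jN|m2].
  have [p [sp pE]] := p1 j jN; have [q [sq qE]] := p2 j jN.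
  exists (p + q); split=> [|x xj]; last by rewrite hornerD pE// qE.
  by rewrite (leq_trans (size_polyD _ _))// geq_max sp.
have [r1 i1] := c1 m2; have [r2 i2] := c2 m2; split.
  by apply: eq_Ck_on (Ck_onD r1 r2) => x; rewrite cE.
by apply: eq_Ck_on (Ck_onD i1 i2) => x; rewrite cE.
Qed.

Lemma splineZ (c : R[i]) (s : R -> R[i]) : spline m N t s ->
  spline m N t (fun x => c * s x).
Proof.
move=> [p1 c1]; split=> [j jN|m2].
  have [p [sp pE]] := p1 j jN.
  exists (c *: p); split=> [|x xj]; last by rewrite hornerZ pE.
  by rewrite (leq_trans (size_scale_leq _ _)).
have [r1 i1] := c1 m2; split.
  apply: eq_Ck_on (Ck_onD (Ck_onZ (cre c) r1) (Ck_onZ (- cim c) i1)) => x.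
  by rewrite cE mulNr.
by apply: eq_Ck_on (Ck_onD (Ck_onZ (cre c) i1) (Ck_onZ (cim c) r1)) => x; rewrite cE.
Qed.

Lemma VspaceD (u v : R -> R[i]) : V u -> V v -> V (fun x => u x + v x).
Proof.
move=> [s1 [s2 [s3 [h1 h2 h3 uE]]]] [r1 [r2 [r3 [g1 g2 g3 vE]]]].
exists (fun x => s1 x + r1 x), (fun x => s2 x + r2 x), (fun x => s3 x + r3 x).
split; [exact: splineD|exact: splineD|exact: splineD|].
by move=> x; rewrite uE vE; ring.
Qed.

Lemma VspaceZ (c : R[i]) (u : R -> R[i]) : V u -> V (fun x => c * u x).
Proof.
move=> [s1 [s2 [s3 [h1 h2 h3 uE]]]].
exists (fun x => c * s1 x), (fun x => c * s2 x), (fun x => c * s3 x).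
split; [exact: splineZ|exact: splineZ|exact: splineZ|].
by move=> x; rewrite uE; ring.
Qed.

Lemma spline0 : spline m N t (fun=> 0 : R[i]).
Proof.
split=> [j _|_]; first by exists 0; split=> [|x _]; rewrite ?size_poly0 ?horner0.
have C0 : Ck_on (m - 2) (fun=> 0 : R).
  exists (fun _ _ => 0); split=> // j jm; first exact: continuous_subspaceT (@cst_continuous _ _ _).
  by move=> _ _; exact: is_derive_cst.
by split.
Qed.

Lemma Vspace0 : V (fun=> 0).
Proof.
exists (fun=> 0), (fun=> 0), (fun=> 0); split; try exact: spline0.
by move=> x; rewrite !mul0r !addr0.
Qed.

Lemma Vspace_L2 (v : R -> R[i]) : V v -> L2 v.
Proof.
move=> /(Vspace_span tP)[c cE].
by case: (L2_off_finite cE).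
Qed.

Definition generator (i : 'I_#|{: 'I_N.+1 * 'I_m * 'I_3 * bool}|) : L2fun R :=
  gen k t (enum_val i).

Lemma Vspace_generators (v : L2fun R) : V v -> exists c : 'rV[R]_#|{: 'I_N.+1 * 'I_m * 'I_3 * bool}|,
  null (@l2form R) (v - lincomb c generator).
Proof.
move=> /(Vspace_span tP)[c cE]; exists (\row_i c (enum_val i)).
have -> : lincomb (\row_i c (enum_val i)) generator = \sum_i c i *: gen k t i.
  rewrite /lincomb [RHS](reindex _ (onW_bij _ (@enum_val_bij _))).
  by apply: eq_bigr => i _; rewrite mxE.
set w := \sum_i _; have [_ vw] := L2_off_finite cE.
have nrm0 : nrm (@l2form R) (v - w) = 0.
  rewrite -N2_nrm (_ : N2 _ = N2 (0 : L2fun R)); last first.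
    apply: N2_ae; move: vw; apply: aeS => x h /h.
    by rewrite l2valB => ->; rewrite subrr.
  by rewrite N2_nrm /nrm (sform0l (@l2formZ R)) sqrtr0.
by rewrite /null -[LHS](sqr_sqrtr (l2form_ge0 _)) -/(nrm _ _) nrm0 expr0n.
Qed.

End VspaceClosure.

(** * The Galerkin estimate *)

Section GalerkinEstimate.
Variables (R : realType) (m : nat) (K : R -> R -> R[i]) (M : R).
Hypothesis KM : kernel_bound M K.
Local Notation mu := (@lebesgue_measure R).
Implicit Types (u v w y : L2fun R).

Definition residual k u := u - kop KM k u.

Lemma residual_lin k a u v : residual k (a *: u + v) = a *: residual k u + residual k v.
Proof. by rewrite /residual kop_lin scalerBr opprD addrACA. Qed.

Lemma ip_l2form u v (v' : L2fun R) : (forall x, v' x = 'i%C * v x) ->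
  ip u v = l2form u v +i* l2form u v'.
Proof.
move=> v'E; have [r1 r2] := l2rint u v; have [q1 q2] := l2rint u v'.
rewrite /ip /Cint /l2form; congr (_ +i* _).
  rewrite -(IntD r1 r2); apply: eq_Int => x _; rewrite !cE; ring.
rewrite -(IntD q1 q2); apply: eq_Int => x _; rewrite v'E !cE /cre /cim /=; ring.
Qed.

Lemma l2_mul_i v : exists v' : L2fun R, forall x, v' x = 'i%C * v x.
Proof. by exists (MkL2fun (L2Z 'i%C (l2valP v))). Qed.

(** No measurability is assumed, since the right-hand side [f] is only known to agree almost
    everywhere with a square integrable function. *)
Lemma ip_ae (f1 f2 v : R -> R[i]) : aeI f1 f2 -> ip f1 v = ip f2 v.
Proof.
move=> f12; rewrite /ip /Cint /Rintegral; congr (fine _ +i* fine _);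
  apply: integral_ae_nonmeasurable; move: f12; apply: aeS => x h xI; by rewrite h.
Qed.

(** The trial space is stable under multiplication by ['i], so the real parts of the equations
    tested with [v] and with ['i] times [v] amount to the complex equation. *)
Lemma galerkin_solP k (f : R -> R[i]) N t (g u : L2fun R) : is_partition N t -> aeI g f ->
  galerkin_sol m K k f N t u <->
  Vspace m k N t u /\
    forall v, Vspace m k N t v -> l2form (residual k u) v = l2form g v.
Proof.
move=> tP gf.
have kE v : ip (Kop K k u) v = ip (kop KM k u) v.
  by rewrite /ip /Cint; congr (_ +i* _); apply: eq_Int => x x1; rewrite (Kop_kop KM).
have Bres v : l2form (residual k u) v = l2form u v - l2form (kop KM k u) v.
  by rewrite /residual l2formD -scaleN1r l2formZ mulN1r.
split=> [[Vu sol]|[Vu sol]]; split=> // v Vv.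
  have [v' v'E] := l2_mul_i v; have := sol v Vv.
  rewrite kE -(ip_ae v gf) !(ip_l2form _ v'E) => -[h _].
  by rewrite Bres h addrAC subrr add0r.
pose vL := MkL2fun (Vspace_L2 tP Vv); have [v' v'E] := l2_mul_i vL.
have Vv' : Vspace m k N t v'.
  have := VspaceZ 'i%C Vv.
  by rewrite (_ : (fun x => _) = l2val v')//; apply/funext => x; rewrite v'E.
have s1 := sol vL Vv; have s2 := sol v' Vv'; rewrite !Bres in s1 s2.
have -> : v = l2val vL by [].
rewrite kE -(ip_ae vL gf) !(ip_l2form _ v'E) -s1 -s2.
by apply: complex_eq; rewrite !cE; ring.
Qed.

Lemma null_aeI0 u : N2 u = 0 -> aeI u (fun=> 0).
Proof.
move=> u0; have [u1 u2] := (L2P u).1 (l2valP u).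
have key (f : R -> R) : sqint (-1) 1 f -> Int (-1) 1 (fun x => f x ^+ 2) = 0 ->
    {ae mu, forall x, Iset x -> f x = 0}.
  move=> [mf rf] f0.
  have : (\int[mu]_(x in @Iset R) `|(f x ^+ 2)%:E| = 0)%E.
    have -> : (fun x => `|(f x ^+ 2)%:E|%E) = (fun x => (f x ^+ 2)%:E).
      by apply/funext => x; rewrite /= ger0_norm ?sqr_ge0.
    rewrite -[LHS]fineK; first by congr EFin.
    exact: integrable_fin_num rf.
  move/ae_eq_integral_abs => /(_ (measurable_itv _)) h.
  have := h (measurable_int mu rf).
  by apply: aeS => x hx xI; have := hx xI => -[/eqP]; rewrite sqrf_eq0 => /eqP.
have : N2 u ^+ 2 = 0 by rewrite u0 expr0n.
rewrite /N2 L2norm_sqr; last exact: l2valP.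
have p1 : 0 <= Int (-1) 1 (fun x => cre (u x) ^+ 2) by apply: Int_ge0 => x _; exact: sqr_ge0.
have p2 : 0 <= Int (-1) 1 (fun x => cim (u x) ^+ 2) by apply: Int_ge0 => x _; exact: sqr_ge0.
move=> s0; have z1 : Int (-1) 1 (fun x => cre (u x) ^+ 2) = 0 by lra.
have z2 : Int (-1) 1 (fun x => cim (u x) ^+ 2) = 0 by lra.
apply: aeS2 (key _ u1 z1) (key _ u2 z2) => x h1 h2 xI.
by apply: complex_eq; rewrite ?h1 ?h2.
Qed.

(* If [w] has a residual orthogonal to the trial space then the residual is no longer
   than its distance to that space; stability and smallness of the distance of [kop k w]
   turn this into quasi-optimality. *)
Lemma quasi_optimal C k N t : 0 < C ->
  (forall u, N2 u <= C * N2 (residual k u)) ->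
  (forall u, exists2 v : L2fun R, Vspace m k N t v & N2 (kop KM k u - v) <= (2 * C)^-1 * N2 u) ->
  forall w p : L2fun R, Vspace m k N t p ->
  (forall v, Vspace m k N t v -> l2form (residual k w) v = 0) ->
  N2 w <= 2 * C * N2 (w - p).
Proof.
move=> C0 stab approx w p Vp orth; have [q Vq qB] := approx w.
(* [p - q] is the trial function to compare with the residual [w - kop k w], as [p] approximates [w]
   and [q] approximates [kop k w]. *)
have Vpq : Vspace m k N t (p - q).
  have := VspaceD Vp (VspaceZ (-1) Vq); congr Vspace.
have rB : N2 (residual k w) <= N2 (w - p) + N2 (kop KM k w - q).
  have E : residual k w - (p - q) = (w - p) - (kop KM k w - q).
    rewrite /residual !opprB !addrA [LHS]addrAC [w - _ - p]addrAC.
    by rewrite [RHS]addrAC.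
  apply: le_trans (N2B _ _); rewrite -E; set r := residual k w in orth *; set z := p - q.
  have rz : l2form r z = 0 by exact: orth.
  by rewrite !N2_nrm l2form_orthogonal.
have s := stab w.
have h : C * N2 (residual k w) <= C * (N2 (w - p) + (2 * C)^-1 * N2 w).
  by rewrite ler_wpM2l ?(ltW C0)// (le_trans rB)// lerD2l.
have : C * ((2 * C)^-1 * N2 w) = N2 w / 2 by field; rewrite gt_eqF.
rewrite mulrDr in h; lra.
Qed.

End GalerkinEstimate.

(** * Infimum over decompositions and conclusion *)

Section Assembly.
Variable R : realType.

(** Each of the three norms is at most the square root [S] of the sum of their squares, whence the
    factor 3. The slack [e] is let to 0 for a fixed decomposition, before the infimum is taken. *)
Lemma le_tHm0_norm m (y : R -> R -> R[i]) k (a b C : R) : 0 < C ->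
  (forall w1 w2 w3 e, Hm m (w1 k) -> Hm m (w2 k) -> Hm m (w3 k) -> 0 < e ->
     osc_decomp y w1 w2 w3 ->
     a <= C * (Hm_norm m (w1 k) + Hm_norm m (w2 k) + Hm_norm m (w3 k) + e)) ->
  1 < k -> (a%:E <= (3 * C)%:E * tHm0_norm m y k)%E.
Proof.
move=> C0 aP k1; rewrite /tHm0_norm -ereal_inf_pZl ?mulr_gt0//.
apply: le_ereal_inf_tmp => _ [_ [[[w1 w2] w3] /= [H1 H2 H3 dec] <-] <-].
rewrite -EFinM lee_fin; set S := Num.sqrt _.
have S1 : Hm_norm m (w1 k) <= S.
  apply: le_trans (ler_norm _) _; rewrite -sqrtr_sqr ler_wsqrtr// -addrA lerDl.
  by rewrite addr_ge0 ?sqr_ge0.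
have S2 : Hm_norm m (w2 k) <= S.
  apply: le_trans (ler_norm _) _; rewrite -sqrtr_sqr ler_wsqrtr//.
  by rewrite addrAC lerDr addr_ge0 ?sqr_ge0.
have S3 : Hm_norm m (w3 k) <= S.
  apply: le_trans (ler_norm _) _; rewrite -sqrtr_sqr ler_wsqrtr//.
  by rewrite lerDr addr_ge0 ?sqr_ge0.
apply/ler_addgt0Pl => e e0; have eC0 : 0 < e / C by rewrite divr_gt0.
have := aP w1 w2 w3 (e / C) (H1.1 k k1) (H2.1 k k1) (H3.1 k k1) eC0 dec.
move/le_trans; apply.
have -> : e + 3 * C * S = C * (S + S + S + e / C) by field; rewrite gt_eqF.
by rewrite ler_wpM2l ?(ltW C0)// !lerD.
Qed.

End Assembly.

Theorem theorem6p2 (R : realType) (m : nat) (K : R -> R -> R[i])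
  (f y : R -> R -> R[i]) :
  (0 < m)%N ->
  Cm_sq m K ->
  tHm0 m f ->
  (forall kappa, 1 < kappa -> ~ one_is_eigenvalue K kappa) ->
  (forall kappa, 1 < kappa ->
     L2 (y kappa) /\ aeI (fun x => y kappa x - Kop K kappa (y kappa) x) (f kappa)) ->
  exists kappa0 c : R, [/\ 1 < kappa0, 0 < c &
    forall kappa, kappa0 <= kappa ->
    exists h0 : R, 0 < h0 /\
    forall (N : nat) (t : nat -> R), is_partition N t -> mesh N t < h0 ->
      exists yh, [/\ galerkin_sol m K kappa (f kappa) N t yh,
        (forall zh, galerkin_sol m K kappa (f kappa) N t zh -> aeI zh yh) &
        ((L2norm (fun x => y kappa x - yh x))%:E
           <= (c * mesh N t ^+ m)%:E * tHm0_norm m y kappa)%E]].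
Proof.
move=> m0 KC _ _ ysol.
have [M KM] := Cm_sq_kernel_bound KC.
have [C [k0 [C0 stab]]] := kop_stable KM.
have [D D0 osc] := @osc_approx R m m0.
have e0 : 0 < (2 * C)^-1 by rewrite invr_gt0 mulr_gt0.
have [h0 h00 approx] := kop_approx KM m0 e0.
(* [2 * C] is the quasi-optimality constant, [D] that of spline approximation, and 3 comes from
   [le_tHm0_norm]. The maximum with 2 keeps the threshold above 1. *)
exists (Num.max k0 2), (3 * (2 * C * D)); split.
- by rewrite lt_max ltr1n orbT.
- by rewrite !mulr_gt0.
move=> k; rewrite ge_max => /andP[kk0 k2]; have k1 : 1 < k by lra.
exists h0; split=> // N t tP mh.
(* [g] is a square integrable representative of the right-hand side; with it the error [yk - yh] has
   a residual exactly orthogonal to the trial space. *)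
have [Ly yf] := ysol k k1; pose yk := MkL2fun Ly; pose g := residual KM k yk.
have gf : aeI g (f k).
  move: yf; apply: aeS => x h xI; rewrite -h//.
  by rewrite /g /residual l2valB -(Kop_kop KM)//; move: xI; rewrite /Iset /= in_itv.
pose V (u : L2fun R) := Vspace m k N t u.
have V0 : V 0 by exact: Vspace0.
have VD u v : V u -> V v -> V (u + v) by exact: VspaceD.
have VZ a u : V u -> V (a *: u) by exact: VspaceZ.
have quasi := quasi_optimal C0 (stab k kk0) (approx k N t tP mh).
(* Quasi-optimality with [d] as its own approximation. *)
have unique d : V d -> (forall v, V v -> l2form (residual KM k d) v = 0) -> N2 d = 0.
  move=> Vd od; apply/eqP; rewrite eq_le N2_ge0 andbT.
  by apply: le_trans (quasi d d Vd od) _; rewrite subrr N2_nrm /nrm (sform0l (@l2formZ R)) sqrtr0 mulr0.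
have unique_null d : V d -> (forall v, V v -> l2form (residual KM k d) v = 0) ->
    null (@l2form R) d.
  move=> Vd od; rewrite /null -[LHS](sqr_sqrtr (l2form_ge0 _)) -/(nrm _ _) -N2_nrm.
  by rewrite unique// expr0n.
have [yh Vyh yhP] := galerkin_solvable (@l2formC R) (@l2formD R) (@l2formZ R) (@l2form_ge0 R)
  V0 VD VZ (@Vspace_generators R m N k t tP) g (residual_lin KM k) unique_null.
have VB u v : V u -> V v -> V (u - v).
  by move=> Vu Vv; rewrite -scaleN1r; apply: VD => //; exact: VZ.
have resB u v : residual KM k (u - v) = residual KM k u - residual KM k v.
  by rewrite addrC -scaleN1r residual_lin scaleN1r addrC.
have formB u v w : l2form (u - v) w = l2form u w - l2form v w.
  by rewrite l2formD -scaleN1r l2formZ mulN1r.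
exists yh; split.
- by apply/(@galerkin_solP R m K M KM k (f k) N t g yh tP gf); split.
- move=> zh zsol; pose z := MkL2fun (Vspace_L2 tP zsol.1).
  have [Vz zP] := (@galerkin_solP R m K M KM k (f k) N t g z tP gf).1 zsol.
  have zy : N2 (z - yh) = 0.
    apply: unique => [|v Vv]; first exact: VB.
    by rewrite resB formB zP// yhP// subrr.
  move: (null_aeI0 zy); apply: aeS => x h xI.
  by apply/eqP; rewrite -subr_eq0 -[zh x]/(z x) -l2valB h.
- have mesh0 : 0 < mesh N t ^+ m by rewrite exprn_gt0// (mesh_gt0 tP).
  have -> : 3 * (2 * C * D) * mesh N t ^+ m = 3 * (2 * C * D * mesh N t ^+ m) by ring.
  apply: le_tHm0_norm => //; first by rewrite !mulr_gt0.
  move=> w1 w2 w3 e H1 H2 H3 e1 dec.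
  have [v Vv vB] := osc k N t yk _ _ _ e H1 H2 H3 e1 tP (dec k k1).
  have -> : L2norm (fun x => y k x - yh x) = N2 (yk - yh).
    by rewrite /N2; congr L2norm; apply/funext => x; rewrite l2valB.
  have orth u : V u -> l2form (residual KM k (yk - yh)) u = 0.
    by move=> Vu; rewrite resB formB yhP// subrr.
  (* Approximating the error by [v - yh] leaves [yk - v], the distance of the exact solution to an
     arbitrary trial function. *)
  have := quasi (yk - yh) (v - yh) (VB _ _ Vv Vyh) orth.
  rewrite opprB addrA subrK => /le_trans; apply.
  by rewrite -!mulrA ler_wpM2l// ler_wpM2l ?(ltW C0)// !mulrA.
Qed.
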